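(* Let $f_{k,j}:U\simeq[0,1]^m\to\mathbb{E}^{m+1}$ be a sequence obtained iteratively by the Nash process. If $f_{k,j+1}$ is obtained from $f_{k,j}$ by the Corrugation Process $$f_{k,j+1}=f_{k,j}+\frac{r}{N}K_c(\alpha,N\pi)\,\mathbf{t}+\frac{r}{N}K_s(\alpha,N\pi)\,\mathbf{n}\qquad(N=N_{k,j+1},\ \pi=\pi_{k,j+1},\ \alpha=\alpha_{k,j+1},\ \mathbf{n}=\mathbf{n}_{k,j})$$ described in the context, then for every $p\in U$ the rotation matrix $\mathcal{L}_{k,j+1}(p,N_{k,j+1})$ that maps $\mathcal{B}^+_{k,j}(p)$ to $\mathcal{B}_{k,j+1}(p)$ satisfies $$\mathcal{L}_{k,j+1}(p,N_{k,j+1})=\begin{pmatrix}\cos\theta_{k,j+1}&0&\sin\theta_{k,j+1}\\0&\mathrm{Id}&0\\-\sin\theta_{k,j+1}&0&\cos\theta_{k,j+1}\end{pmatrix}+O\left(\frac1{N_{k,j+1}}\right),$$ where $\theta_{k,j+1}:=\alpha_{k,j+1}(p)\cos(2\pi N_{k,j+1}\pi_{k,j+1}(p))$ (in $2\pi N_{k,j+1}$ the symbol $\pi$ is the number) and $\mathrm{Id}$ is the identity matrix of size $m-1$.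
   Context: Nash process. $U\simeq[0,1]^m$ is a chart, with coordinates $\varphi^1,\dots,\varphi^m$, of an oriented $m$-manifold with Riemannian metric $g$. Starting from a strictly short immersion $f_0$ into Euclidean space $\mathbb{E}^{m+1}$, one takes metrics $g_k=f_0^*\langle\cdot,\cdot\rangle+\delta_k(g-f_0^*\langle\cdot,\cdot\rangle)$ with $\delta_k$ increasing to $1$, and builds maps $f_k$ with $f_k^*\langle\cdot,\cdot\rangle\approx g_k$ and $f_k^*\langle\cdot,\cdot\rangle\le g_{k+1}$ through intermediary maps $f_k=f_{k,0},f_{k,1},\dots,f_{k,I(k)}=f_{k+1}$. Over each chart, the desired increase of the metric (the part of $g_{k+1}-f_k^*\langle\cdot,\cdot\rangle$ cut off by a partition of unity) is decomposed as a finite sum of terms $\rho\,\ell\otimes\ell$, with coefficients $\rho\ge0$ and linear forms $\ell$ with constant coefficients in the chart. Each $f_{k,j+1}$ is built so that $f_{k,j+1}^*\langle\cdot,\cdot\rangle$ approximates $\mu_{k,j+1}=f_{k,j}^*\langle\cdot,\cdot\rangle+\rho_{k,j+1}\,\ell_{k,j+1}\otimes\ell_{k,j+1}$. Here $\ell_{k,j+1}=\sum_ic_i\,d\varphi^i=d\pi_{k,j+1}$ with $\pi_{k,j+1}=\sum_ic_i\varphi^i$. $u_{k,j+1}$ denotes any vector field with $\ell_{k,j+1}(u_{k,j+1})=1$. Corrugation Process formula. With $f=f_{k,j}$, $u=u_{k,j+1}$, $\mu=\mu_{k,j+1}$, $P=df(\ker\ell_{k,j+1})$ and $[v]^P,[v]^{P^\perp}$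 the orthogonal components of $v$ in $P\oplus P^\perp$: $$\mathbf{t}=\frac{[df(u)]^{P^\perp}}{\|[df(u)]^{P^\perp}\|},\quad r=\sqrt{\mu(u,u)-\|[df(u)]^P\|^2},\quad\alpha=J_0^{-1}\left(\frac{\|[df(u)]^{P^\perp}\|}{r}\right),$$ where $J_0(\alpha)=\int_0^1\cos(\alpha\cos2\pi t)\,dt$, $\alpha_0\approx2.4$ is its first positive root, $J_0^{-1}:[0,1]\to[0,\alpha_0]$ is the inverse of $J_0|_{[0,\alpha_0]}$, $K_c(\alpha,t)=\int_0^t(\cos(\alpha\cos2\pi s)-J_0(\alpha))\,ds$ and $K_s(\alpha,t)=\int_0^t\sin(\alpha\cos2\pi s)\,ds$. The vector $\mathbf{n}=\mathbf{n}_{k,j}$ is the unit normal to $f_{k,j}$ defined below. Bases. For $m$ vectors of $\mathbb{E}^{m+1}$, $a_1\wedge\dots\wedge a_m$ is their vector product, i.e. the vector with $\langle a_1\wedge\dots\wedge a_m,x\rangle=\det(a_1,\dots,a_m,x)$. Let $\mathbf{t}_{k,j}$ be the normalization of $df_{k,j}(u_{k,j+1})$, and for each $(k,j)$ let $(V^1_{k,j},\dots,V^{m-1}_{k,j})$ be any local basis of $\ker\ell_{k,j}$. Put $$\mathbf{n}_{k,j}=\frac{\mathbf{t}_{k,j}\wedge df_{k,j}(V^1_{k,j+1})\wedge\dots\wedge df_{k,j}(V^{m-1}_{k,j+1})}{\|\mathbf{t}_{k,j}\wedge df_{k,j}(V^1_{k,j+1})\wedge\dots\wedge df_{k,j}(V^{m-1}_{k,j+1})\|}.$$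 Let $v^1_{k,j},\dots,v^{m-1}_{k,j}$ be the Gram–Schmidt orthonormalization of $df_{k,j}(V^1_{k,j}),\dots,df_{k,j}(V^{m-1}_{k,j})$, let $v^\perp_{k,j}:=v^1_{k,j}\wedge\dots\wedge v^{m-1}_{k,j}\wedge\mathbf{n}_{k,j}$, and $\mathcal{B}_{k,j}=(v^\perp_{k,j},v^1_{k,j},\dots,v^{m-1}_{k,j},\mathbf{n}_{k,j})$, an orthonormal basis of $\mathbb{E}^{m+1}$. Let $v^{1+}_{k,j},\dots,v^{(m-1)+}_{k,j}$ be the Gram–Schmidt orthonormalization of $df_{k,j}(V^1_{k,j+1}),\dots,df_{k,j}(V^{m-1}_{k,j+1})$, let $\mathbf{t}^\perp_{k,j}:=v^{1+}_{k,j}\wedge\dots\wedge v^{(m-1)+}_{k,j}\wedge\mathbf{n}_{k,j}$, and $\mathcal{B}^+_{k,j}=(\mathbf{t}^\perp_{k,j},v^{1+}_{k,j},\dots,v^{(m-1)+}_{k,j},\mathbf{n}_{k,j})$, a second orthonormal basis. A matrix $A$ maps a basis $\mathcal{B}$ to a basis $\mathcal{B}'$ if, writing the bases as columns of vectors, $\mathcal{B}'=A\,\mathcal{B}$.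
   Formalization: The angle in the matrix is (-1)^m θ instead of θ (the stated sign fails for odd m); the frames (u,V) of all steps are positively oriented, else consecutive normals n may be opposite; √ρ is assumed C^1, else f_{k,j+1} need not be differentiable where ρ=0. *)

(* Defs.v *)
(* World: MathComp + MathComp-Analysis, over an arbitrary R : realType. *)
From HB Require Import structures.
From mathcomp Require Import all_boot all_order all_algebra.
From mathcomp Require Import all_classical all_reals all_analysis.

Set Implicit Arguments.
Unset Strict Implicit.
Unset Printing Implicit Defensive.

Import Order.TTheory GRing.Theory Num.Theory.
Import numFieldNormedType.Exports.

Local Open Scope classical_set_scope.
Local Open Scope ring_scope.

(* The chart has dimension m = n.+1 and the ambient Euclidean space has
   dimension m + 1 = n.+2, so that a basis of a hyperplane of R^m is indexed by
   'I_n.  Vectors are row vectors.  The library norm of 'rV[R]_d is the sup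
   norm: it only serves for the topology, and metric quantities go through
   [dot] and [enorm]. *)

Section Euclidean.
Context {R : realType}.

Definition dot {d} (v w : 'rV[R]_d) : R := (v *m w^T) 0 0.

Definition enorm {d} (v : 'rV[R]_d) : R := Num.sqrt (dot v v).

Definition normalize {d} (v : 'rV[R]_d) : 'rV[R]_d := (enorm v)^-1 *: v.

Definition fcons {T : Type} {k} (x : T) (a : 'I_k -> T) : 'I_k.+1 -> T :=
  fun i => oapp a x (unlift ord0 i).

Definition frcons {T : Type} {k} (a : 'I_k -> T) (x : T) : 'I_k.+1 -> T :=
  fun i => oapp a x (unlift ord_max i).

(* <wedge a, x> = det (a_1, ..., a_d, x), read off on the canonical basis. *)
Definition wedge {d} (a : 'I_d -> 'rV[R]_d.+1) : 'rV[R]_d.+1 :=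
  \row_j \det (\matrix_i frcons a (delta_mx 0 j) i).

Definition gram_schmidt_seq {d} (s : seq 'rV[R]_d) : seq 'rV[R]_d :=
  foldl (fun e a => rcons e (normalize (a - \sum_(w <- e) dot a w *: w)))
    [::] s.

Definition gram_schmidt {k d} (a : 'I_k -> 'rV[R]_d) : 'I_k -> 'rV[R]_d :=
  fun i => nth 0 (gram_schmidt_seq [seq a j | j <- enum 'I_k]) i.

Definition proj {d} (P : set 'rV[R]_d) (v : 'rV[R]_d) : 'rV[R]_d :=
  xget 0 [set w | P w /\ forall z, P z -> dot (v - w) z = 0].

Definition projperp {d} (P : set 'rV[R]_d) (v : 'rV[R]_d) : 'rV[R]_d :=
  v - proj P v.

Definition is_rotation {d} (L : 'M[R]_d) : Prop :=
  L *m L^T = 1%:M /\ \det L = 1.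

End Euclidean.

Section Bessel.
Context {R : realType}.
Implicit Types a t s x : R.

Definition J0 a : R :=
  \int[lebesgue_measure]_(t in `[0, 1]) cos (a * cos (2 * pi * t)).

Definition alpha0 : R := inf [set a : R | 0 < a /\ J0 a = 0].

Definition J0inv : R -> R := 'pinv_(fun=> 0) `[0, alpha0] J0.

(* Oriented integral: [pi] takes negative values when some coefficient of the
   linear form is negative. *)
Definition oriented_int (h : R -> R) t : R :=
  if 0 <= t then \int[lebesgue_measure]_(s in `[0, t]) h s
  else - \int[lebesgue_measure]_(s in `[t, 0]) h s.

Definition Kc a t : R :=
  oriented_int (fun s => cos (a * cos (2 * pi * s)) - J0 a) t.

Definition Ks a t : R :=
  oriented_int (fun s => sin (a * cos (2 * pi * s))) t.

End Bessel.

Fixpoint class_C {R : realType} {V W : normedModType R} (k : nat)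
    (O : set V) (h : V -> W) : Prop :=
  if k is k'.+1 then
    (forall p, O p -> differentiable h p) /\
    (forall v, class_C k' O (fun p => 'd h p v))
  else forall p, O p -> {for p, continuous h}.

Definition cube {R : realType} {d} : set 'rV[R]_d :=
  [set p | forall i, 0 <= p 0 i <= 1].

Section Corrugation.
Context {R : realType} {n : nat}.
Local Notation chart := 'rV[R]_n.+1.
Local Notation space := 'rV[R]_n.+2.
Local Notation covector := 'cV[R]_n.+1.
Local Notation frame := ('I_n -> chart -> chart).
Implicit Types (f : chart -> space) (c : covector) (l : chart -> covector).
Implicit Types (rho : chart -> R) (u : chart -> chart) (V : frame).
Implicit Types (p x y : chart) (nu : chart -> space).

Definition pairing c x : R := (x *m c) 0 0.

Definition pullback f p x y : R := dot ('d f p x) ('d f p y).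

Definition immersion_on (O : set chart) f : Prop :=
  forall p, O p -> injective ('d f p).

(* The linear form l may vary here because consecutive steps may belong to
   different charts.  The last condition is the compatibility of (u, V) with
   the orientation of the manifold, which selects the side of the unit normal:
   without it the normals of two consecutive steps could be opposite. *)
Definition adapted_frame (O : set chart) l u V : Prop :=
  [/\ class_C 0 O u, forall i, class_C 0 O (V i) &
      forall p, O p ->
        [/\ pairing (l p) (u p) = 1,
            row_free (\matrix_i V i p),
            (\matrix_i V i p == kermx (l p))%MS &
            0 < \det (\matrix_i fcons (u p) (fun k => V k p) i)]].

Definition image_ker f c p : set space :=
  [set 'd f p x | x in [set x | pairing c x = 0]].

Definition unit_normal f u V p : space :=
  normalize (wedge (fcons (normalize ('d f p (u p)))
                          (fun i => 'd f p (V i p)))).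

Definition mu f rho c p x y : R :=
  pullback f p x y + rho p * pairing c x * pairing c y.

Definition tvec f c u p : space :=
  normalize (projperp (image_ker f c p) ('d f p (u p))).

Definition radius f rho c u p : R :=
  Num.sqrt (mu f rho c p (u p) (u p)
            - enorm (proj (image_ker f c p) ('d f p (u p))) ^+ 2).

Definition alpha f rho c u p : R :=
  J0inv (enorm (projperp (image_ker f c p) ('d f p (u p)))
         / radius f rho c u p).

(* The linear form c of the chart is d(pairing c), so [pairing c p] is the
   function pi = sum_i c_i phi^i of the corrugation process. *)
Definition corrugation f rho c u nu (N : nat) p : space :=
  f p
  + (radius f rho c u p / N%:R * Kc (alpha f rho c u p) (N%:R * pairing c p))
      *: tvec f c u p
  + (radius f rho c u p / N%:R * Ks (alpha f rho c u p) (N%:R * pairing c p))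
      *: nu p.

Definition theta f rho c u (N : nat) p : R :=
  alpha f rho c u p * cos (2 * pi * (N%:R * pairing c p)).

(* Rows: v^1 /\ ... /\ v^(m-1) /\ nu, then v^1, ..., v^(m-1), then nu, where
   (v^i) is the Gram-Schmidt orthonormalization of (df (V^i)).  With bases
   written as matrices of rows, "A maps B to B'" reads B' = A *m B. *)
Definition adapted_basis f V nu p : 'M[R]_n.+2 :=
  let v := gram_schmidt (fun i => 'd f p (V i p)) in
  \matrix_i fcons (wedge (frcons v (nu p))) (frcons v (nu p)) i.

(* The block matrix (cos 0 sin | 0 Id 0 | -sin 0 cos), blocks 1, n, 1. *)
Definition corner_rotation (th : R) : 'M[R]_n.+2 :=
  \matrix_(i, j)
    if i == ord0 then
      if j == ord0 then cos th else if j == ord_max then sin th else 0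
    else if i == ord_max then
      if j == ord0 then - sin th else if j == ord_max then cos th else 0
    else (i == j)%:R.

(* A Nash process seen from a chart [0,1]^m, whose coordinates extend to the
   neighbourhood O.  [f_ k j] is used for j <= nsteps k, and the data indexed by
   (k, j), 1 <= j <= nsteps k, are those of the step from [f_ k j.-1] to [f_ k j].
   Since the charts of the manifold overlap, a step may be carried out in
   another chart; [here k j] tells that it is carried out in this one. *)
Record nash_process (O : set chart) := NashProcess {
  g_ : chart -> 'M[R]_n.+1;
  delta_ : nat -> R;
  cutoff : chart -> R;
  nsteps : nat -> nat;
  here : nat -> nat -> bool;
  f_ : nat -> nat -> chart -> space;
  rho_ : nat -> nat -> chart -> R;
  ell_ : nat -> nat -> covector;
  u_ : nat -> nat -> chart -> chart;
  V_ : nat -> nat -> frame;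
  freq_ : nat -> nat -> nat;
  metric := fun p x y => (x *m g_ p *m y^T) 0 0;
  metric_ := fun k p x y =>
    pullback (f_ 0 0) p x y
      + delta_ k * (metric p x y - pullback (f_ 0 0) p x y);
  g_sym : forall p, O p -> (g_ p)^T = g_ p;
  g_gt0 : forall p x, O p -> x != 0 -> 0 < metric p x x;
  delta_ge0 : 0 <= delta_ 0;
  delta_incr : {homo delta_ : a b / (a < b)%N >-> a < b};
  delta_cvg : delta_ @ \oo --> (1 : R);
  f_C2 : forall k j, (j <= nsteps k)%N -> class_C 2 O (f_ k j);
  f_immersion : forall k j, (j <= nsteps k)%N -> immersion_on O (f_ k j);
  f0_short : forall p x, O p -> x != 0 ->
    pullback (f_ 0 0) p x x < metric p x x;
  f_stage : forall k p, O p -> f_ k (nsteps k) p = f_ k.+1 0 p;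
  f_le : forall k p x, O p -> pullback (f_ k 0) p x x <= metric_ k.+1 p x x;
  cutoff_itv : forall p, O p -> 0 <= cutoff p <= 1;
  rho_ge0 : forall k j p, here k j -> O p -> 0 <= rho_ k j p;
  (* J0inv is not differentiable at 1: where rho vanishes, it is the regularity
     of its square root that makes the corrugated map differentiable. *)
  sqrt_rho_C1 : forall k j, here k j ->
    class_C 1 O (fun p => Num.sqrt (rho_ k j p) : R^o);
  decomposition : forall k p x y, O p ->
    cutoff p * (metric_ k.+1 p x y - pullback (f_ k 0) p x y) =
    \sum_(1 <= j < (nsteps k).+1 | here k j)
      rho_ k j p * pairing (ell_ k j) x * pairing (ell_ k j) y;
  frame_adapted : forall k j, here k j ->
    adapted_frame O (fun=> ell_ k j) (u_ k j) (V_ k j);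
  freq_gt0 : forall k j, (0 < freq_ k j)%N;
  f_step : forall k j, (j < nsteps k)%N -> here k j.+1 -> forall p, O p ->
    f_ k j.+1 p =
    corrugation (f_ k j) (rho_ k j.+1) (ell_ k j.+1) (u_ k j.+1)
      (unit_normal (f_ k j) (u_ k j.+1) (V_ k j.+1)) (freq_ k j.+1) p
}.

End Corrugation.

(* Main.v *)
Require Import Defs.
From HB Require Import structures.
From mathcomp Require Import all_boot all_order all_algebra.
From mathcomp Require Import all_classical all_reals all_analysis.
From mathcomp Require Import ring lra.

Set Implicit Arguments.
Unset Strict Implicit.
Unset Printing Implicit Defensive.

Import Order.TTheory GRing.Theory Num.Theory.
Import numFieldNormedType.Exports.

Local Open Scope classical_set_scope.
Local Open Scope ring_scope.

(** The corrugation adds to f a perturbation of size 1/N whose phase N pi(p)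
    turns fast in the direction of the linear form l = d pi.  Differentiating it,
    every term in which the derivative falls on a slowly varying factor keeps
    the factor 1/N; only the derivative of the phase survives, and
      df'(x) = df(x) + l(x) (r (cos theta - J0(alpha)) t + r sin theta n) + O(1/N).
    Hence df' and df agree on ker l up to O(1/N), and since r J0(alpha) is the
    height s of df(u) above P = df(ker l),
      df'(u) = [df(u)]^P + r (cos theta t + sin theta n) + O(1/N):
    the tangent hyperplane of f' is that of f turned about P by the angle theta.
    Its unit normal is then cos theta n - sin theta t + O(1/N), while the
    Gram-Schmidt vectors v of df(V) move by O(1/N).

    Both bases are orthonormal with the same determinant, so the matrix from one
    to the other is a rotation, whose entries are the dot products of their
    vectors.  Replacing the vectors of the second basis by the approximations
    above gives the block matrix; the sign (-1)^m of the angle comes from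
    v^1 /\ ... /\ v^(m-1) /\ n = (-1)^m t ([adapted_wedge]).

    Three points need work.

    - Regularity of alpha = J0inv (s / r).  The derivative of J0 vanishes at 0, so
      J0inv is not differentiable at 1, which is reached where rho vanishes.
      Written as a function of x = sqrt rho / s, the angle is differentiable for
      x != 0 with a bounded derivative, and is O(x); at a zero of rho the
      function x has a minimum, so its differential vanishes and alpha is
      differentiable there too ([differentiable_angle]).  This rests on
      the bound J0'(a) <= - c a on [0, pi], which holds because y sin y >= 0 for
      |y| <= pi, and on alpha0 <= pi.  The latter follows from J0(pi) <= 0: the
      mean of cos (pi cos x) is half that of
      cos (pi cos x) + cos (pi sin x), a product of two cosines of opposite signs.

    - Uniformity.  The kernels K_c and K_s and their derivatives in alpha are
      1-periodic in the phase, hence bounded, whatever N is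
      ([centered_primitive_bounded]); all other quantities are continuous on the
      compact cube, and those that are divided by are positive there.

    - Choice of frames.  u and V are only continuous, but t, n, s, r and alpha do
      not depend on them, so they can be computed from the constant fields
      u(0), V(0), for which everything is differentiable.  In the same way the
      normal of f' does not depend on the data of the step after it. *)

(** * Functions of one real variable *)

Section OneVariable.
Context {R : realType}.
Implicit Types (f F h : R -> R) (a b t x y C M : R).

Lemma is_derive_continuous f df x : is_derive x 1 f df -> {for x, continuous f}.
Proof. by move=> [/derivable1_diffP/differentiable_continuous]. Qed.

Lemma mean_value f df a b : a <= b -> (forall x, is_derive x 1 f (df x)) ->
  exists2 c, a <= c <= b & f b - f a = df c * (b - a).
Proof.
move=> ab fdf.
have cf : {within `[a, b], continuous f}.
  by apply: continuous_subspaceT => x; exact: is_derive_continuous (fdf x).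
have [c cab ->] := MVT_segment ab (fun x _ => fdf x) cf.
by exists c => //; move: cab; rewrite in_itv.
Qed.

Lemma derive0_cst f : (forall x, is_derive x 1 f 0) -> forall x y, f x = f y.
Proof.
move=> df x y; wlog xy : x y / x <= y.
  by move=> H; case: (leP x y) => [/H//|/ltW/H].
by have [c _ /eqP] := mean_value xy df; rewrite mul0r subr_eq0 => /eqP.
Qed.

Lemma derive_ge0_le f df a b : a <= b -> (forall x, is_derive x 1 f (df x)) ->
  (forall x, a <= x <= b -> 0 <= df x) -> f a <= f b.
Proof.
move=> ab fdf df0; have [c cab e] := mean_value ab fdf.
by rewrite -subr_ge0 e mulr_ge0 ?df0 ?subr_ge0.
Qed.

Lemma derive_lipschitz f df M : (forall x, is_derive x 1 f (df x)) ->
  (forall x, `|df x| <= M) -> forall x y, `|f x - f y| <= M * `|x - y|.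
Proof.
move=> fdf dfM x y; wlog xy : x y / y <= x.
  move=> H; case: (leP y x) => [/H//|/ltW/H].
  by rewrite distrC (distrC y).
by have [c _ ->] := mean_value xy fdf; rewrite normrM ler_wpM2r.
Qed.

(** The form in which derivatives of parametric integrals are obtained below,
    from a pointwise Taylor estimate. *)
Lemma quadratic_is_derive F a d C :
  (forall e, `|F (a + e) - F a - e * d| <= C * e ^+ 2) -> is_derive a 1 F d.
Proof.
move=> FC.
have lim : h^-1 *: (F (h *: 1 + a) - F a) @[h --> 0^'] --> d.
  apply/cvgrPdist_le => e e0.
  have C0 : 0 <= C.
    by have := FC 1; rewrite expr1n mulr1; apply: le_trans.
  near=> h.
  have h0 : h != 0 by near: h; exact: nbhs_dnbhs_neq.
  have -> : d - h^-1 *: (F (h *: 1 + a) - F a) =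
            - h^-1 * (F (a + h) - F a - h * d).
    by rewrite [h *: 1]mulr1 (addrC h) /GRing.scale/=; field.
  rewrite normrM normrN normfV.
  have hn : 0 < `|h| by rewrite normr_gt0.
  rewrite mulrC ler_pdivrMr//; apply: le_trans (FC h) _.
  rewrite -real_normK ?num_real// expr2 mulrA ler_wpM2r//.
  have hd : `|h| <= e / (C + 1).
    by near: h; apply: dnbhs0_le; rewrite divr_gt0// ltr_wpDl.
  apply: (@le_trans _ _ ((C + 1) * `|h|)).
    by rewrite ler_wpM2r// lerDl.
  by rewrite mulrC -ler_pdivlMr// ltr_wpDl.
apply: DeriveDef; first by apply/cvg_ex; exists d.
exact/cvg_lim.
Unshelve. all: by end_near. Qed.

End OneVariable.

(** * Oriented integrals as primitives *)

Section Primitive.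
Context {R : realType}.
Notation leb := (@lebesgue_measure R).
Implicit Types (h F : R -> R) (a b t x : R).

Lemma continuous_integrable_itv h a b : continuous h ->
  leb.-integrable `[a, b] (EFin \o h).
Proof.
move=> ch; apply: continuous_compact_integrable; first exact: segment_compact.
exact: continuous_subspaceT.
Qed.

Lemma Rintegral_segment_cat h a b t : continuous h -> a <= b -> b <= t ->
  \int[leb]_(x in `[a, t]) h x =
  \int[leb]_(x in `[a, b]) h x + \int[leb]_(x in `[b, t]) h x.
Proof.
move=> ch ab bt.
rewrite -(@Rintegral_itv_obnd_cbnd _ b (BRight t)); last first.
  apply: integrableS (continuous_integrable_itv b t ch) => //.
  by apply: subset_itvr; rewrite bnd_simp.
rewrite -(@Rintegral_itvB _ h (BLeft a) (BRight t) b) ?bnd_simp//.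
  by rewrite addrC subrK.
exact: continuous_integrable_itv.
Qed.

(** Measuring from a base point to the left of both 0 and t removes the case
    distinction on the sign of t. *)
Lemma oriented_intE h a t : continuous h -> a <= 0 -> a <= t ->
  oriented_int h t =
  \int[leb]_(x in `[a, t]) h x - \int[leb]_(x in `[a, 0]) h x.
Proof.
move=> ch a0 at_; rewrite /oriented_int; case: ifPn => [t0|].
  by rewrite (Rintegral_segment_cat ch a0 t0) addrC addKr.
rewrite -ltNge => /ltW t0.
by rewrite (Rintegral_segment_cat ch at_ t0) opprD addrA subrr sub0r.
Qed.

Lemma oriented_int0 h : oriented_int h 0 = 0.
Proof. by rewrite /oriented_int lexx set_itv1 Rintegral_set1. Qed.

Lemma is_derive_oriented_int h : continuous h ->
  forall t, is_derive t 1 (oriented_int h) (h t).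
Proof.
(* A base point to the left of t and of 0, so that t is interior. *)
move=> ch t; pose a := Num.min t 0 - 1.
have [a0 at_] : a < 0 /\ a < t.
  by split; rewrite /a; case: (leP t 0) => ?; lra.
have [dF F't] := @continuous_FTC1_closed _ h a t (t + 1) ltac:(lra)
  (continuous_integrable_itv a (t + 1) ch) at_ (ch t).
set F := (fun x => _) in dF F't.
have dF' : is_derive t 1 (fun x => F x - F 0) (h t).
  have -> : h t = h t - 0 by rewrite subr0.
  apply: is_deriveB; apply: DeriveDef; [exact: dF | by rewrite -derive1E].
apply: near_eq_is_derive dF'; near=> x.
rewrite (@oriented_intE h a)//; first exact: ltW.
by apply: ltW; near: x; exact: lt_nbhsr.
Unshelve. all: by end_near. Qed.

Lemma oriented_int_unique h F : continuous h ->
  (forall t, is_derive t 1 F (h t)) -> forall t, oriented_int h t = F t - F 0.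
Proof.
move=> ch dF t.
have : forall t, is_derive t 1 (fun t => oriented_int h t - F t) 0.
  move=> x; rewrite -(subrr (h x)); apply: is_deriveB => //.
  exact: is_derive_oriented_int.
by move=> /derive0_cst/(_ t 0); rewrite oriented_int0 => /eqP; lra.
Qed.

Lemma is_derive_comp_shift F (d c t : R) : is_derive (t + c) 1 F d ->
  is_derive t 1 (fun x => F (x + c)) d.
Proof.
move=> dF; have dS : is_derive t 1 (fun x : R => x + c) 1.
  by apply: is_derive_eq; rewrite addr0.
by have := @is_derive1_comp _ _ (fun x : R => x + c) _ _ _ dF dS; rewrite mulr1.
Qed.

Lemma oriented_int_shift1 h t : continuous h -> (forall x, h (x + 1) = h x) ->
  oriented_int h (t + 1) = oriented_int h t + oriented_int h 1.
Proof.
move=> ch per.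
have dD x : is_derive x 1 (fun x => oriented_int h (x + 1) - oriented_int h x) 0.
  rewrite -[0](subrr (h x)); apply: is_deriveB; last exact: is_derive_oriented_int.
  by rewrite -[h x]per; apply: is_derive_comp_shift; exact: is_derive_oriented_int.
have := derive0_cst dD t 0.
by rewrite add0r oriented_int0; lra.
Qed.

(** The two halves of the period cancel; this is why the sine kernel needs no
    correction by a mean value. *)
Lemma oriented_int1_antiperiodic h : continuous h ->
  (forall x, h (x + 1 / 2) = - h x) -> oriented_int h 1 = 0.
Proof.
move=> ch per.
have dD x : is_derive x 1 (fun x => oriented_int h (x + 1 / 2) + oriented_int h x) 0.
  rewrite -[0](addNr (h x)); apply: is_deriveD; last exact: is_derive_oriented_int.
  by rewrite -[- h x]per; apply: is_derive_comp_shift; exact: is_derive_oriented_int.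
have := derive0_cst dD (1 / 2) 0.
have -> : 1 / 2 + 1 / 2 = 1 :> R by lra.
by rewrite add0r oriented_int0; lra.
Qed.

(** Removing the mean value of h makes its primitive periodic, hence bounded on
    the whole line by its bound on one period. *)
Lemma centered_primitive_bounded h t : continuous h ->
  (forall x, h (x + 1) = h x) -> (forall x, `|h x| <= 1) ->
  `|oriented_int h t - t * oriented_int h 1| <= 2.
Proof.
move=> ch per h1; pose F t := oriented_int h t - t * oriented_int h 1.
have FS x : F (x + 1) = F x by rewrite /F oriented_int_shift1//; ring.
have FSn (k : nat) x : F (x + k%:R) = F x.
  by elim: k => [|k IH]; rewrite ?addr0// -natr1 addrA FS.
have FSz (k : int) x : F (x + k%:~R) = F x.
  case: k => k; first exact: FSn.
  by rewrite NegzE mulrNz -[in RHS](subrK k.+1%:~R x) -[k.+1%:~R]/(k.+1%:R) FSn.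
rewrite -/(F t); have -> : F t = F (t - (Num.floor t)%:~R).
  by rewrite -[in LHS](subrK (Num.floor t)%:~R t) FSz.
have lip x : `|oriented_int h x| <= `|x|.
  have := derive_lipschitz (is_derive_oriented_int ch) h1 x 0.
  by rewrite oriented_int0 !subr0 mul1r.
set x := t - _; have x01 : 0 <= x <= 1.
  rewrite /x; have := Num.Theory.floor_itv t; rewrite intrD1; lra.
rewrite /F; apply: le_trans (ler_normB _ _) _.
rewrite normrM; have := lip x; have := lip 1; rewrite normr1.
have xn : `|x| <= 1 by rewrite ger0_norm; lra.
move=> h1' hx; have : `|x| * `|oriented_int h 1| <= 1 * 1 by rewrite ler_pM.
lra.
Qed.

End Primitive.

(** * Integrals of a function of a cos (2 pi s) *)

Section ParametricPrimitive.
Context {R : realType}.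
Implicit Types (a b t s x y e : R) (g : R -> R).

Local Notation w s := (cos (2 * pi * s)).

Lemma is_derive_wave s : is_derive s 1 (fun s : R => w s) (- (2 * pi) * sin (2 * pi * s)).
Proof.
by apply: is_derive_eq; rewrite /GRing.scale /=; ring.
Qed.

Lemma continuous_wave : continuous (fun s : R => w s).
Proof. by move=> s; exact: is_derive_continuous (is_derive_wave s). Qed.

(** Satisfied by cos and sin, the two functions integrated by the kernels. *)
Definition lipschitz_derivative g (g' : R -> R) :=
  (forall y, is_derive y 1 g (g' y)) /\ (forall x y, `|g' x - g' y| <= `|x - y|).

Lemma lipschitz_derivative_cos : lipschitz_derivative cos (fun y => - sin y).
Proof.
split=> [y|x y]; first exact: is_derive_cos.
rewrite -opprD normrN -[leRHS]mul1r.
by apply: (@derive_lipschitz _ sin cos) => z; exact: cos_max.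
Qed.

Lemma lipschitz_derivative_sin : lipschitz_derivative sin cos.
Proof.
split=> [y|x y]; first exact: is_derive_sin.
rewrite -[leRHS]mul1r; apply: (@derive_lipschitz _ cos (fun y => - sin y)) => z.
by rewrite normrN sin_max.
Qed.

Lemma lipschitz_derivative_taylor g g' : lipschitz_derivative g g' ->
  forall y e, `|g (y + e) - g y - e * g' y| <= e ^+ 2.
Proof.
move=> [dg lg] y e.
suff [c cy ->] : exists2 c, `|c - y| <= `|e| & g (y + e) - g y = g' c * e.
  rewrite mulrC -mulrBr normrM -[leRHS]real_normK ?num_real// expr2 ler_wpM2l//.
  exact: le_trans (lg _ _) cy.
have [e0|e0] := leP 0 e.
  have ye : y <= y + e by lra.
  have [c cye ->] := mean_value ye dg.
  exists c; last by congr (_ * _); ring.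
  by rewrite !ger0_norm; lra.
have ye : y + e <= y by lra.
have [c cye ge] := mean_value ye dg.
exists c; first by rewrite !ler0_norm; lra.
by rewrite -opprB ge; ring.
Qed.

Definition wave_int g a t := oriented_int (fun s => g (a * w s)) t.

Section WithG.
Variables (g g' : R -> R).
Hypothesis gg' : lipschitz_derivative g g'.

Let cg : continuous g. Proof. by move=> y; exact: is_derive_continuous (gg'.1 y). Qed.

Let cg' : continuous g'.
Proof.
move=> y; apply/cvgrPdist_le => e e0; near=> x.
apply: le_trans (gg'.2 _ _) _.
by near: x; apply: cvgr_dist_le.
Unshelve. all: by end_near. Qed.

Lemma continuous_wave_comp a : continuous (fun s => g (a * w s)).
Proof.
move=> s; apply: (@continuous_comp _ _ _ (fun s => a * w s) g); last exact: cg.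
by apply: continuousM; [exact: cst_continuous | exact: continuous_wave].
Qed.

Lemma is_derive_wave_int a t :
  is_derive t 1 (wave_int g a) (g (a * w t)).
Proof. by have := is_derive_oriented_int (@continuous_wave_comp a) t. Qed.

Lemma continuous_wave_comp_deriv a : continuous (fun s => w s * g' (a * w s)).
Proof.
move=> s; apply: continuousM; first exact: continuous_wave.
apply: (@continuous_comp _ _ _ (fun s => a * w s) g'); last exact: cg'.
by apply: continuousM; [exact: cst_continuous | exact: continuous_wave].
Qed.

(** Differentiation under the integral sign.  The Taylor remainder of the
    integrand is at most e^2, so the difference of the two sides, as a function
    of t, has a derivative bounded by e^2. *)
Lemma is_derive_wave_int_param a t :
  is_derive a 1 (wave_int g ^~ t) (oriented_int (fun s => w s * g' (a * w s)) t).
Proof.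
apply: (@quadratic_is_derive _ _ _ _ `|t|) => e.
pose D x := wave_int g (a + e) x - wave_int g a x
            - e * oriented_int (fun s => w s * g' (a * w s)) x.
pose D' x := g ((a + e) * w x) - g (a * w x) - e * (w x * g' (a * w x)).
have dD x : is_derive x 1 D (D' x).
  apply: is_deriveB; first by apply: is_deriveB; exact: is_derive_wave_int.
  apply: is_deriveZ; by have := is_derive_oriented_int (@continuous_wave_comp_deriv a) x.
have bD x : `|D' x| <= e ^+ 2.
  rewrite /D' mulrDl mulrA; apply: le_trans (lipschitz_derivative_taylor gg' _ _) _.
  by rewrite exprMn ler_piMr ?sqr_ge0//.
have := derive_lipschitz dD bD t 0.
by rewrite {2}/D /wave_int !oriented_int0 mulr0 !subr0 mulrC.
Qed.

Lemma wave_half s : 2 * pi * (s + 1 / 2) = 2 * pi * s + pi :> R.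
Proof. by field. Qed.

Lemma wave_shift1 s : w (s + 1) = w s.
Proof.
have -> : 2 * pi * (s + 1) = 2 * pi * s + (pi *+ 2) :> R by ring.
by rewrite cosD2pi.
Qed.

Lemma wave_int_shift1 a t : wave_int g a (t + 1) = wave_int g a t + wave_int g a 1.
Proof.
apply: oriented_int_shift1 => [|s]; last by rewrite wave_shift1.
exact: continuous_wave_comp.
Qed.

End WithG.

End ParametricPrimitive.

(** * The Bessel function J0 and its first zero *)

Section BesselZero.
Context {R : realType}.
Implicit Types (a b q t s x y : R).

Local Notation w s := (cos (2 * pi * s)).

Lemma J0E a : J0 a = wave_int cos a 1.
Proof. by rewrite /J0 /wave_int /oriented_int ler01. Qed.

(** The derivative of J0, i.e. the opposite of the Bessel function J1. *)
Definition dJ0 a := oriented_int (fun s => w s * (- sin (a * w s))) 1.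

Lemma is_derive_J0 a : is_derive a 1 J0 (dJ0 a).
Proof.
have -> : J0 = (fun x : R => wave_int cos x 1) by apply/funext => x; rewrite J0E.
exact: (is_derive_wave_int_param lipschitz_derivative_cos).
Qed.

Lemma J00 : J0 0 = 1 :> R.
Proof.
rewrite J0E /wave_int.
have -> : (fun s : R => cos (0 * w s)) = fun=> 1.
  by apply/funext => s; rewrite mul0r cos0.
rewrite (@oriented_int_unique _ _ id) ?subr0// => s; exact: cst_continuous.
Qed.

Lemma cos_ge1BX y : 1 - y ^+ 2 <= cos y.
Proof.
have := lipschitz_derivative_taylor (@lipschitz_derivative_cos R) 0 y.
by rewrite add0r cos0 sin0 oppr0 mulr0 subr0 ler_norml => /andP[]; lra.
Qed.

Lemma J0_ge a : 1 - a ^+ 2 <= J0 a.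
Proof.
rewrite J0E.
pose D t := wave_int cos a t - (1 - a ^+ 2) * t.
pose D' t := cos (a * w t) - (1 - a ^+ 2).
have dD t : is_derive t 1 D (D' t).
  have := is_derive_wave_int lipschitz_derivative_cos a t => dP.
  by apply: is_derive_eq; rewrite /GRing.scale/= mulr1.
have D'0 t : 0 <= t <= 1 -> 0 <= D' t.
  move=> _; rewrite /D' subr_ge0; apply: le_trans (cos_ge1BX _).
  rewrite lerB// exprMn ler_piMr ?sqr_ge0//.
have := derive_ge0_le ler01 dD D'0.
by rewrite /D /wave_int oriented_int0; lra.
Qed.

(** sin y = 2 sin (y/2) cos (y/2), and sin z >= z cos z for z = y/2 by the mean
    value theorem; finally cos^2 (y/2) >= 1/2 below pi/2. *)
Lemma sin_ge_half y : 0 <= y <= pi / 2 -> y / 2 <= sin y.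
Proof.
move=> /andP[y0 ypi]; have pi0 := @pi_gt0 R.
have y2 : 0 <= y / 2 by lra.
have [c cy] := @mean_value _ sin cos 0 (y / 2) y2 ltac:(move=> x; exact: is_derive_sin).
rewrite sin0 !subr0 => sE.
have cosc : cos (y / 2) <= cos c.
  have := @ltr_cos R (y / 2) c; rewrite !in_itv/= => /(_ ltac:(lra) ltac:(lra)) e.
  by rewrite leNgt -leNgt; case: (ltrP (cos c) (cos (y / 2))) => //; rewrite ltr_cos ?in_itv/=; lra.
have yE : y = (y / 2) *+ 2 by lra.
suff : (y / 2) *+ 2 / 2 <= sin ((y / 2) *+ 2) by rewrite -yE.
rewrite sin_mulr2n mulr2n sE.
have c2 : 1 <= cos (y / 2) ^+ 2 *+ 2.
  rewrite -subr_ge0 -cos_mulr2n.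
  have -> : y / 2 *+ 2 = y by lra.
  by apply: cos_ge0_pihalf; lra.
have cy0 : 0 <= cos (y / 2) by apply: cos_ge0_pihalf; lra.
have : cos (y / 2) ^+ 2 <= cos (y / 2) * cos c by rewrite expr2 ler_wpM2l.
move: c2; set u := cos (y / 2); set v := cos c => c2 uv.
have : 0 <= y / 2 * (2 * (u * v) - 1) by apply: mulr_ge0; lra.
lra.
Qed.

(** The half-angle formula turns the two zeros 0 and pi of the sine into the zeros
    of two sines at 0, each bounded below by a linear function. *)
Lemma sin_ge_quad y : 0 <= y <= pi -> y * (pi - y) / 8 <= sin y.
Proof.
move=> ypi.
have -> : sin y = 2 * (sin (y / 2) * sin ((pi - y) / 2)).
  have -> : sin ((pi - y) / 2) = cos (y / 2).
    have -> : (pi - y) / 2 = - (y / 2 - pi / 2) by lra.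
    by rewrite sinN sinBpihalf opprK.
  have yE : y = (y / 2) *+ 2 by lra.
  by rewrite {1}yE sin_mulr2n; ring.
have h1 : y / 2 / 2 <= sin (y / 2) by apply: sin_ge_half; lra.
have h2 : (pi - y) / 2 / 2 <= sin ((pi - y) / 2) by apply: sin_ge_half; lra.
have : (y / 2 / 2) * ((pi - y) / 2 / 2) <= sin (y / 2) * sin ((pi - y) / 2).
  by apply: ler_pM => //; lra.
by lra.
Qed.

(** The lower bound is a trigonometric polynomial in x when k = cos x, which can
    be integrated exactly. *)
Lemma mul_sin_ge a (k : R) : 0 <= a <= pi -> -1 <= k <= 1 ->
  a * pi / 16 * (k ^+ 2 * (1 - k ^+ 2)) <= k * sin (a * k).
Proof.
move=> api kk.
have -> : k * sin (a * k) = `|k| * sin (a * `|k|).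
  case: (ger0P k) => // k0; rewrite mulrN sinN; ring.
rewrite -(real_normK (num_real k)); set l := `|k|.
have l0 : 0 <= l by exact: normr_ge0.
have l1 : l <= 1 by rewrite ler_norml.
have pi0 := @pi_gt0 R.
have al : 0 <= a * l <= pi by apply/andP; split; nra.
have := sin_ge_quad al => h.
have : l * (a * l * (pi - a * l) / 8) <= l * sin (a * l) by rewrite ler_wpM2l.
apply: le_trans.
have e : a * l <= pi * l by nra.
have l2 : 0 <= a * (l ^+ 2) by rewrite mulr_ge0 ?sqr_ge0//; lra.
have : a * l ^+ 2 * (pi * (1 - l)) <= a * l ^+ 2 * (pi - a * l).
  by rewrite ler_wpM2l//; lra.
have : a * l ^+ 2 * (pi * (1 - l ^+ 2) / 2) <= a * l ^+ 2 * (pi * (1 - l)).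
  rewrite ler_wpM2l// -mulrA ler_wpM2l ?pi_ge0//.
  have : 0 <= (1 - l) ^+ 2 by rewrite sqr_ge0.
  by rewrite sqrrB; lra.
lra.
Qed.

(** The linear lower bound of - J0' that controls J0inv near 1. *)
Lemma dJ0_le a : 0 <= a <= pi -> dJ0 a <= - (pi / 128 * a).
Proof.
move=> api; have pi0 := @pi_gt0 R.
pose G t := - (a * pi / 128) * (t - sin (8 * pi * t) / (8 * pi))
            - oriented_int (fun s => w s * (- sin (a * w s))) t.
pose G' t := - (a * pi / 128) * (1 - cos (8 * pi * t)) + w t * sin (a * w t).
have dG t : is_derive t 1 G (G' t).
  have := is_derive_oriented_int
    (@continuous_wave_comp_deriv _ _ _ lipschitz_derivative_cos a) t => dP.
  apply: is_derive_eq.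
  rewrite /G' /GRing.scale/= mulr1.
  by move: (lt0r_neq0 pi0); clear; generalize (pi : R) => p p0; field.
have G'0 t : 0 <= t <= 1 -> 0 <= G' t.
  move=> _; rewrite /G'.
  (* cos^2 x sin^2 x = (1 - cos (4 x)) / 8 with x = 2 pi t *)
  have -> : cos (8 * pi * t) = 1 - 8 * (w t ^+ 2 * (1 - w t ^+ 2)).
    have -> : 8 * pi * t = (2 * pi * t) *+ 2 *+ 2 by ring.
    by rewrite !cos_mulr2n; ring.
  have := @mul_sin_ge a (w t) api.
  by rewrite cos_geN1 cos_le1 => /(_ isT); lra.
have := derive_ge0_le ler01 dG G'0.
rewrite /G oriented_int0 mulr0 sin0 -/(dJ0 a) mulr1.
have -> : 8 * pi = (pi *+ 2) *+ 2 *+ 2 :> R by ring.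
rewrite [sin (_ *+ 2 *+ 2)]sin_mulr2n [sin (_ *+ 2)]sin_mulr2n sin2pi.
by rewrite mulr0 mul0rn mulr0 mul0rn !mul0r; lra.
Qed.

Lemma J0_drop a b : 0 <= a -> a <= b -> b <= pi ->
  pi / 256 * (b ^+ 2 - a ^+ 2) <= J0 a - J0 b.
Proof.
move=> a0 ab bpi.
(* pi / 256 x^2 is the primitive of the bound of dJ0_le. *)
pose D x := - J0 x - pi / 256 * x ^+ 2.
pose D' x := - dJ0 x - pi / 128 * x.
have dD x : is_derive x 1 D (D' x).
  have := is_derive_J0 x => dP.
  by apply: is_derive_eq; rewrite /D' /GRing.scale/=; field.
have D'0 x : a <= x <= b -> 0 <= D' x.
  move=> xab; have : 0 <= x <= pi by lra.
  by move=> /dJ0_le; rewrite /D'; lra.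
by have := derive_ge0_le ab dD D'0; rewrite /D; lra.
Qed.

Lemma J0_decr a b : 0 <= a -> a < b -> b <= pi -> J0 b < J0 a.
Proof.
move=> a0 ab bpi; rewrite -subr_gt0; apply: lt_le_trans (J0_drop a0 (ltW ab) bpi).
have pi0 := @pi_gt0 R.
have ba : 0 < b - a by rewrite subr_gt0.
have ba' : 0 < b + a by apply: (lt_le_trans ba); rewrite lerD2l; lra.
by rewrite subr_sqr !mulr_gt0 ?divr_gt0.
Qed.

(** Shifting by a quarter period exchanges cos and sin, so the integral of
    cos (pi cos x) + cos (pi sin x) is twice J0 pi.  This integrand is a product of
    two cosines whose arguments lie, since 1 <= |cos x| + |sin x|, on either side
    of pi / 2. *)
Lemma J0_pi_le0 : J0 pi <= 0 :> R.
Proof.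
rewrite J0E.
pose P := wave_int cos (pi : R).
pose G t := - (P t + P (t - 1 / 4)).
pose G' t := - (cos (pi * w t) + cos (pi * sin (2 * pi * t))).
have dG x : is_derive x 1 G (G' x).
  apply: is_deriveN; apply: is_deriveD; first exact: is_derive_wave_int lipschitz_derivative_cos _ _.
  have := is_derive_wave_int lipschitz_derivative_cos pi (x - 1 / 4) => dP.
  have dS : is_derive x 1 (fun x : R => x - 1 / 4) 1.
    by apply: is_derive_eq; rewrite subr0.
  have := @is_derive1_comp _ _ (fun x : R => x - 1 / 4) _ _ _ dP dS; rewrite mulr1.
  have -> : 2 * pi * (x - 1 / 4) = 2 * pi * x - pi / 2 by field.
  by rewrite cosBpihalf.
have G'0 x : 0 <= x <= 1 -> 0 <= G' x.
  move=> _; rewrite /G' oppr_ge0.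
  set c := w x; set s := sin _.
  have cs : `|c| ^+ 2 + `|s| ^+ 2 = 1.
    by rewrite !real_normK ?num_real// cos2Dsin2.
  have cosE y : cos (pi * y) = cos (pi * `|y|) :> R.
    by case: (ger0P y) => // _; rewrite mulrN cosN.
  rewrite (cosE c) (cosE s); have := normr_ge0 c; have := normr_ge0 s.
  move: cs; set C := `|c|; set S := `|s| => cs S0 C0.
  have -> : pi * C = pi * (C + S) / 2 + pi * (C - S) / 2 by field.
  have -> : pi * S = pi * (C + S) / 2 - pi * (C - S) / 2 by field.
  rewrite cosD cosB.
  have S1 : S <= 1 by nra.
  have C1 : C <= 1 by nra.
  have CS1 : 1 <= C + S by nra.
  have pi0 := @pi_gt0 R.
  have h2 : 0 <= cos (pi * (C - S) / 2).
    by apply: cos_ge0_pihalf; apply/andP; split; nra.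
  have h1 : cos (pi * (C + S) / 2) <= 0.
    have -> : pi * (C + S) / 2 = pi * (C + S - 1) / 2 + pi / 2 by field.
    rewrite cosDpihalf oppr_le0 sin_ge0_pi//; apply/andP; split; nra.
  nra.
have := derive_ge0_le ler01 dG G'0.
rewrite /G sub0r.
have -> : 1 - 1 / 4 = - (1 / 4) + 1 :> R by lra.
rewrite [P (_ + 1)](wave_int_shift1 lipschitz_derivative_cos) -/P.
have -> : P 0 = 0 by exact: oriented_int0.
by rewrite -/P; lra.
Qed.

Lemma continuous_J0 : continuous (J0 : R -> R).
Proof. by move=> x; exact: is_derive_continuous (is_derive_J0 x). Qed.

Lemma J0_IVT b q : 0 <= b -> J0 b <= q <= 1 -> exists2 a, 0 <= a <= b & J0 a = q.
Proof.
move=> b0 /andP[bq q1].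
have cf : {within `[0, b], continuous J0}.
  exact/continuous_subspaceT/continuous_J0.
have [|a aab <-] := @IVT _ J0 0 b q b0 cf; last by exists a => //; move: aab; rewrite in_itv.
by rewrite J00 ge_min le_max bq q1 orbT.
Qed.

(** As J0 decreases on [0, pi], its zero there is unique and is the infimum of all
    positive zeros. *)
Lemma alpha0P : [/\ 0 < alpha0 :> R, alpha0 <= pi :> R & J0 alpha0 = 0 :> R].
Proof.
have [z zpi z0] : exists2 z : R, 0 <= z <= pi & J0 z = 0.
  by apply: J0_IVT; [exact: pi_ge0 | rewrite J0_pi_le0 ler01].
have z_gt0 : 0 < z.
  rewrite lt_neqAle (andP zpi).1 andbT; apply/eqP => z00.
  by move: z0; rewrite -z00 J00 => /eqP; rewrite oner_eq0.
suff -> : alpha0 = z by split=> //; lra.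
rewrite /alpha0; set A := [set _ | _].
have lb : lbound A z.
  move=> a [a0 Ja]; rewrite leNgt; apply/negP => az.
  by have := J0_decr (ltW a0) az (andP zpi).2; rewrite z0 Ja ltxx.
have Az : A z by [].
apply/eqP; rewrite eq_le lb_le_inf// ?andbT; last by exists z.
by apply: ge_inf => //; exists z.
Qed.

Lemma J0_inj : {in [set` `[0, alpha0]] &, injective (J0 : R -> R)}.
Proof.
have [_ api _] := alpha0P.
move=> a b; rewrite !inE/= !in_itv/= => aab bab eq_J.
have [ab|ba|//] := ltgtP a b.
  by have := @J0_decr a b ltac:(lra) ab ltac:(lra); rewrite eq_J ltxx.
by have := @J0_decr b a ltac:(lra) ba ltac:(lra); rewrite eq_J ltxx.
Qed.

Lemma J0K a : 0 <= a <= alpha0 -> J0inv (J0 a) = a.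
Proof. by move=> aa; rewrite /J0inv (pinvKV _ J0_inj)// inE/= in_itv. Qed.

Lemma J0invP q : 0 <= q <= 1 -> 0 <= J0inv q <= alpha0 /\ J0 (J0inv q) = q.
Proof.
move=> q01; have [a0 _ Ja0] := alpha0P.
have [a aa <-] : exists2 a, 0 <= a <= alpha0 & J0 a = q.
  by apply: J0_IVT; rewrite ?Ja0// ltW.
by rewrite J0K.
Qed.

End BesselZero.

(** * The corrugation kernels *)

Section Kernels.
Context {R : realType}.
Implicit Types (a t s x y : R).

Local Notation w s := (cos (2 * pi * s)).

Lemma norm_cos_mul_le1 s (y : R) : `|y| <= 1 -> `|w s * y| <= 1.
Proof. by move=> y1; rewrite normrM -[leRHS]mulr1 ler_pM// cos_max. Qed.

Lemma KcE a t : Kc a t = wave_int cos a t - t * J0 a.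
Proof.
pose F t := wave_int cos a t - t * J0 a.
pose h s := cos (a * w s) - J0 a.
have ch : continuous h.
  by move=> s; apply: cvgB;
    [exact: (continuous_wave_comp lipschitz_derivative_cos) | exact: cst_continuous].
have dF x : is_derive x 1 F (h x).
  have := is_derive_wave_int lipschitz_derivative_cos a x => dP.
  by apply: is_derive_eq; rewrite /h /GRing.scale/=; ring.
by rewrite /Kc (oriented_int_unique ch dF) /F /wave_int oriented_int0 mul0r !subr0.
Qed.

Lemma is_derive_Kc a t : is_derive t 1 (Kc a) (cos (a * w t) - J0 a).
Proof.
apply: (@is_derive_oriented_int _ (fun s => cos (a * w s) - J0 a)) => s.
by apply: cvgB;
    [exact: (continuous_wave_comp lipschitz_derivative_cos) | exact: cst_continuous].
Qed.

Lemma is_derive_Ks a t : is_derive t 1 (Ks a) (sin (a * w t)).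
Proof. exact: (is_derive_wave_int lipschitz_derivative_sin). Qed.

Definition dKc a t := oriented_int (fun s => w s * (- sin (a * w s))) t - t * dJ0 a.
Definition dKs a t := oriented_int (fun s => w s * cos (a * w s)) t.

Lemma is_derive_Kc_param a t : is_derive a 1 (Kc ^~ t) (dKc a t).
Proof.
have -> : Kc ^~ t = (fun x => wave_int cos x t - t * J0 x).
  by apply/funext => x; rewrite KcE.
apply: is_deriveB; first exact: (is_derive_wave_int_param lipschitz_derivative_cos).
exact: (is_deriveZ _ (is_derive_J0 a)).
Qed.

Lemma is_derive_Ks_param a t : is_derive a 1 (Ks ^~ t) (dKs a t).
Proof. exact: (is_derive_wave_int_param lipschitz_derivative_sin). Qed.

Lemma Kc_bounded a t : `|Kc a t| <= 2.
Proof.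
rewrite KcE J0E; apply: centered_primitive_bounded => [|s|s].
- exact: (continuous_wave_comp lipschitz_derivative_cos).
- by rewrite wave_shift1.
- exact: cos_max.
Qed.

Lemma dKc_bounded a t : `|dKc a t| <= 2.
Proof.
apply: centered_primitive_bounded => [|s|s].
- exact: (continuous_wave_comp_deriv lipschitz_derivative_cos).
- by rewrite wave_shift1.
- by apply: norm_cos_mul_le1; rewrite normrN sin_max.
Qed.

Lemma Ks_bounded a t : `|Ks a t| <= 2.
Proof.
have cs := @continuous_wave_comp _ _ _ (@lipschitz_derivative_sin R) a.
have i0 : oriented_int (fun s => sin (a * w s)) 1 = 0.
  apply: oriented_int1_antiperiodic => // x.
  by rewrite wave_half cosDpi mulrN sinN.
rewrite /Ks -[oriented_int _ t]subr0 -(mulr0 t) -i0.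
apply: centered_primitive_bounded => // s; first by rewrite wave_shift1.
exact: sin_max.
Qed.

Lemma dKs_bounded a t : `|dKs a t| <= 2.
Proof.
have cs := @continuous_wave_comp_deriv _ _ _ (@lipschitz_derivative_sin R) a.
have i0 : oriented_int (fun s => w s * cos (a * w s)) 1 = 0.
  apply: oriented_int1_antiperiodic => // x.
  by rewrite wave_half cosDpi mulrN cosN mulNr.
rewrite /dKs -[oriented_int _ t]subr0 -(mulr0 t) -i0.
apply: centered_primitive_bounded => // s; first by rewrite wave_shift1.
by apply: norm_cos_mul_le1; rewrite cos_max.
Qed.

Lemma continuous_mul_wave : continuous (fun z : R * R => z.1 * w z.2).
Proof.
move=> z; apply: continuousM; first exact: cvg_fst.
apply: (@continuous_comp _ _ _ (fun z : R * R => z.2) (fun s => w s)); first exact: cvg_snd.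
exact: continuous_wave.
Qed.

Lemma continuous_dt_Kc : continuous (fun z : R * R => cos (z.1 * w z.2) - J0 z.1).
Proof.
move=> z; apply: cvgB.
  apply: (@continuous_comp _ _ _ (fun z : R * R => z.1 * w z.2) cos).
    exact: continuous_mul_wave.
  exact: continuous_cos.
apply: (@continuous_comp _ _ _ (fun z : R * R => z.1) J0); first exact: cvg_fst.
exact: continuous_J0.
Qed.

Lemma continuous_dt_Ks : continuous (fun z : R * R => sin (z.1 * w z.2)).
Proof.
move=> z; apply: (@continuous_comp _ _ _ (fun z : R * R => z.1 * w z.2) sin).
  exact: continuous_mul_wave.
exact: continuous_sin.
Qed.

End Kernels.

(** * Differentials in normed spaces *)

Section Differentials.
Context {R : realType} {V : normedModType R}.
Implicit Types (E a b : V -> R) (p q v : V).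

(** A perturbation that is o(h) is invisible to the differential; this yields the
    locality of differentials and handles the points where the angle vanishes. *)
Lemma littleo_is_diff (W : normedModType R) (E : V -> W) p :
  (forall e, 0 < e -> \forall h \near 0, `|E (h + p) - E p| <= e * `|h|) ->
  is_diff p E (fun=> 0).
Proof.
move=> Eo.
have dc : continuous (\0 : {linear V -> W}) by move=> x; exact: cst_continuous.
have exp : E \o shift p = cst (E p) + (\0 : {linear V -> W}) +o_ 0 id.
  apply/eqaddoP => e e0; have := Eo e e0.
  apply: filterS => h /=.
  by rewrite /cst !fctE /= addr0.
have dE := diff_unique dc exp.
apply: DiffDef; last exact: dE.
by apply/diff_locallyP; rewrite dE.
Qed.

Lemma near_is_diff (W : normedModType R) (a b da : V -> W) p :
  (\forall q \near p, a q = b q) -> is_diff p a da -> is_diff p b da.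
Proof.
move=> ab da_.
have E0 : is_diff p (b - a) (fun=> 0).
  apply: littleo_is_diff => e e0.
  have ab' : \forall h \near 0, a (h + p) = b (h + p).
    by move: ab; rewrite (near_shift 0 p) /=; apply: filterS => h /=; rewrite subr0.
  move: ab'; apply: filterS => h abh.
  rewrite !fctE abh (nbhs_singleton ab) !subrr normr0.
  exact: mulr_ge0 (ltW e0) (normr_ge0 _).
have -> : b = a + (b - a) by apply/funext => q; rewrite !fctE addrC subrK.
have := is_diffD da_ E0.
by congr is_diff_def; apply/funext => q; rewrite !fctE addr0.
Qed.

Lemma differentiable_lipschitz_at a p : differentiable a p ->
  exists2 C, 0 < C & \forall h \near 0, `|a (h + p) - a p| <= C * `|h|.
Proof.
move=> da.
have [M M0 dM] : exists2 M, 0 < M & forall h, `|'d a p h| <= M * `|h|.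
  by have /diff_locallyP[/linear_lipschitz] := da.
have /diff_locallyP[_ ] := da.
move=> /eqaddoP/(_ 1 ltr01) near1.
exists (M + 1); first by rewrite addr_gt0.
move: near1; apply: filterS => h /=; rewrite !fctE /= mul1r => h1.
have -> : a (h + p) - a p = (a (h + p) - (a p + 'd a p h)) + 'd a p h by ring.
apply: le_trans (ler_normD _ _) _.
by rewrite mulrDl mul1r addrC lerD.
Qed.

Lemma is_diff_comp1 (f : R -> R) (d : R) a p : is_derive (a p) 1 f d ->
  differentiable a p -> is_diff p (f \o a) (fun v => d * 'd a p v).
Proof.
move=> df da.
have dfd : differentiable f (a p) by apply/derivable1_diffP.
have := is_diff_comp (differentiableP da) (differentiableP dfd).
congr is_diff_def; apply/funext => v /=.
by rewrite diff1E// derive1E derive_val mulrC.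
Qed.

(** The chain rule for K (a, b).  Continuity of the partial derivative is needed
    in the second variable alone: K (a q, b q) - K (a q, b p) is handled by the
    mean value theorem, and K (a q, b p) by the chain rule in one variable. *)
Lemma differentiable_two_variables (K Ka Kt : R -> R -> R) a b p :
  (forall x t : R, is_derive x 1 (K ^~ t) (Ka x t)) ->
  (forall x t : R, is_derive t 1 (K x) (Kt x t)) ->
  continuous (fun z : R * R => Kt z.1 z.2) ->
  differentiable a p -> differentiable b p ->
  is_diff p (fun q => K (a q) (b q))
    (fun v => Ka (a p) (b p) * 'd a p v + Kt (a p) (b p) * 'd b p v).
Proof.
move=> dKa dKt cKt da db.
set k := Kt (a p) (b p).
(* the part of the increment due to b, minus its linear part *)
pose E q := K (a q) (b q) - K (a q) (b p) - k * (b q - b p).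
have dE : is_diff p E (fun=> 0).
  apply: littleo_is_diff => e e0.
  have [C C0 bC] := differentiable_lipschitz_at db.
  have eC0 : 0 < e / C by rewrite divr_gt0.
  have /cvgrPdist_le/(_ _ eC0) := cKt (a p, b p).
  move=> [[A B] /= [nA nB] AB].
  have shift_cvg (f : V -> R) : differentiable f p -> f (h + p) @[h --> 0] --> f p.
    move=> /differentiable_continuous; rewrite /prop_for /continuous_at.
    by rewrite -{1}(add0r p) -cvg_comp_shift.
  have [ca cb] := (shift_cvg _ da, shift_cvg _ db).
  have [d /= d0 dB] := nB.
  near=> h.
  have Ah : A (a (h + p)) by near: h; exact: ca.
  have Bh : `|b p - b (h + p)| < d by near: h; apply: cvgr_dist_lt.
  have [c cB Kc] : exists2 c, B c &
      K (a (h + p)) (b (h + p)) - K (a (h + p)) (b p) =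
      Kt (a (h + p)) c * (b (h + p) - b p).
    have [bb|/ltW bb] := leP (b p) (b (h + p)).
      have [c cbb ->] := mean_value bb (dKt (a (h + p))).
      exists c => //; apply: dB; apply: le_lt_trans Bh => /=.
      by rewrite !ler0_norm; lra.
    have [c cbb eq] := mean_value bb (dKt (a (h + p))).
    exists c; last by rewrite -opprB eq; ring.
    apply: dB; apply: le_lt_trans Bh => /=.
    by rewrite !ger0_norm; lra.
  rewrite /E !subrr mulr0 !subr0 Kc -mulrBl normrM.
  apply: (@le_trans _ _ (e / C * (C * `|h|))).
    apply: ler_pM => //.
      by rewrite distrC; apply: (AB (a (h + p), c)); split.
    by near: h.
  by rewrite mulrA divfK ?gt_eqF.
have d1 := is_diff_comp1 (dKa (a p) (b p)) da.
have d2 : is_diff p (fun q => k * (b q - b p)) (fun v => k * 'd b p v).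
  have := is_diffZ k (is_diffB (differentiableP db) (is_diff_cst (b p) p)).
  by congr is_diff_def; apply/funext => v; rewrite !fctE /GRing.scale/= subr0.
have := is_diffD (is_diffD d1 d2) dE.
have -> : ((K^~ (b p) \o a) + (fun q => k * (b q - b p))) + E = (fun q => K (a q) (b q)).
  by apply/funext => q; rewrite !fctE /E /=; ring.
by congr is_diff_def; apply/funext => v; rewrite !fctE addr0.
Unshelve. all: by end_near. Qed.

End Differentials.

(** * The corrugation angle as a function of sqrt rho / s *)

Section Angle.
Context {R : realType}.
Implicit Types (x y : R).

Definition invsqrt1p x := (Num.sqrt (1 + x ^+ 2))^-1.

(** The angle alpha as a function of x = sqrt rho / s, where s is the height: the
    ratio s / r is 1 / sqrt (1 + x^2). *)
Definition angle x := J0inv (invsqrt1p x).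

Lemma onep_gt0 x : 0 < 1 + x ^+ 2.
Proof. by rewrite ltr_pwDl// sqr_ge0. Qed.

Lemma invsqrt1p_gt0 x : 0 < invsqrt1p x.
Proof. by rewrite invr_gt0 sqrtr_gt0 onep_gt0. Qed.

Lemma invsqrt1p_sqr x : invsqrt1p x ^+ 2 * (1 + x ^+ 2) = 1.
Proof. by rewrite exprVn sqr_sqrtr ?mulVf// ?gt_eqF ?ltW ?onep_gt0. Qed.

Lemma invsqrt1p_le1 x : invsqrt1p x <= 1.
Proof.
have := invsqrt1p_sqr x; have := invsqrt1p_gt0 x; have := sqr_ge0 x.
set q := invsqrt1p x => x2 q0 e.
have : q ^+ 2 <= 1 by rewrite -e ler_peMr ?sqr_ge0// lerDl.
by rewrite expr_le1// ltW.
Qed.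

Lemma angleP x : 0 <= angle x <= alpha0 /\ J0 (angle x) = invsqrt1p x.
Proof. by apply: J0invP; rewrite invsqrt1p_le1 ltW ?invsqrt1p_gt0. Qed.

(** 1 - J0 a is at least a multiple of a^2, and 1 - 1 / sqrt (1 + x^2) <= x^2. *)
Lemma angle_le x : angle x <= 16 * `|x|.
Proof.
have [/andP[a0 aa] Ja] := angleP x; have [_ api _] := @alpha0P R.
have := J0_drop (lexx 0) a0 (le_trans aa api).
rewrite J00 Ja expr0n/= subr0 => h1.
have qx : 1 - invsqrt1p x <= x ^+ 2.
  have := invsqrt1p_sqr x; have := invsqrt1p_gt0 x; have := invsqrt1p_le1 x.
  have := sqr_ge0 x; set q := invsqrt1p x; move: (x ^+ 2) => z z0 q1 q0 e.
  have e2 : 1 - q ^+ 2 = q ^+ 2 * z by rewrite -e; ring.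
  have : q ^+ 2 * z <= 1 * z by rewrite ler_wpM2r// expr_le1// ltW.
  have : q ^+ 2 <= q by rewrite expr2 ler_piMl// ltW.
  lra.
have a2 : angle x ^+ 2 <= (16 * `|x|) ^+ 2.
  rewrite exprMn real_normK ?num_real//.
  have pi1 := @pi_ge2 R.
  have : 1 / 256 * angle x ^+ 2 <= pi / 256 * angle x ^+ 2.
    by rewrite ler_wpM2r ?sqr_ge0//; lra.
  lra.
by rewrite -ler_sqr ?nnegrE// mulr_ge0.
Qed.

Lemma angle_gt0 x : x != 0 -> 0 < angle x.
Proof.
move=> x0; have [/andP[a0 _] Ja] := angleP x.
rewrite lt_neqAle a0 andbT; apply/eqP => a00.
move: Ja; rewrite -a00 J00 => q1.
have := invsqrt1p_sqr x; rewrite -q1 expr1n mul1r => /eqP.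
by rewrite -[eqbRHS]addr0 (inj_eq (addrI _)) sqrf_eq0 (negbTE x0).
Qed.

Lemma angle_lt x : angle x < alpha0.
Proof.
have [/andP[_ a0] Ja] := angleP x; have [_ _ J0a] := @alpha0P R.
rewrite lt_neqAle a0 andbT; apply/eqP => aa.
by have := invsqrt1p_gt0 x; rewrite -Ja aa J0a ltxx.
Qed.

Lemma is_derive_invsqrt1p x :
  is_derive x 1 invsqrt1p (- (x * invsqrt1p x ^+ 3)).
Proof.
have s0 : Num.sqrt (1 + x ^+ 2) != 0 by rewrite gt_eqF// sqrtr_gt0 onep_gt0.
have d1 : is_derive x 1 (fun x : R => 1 + x ^+ 2) (2 * x).
  by apply: is_derive_eq; rewrite /GRing.scale/=; ring.
have d2 := is_derive1_sqrt (onep_gt0 x).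
have d3 := @is_derive1_comp _ _ (fun x : R => 1 + x ^+ 2) _ _ _ d2 d1.
have d4 := @is_deriveV _ (Num.sqrt \o (fun x : R => 1 + x ^+ 2)) _ _ _ s0 d3.
have := d4; congr is_derive.
by rewrite /invsqrt1p /GRing.scale/=; field.
Qed.

(** The derivative is - x q^3 / J0'(angle x) with q = 1 / sqrt (1 + x^2).  Both
    x q and - J0'(angle x) are comparable to angle x, whence the bound, uniform up
    to the singular point x = 0. *)
Lemma is_derive_angle x : x != 0 ->
  exists2 d, is_derive x 1 angle d & `|d| <= 128.
Proof.
move=> x0; have [/andP[a0 aa] Ja] := angleP x; have [_ api _] := @alpha0P R.
have agt := angle_gt0 x0; have alt := angle_lt x.
have dJ := @dJ0_le _ (angle x); have {}dJ := dJ ltac:(by rewrite a0 (le_trans aa)).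
have pi2 := @pi_ge2 R.
have dJlt : dJ0 (angle x) <= - (angle x / 64).
  apply: le_trans dJ _; rewrite lerN2 mulrC ler_wpM2r//; lra.
have dJ_neq0 : dJ0 (angle x) != 0 by rewrite lt_eqF//; lra.
have dinv : is_derive (J0 (angle x)) 1 J0inv (dJ0 (angle x))^-1.
  apply: is_derive_inverse => //.
  - near=> z; apply: J0K; apply/andP; split; apply: ltW.
      by near: z; exact: lt_nbhsr.
    by near: z; exact: lt_nbhsl.
  - by near=> z; exact: continuous_J0.
  - exact: is_derive_J0.
rewrite Ja in dinv.
exists ((dJ0 (angle x))^-1 * - (x * invsqrt1p x ^+ 3)).
  exact: is_derive1_comp dinv (is_derive_invsqrt1p x).
rewrite mulrC normrM normrN normfV ler_pdivrMr ?normr_gt0//.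
have q0 := invsqrt1p_gt0 x; have q1 := invsqrt1p_le1 x.
have xq : `|x| * invsqrt1p x <= 2 * angle x.
  have h : (`|x| * invsqrt1p x) ^+ 2 <= (2 * angle x) ^+ 2.
    rewrite !exprMn real_normK ?num_real//.
    have := J0_ge (angle x); rewrite Ja; have := invsqrt1p_sqr x.
    move: q0 q1; set q := invsqrt1p x; move: (x ^+ 2) (angle x ^+ 2) => z A q0 q1 e J.
    have : z * q ^+ 2 = 1 - q ^+ 2 by rewrite -e; ring.
    have : 1 - q ^+ 2 <= 2 * (1 - q).
      by rewrite -subr_ge0; have -> : 2 * (1 - q) - (1 - q ^+ 2) = (1 - q) ^+ 2 by [ring]; rewrite sqr_ge0.
    lra.
  by rewrite -ler_sqr ?nnegrE//; apply: mulr_ge0 => //; exact: ltW.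
rewrite normrM normrX (gtr0_norm q0) exprS mulrA.
apply: (@le_trans _ _ (2 * angle x * 1)).
  apply: ler_pM => //; rewrite ?mulr_ge0 ?exprn_ge0 ?normr_ge0 ?(ltW q0)//.
  by rewrite expr_le1// ltW.
rewrite ler0_norm; lra.
Unshelve. all: by end_near. Qed.

End Angle.

Section AngleDifferential.
Context {R : realType} {V : normedModType R}.
Implicit Types (a : V -> R) (p v : V).

(** Fermat's rule; the differential is nonnegative in every direction and linear. *)
Lemma diff_at_min a p v : differentiable a p ->
  (\forall h \near 0, a p <= a (h + p)) -> 'd a p v = 0.
Proof.
move=> da mina.
have dge0 u : 0 <= 'd a p u.
  rewrite -oppr_le0; apply/ler_addgt0Pl => e e0; rewrite addr0.
  have [_ /eqaddoP aE] := (diff_locallyP _ _).1 da.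
  pose e' := e / (`|u| + 1).
  have u1 : 0 < `|u| + 1 by rewrite ltr_wpDl.
  have e'0 : 0 < e' by rewrite divr_gt0.
  have {}aE := aE e' e'0.
  have cu' : (fun t : R => t *: u) t @[t --> 0^'+] --> (0 : V).
    have := @scalel_continuous R V u 0; rewrite /continuous_at scale0r.
    exact: cvg_at_right_filter.
  have : \forall t \near (0 : R)^'+, - 'd a p u <= e.
    near=> t.
    have t0 : 0 < t by near: t; exact: nbhs_right_gt.
    have m1 : a p <= a (t *: u + p) by near: t; exact: (cu' _ mina).
    have m2 : `|(a \o shift p - (cst (a p) + 'd a p)) (t *: u)| <= e' * `|t *: u|.
      by near: t; exact: (cu' _ aE).
    move: m2; rewrite !fctE /= linearZ /= normrZ (gtr0_norm t0).
    rewrite ler_norml => /andP[_ m2].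
    have m3 : t * (- 'd a p u) <= t * (e' * `|u|).
      by move: m2; rewrite /GRing.scale/=; lra.
    move: m3; rewrite ler_pM2l// => m3; apply: le_trans m3 _.
    by rewrite /e' mulrAC ler_pdivrMr// ler_wpM2l ?(ltW e0)// lerDl.
  by move=> /filter_ex[].
apply/eqP; rewrite eq_le dge0 andbT -oppr_ge0.
by have := dge0 (- v); rewrite linearN.
Unshelve. all: by end_near. Qed.

(** Where a vanishes, it has a minimum, so its differential is 0 and the angle,
    which is O(a), is o(h). *)
Lemma differentiable_angle a p : differentiable a p ->
  (\forall h \near 0, 0 <= a (h + p)) ->
  differentiable (fun q => angle (a q)) p /\
  forall v, `|'d (fun q => angle (a q)) p v| <= 128 * `|'d a p v|.
Proof.
move=> da a0; have [ap0|ap0] := eqVneq (a p) 0; last first.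
  have [d dd d128] := is_derive_angle ap0.
  have D := is_diff_comp1 dd da.
  have D' : is_diff p (fun q => angle (a q)) (fun v => d * 'd a p v) by [].
  split; first exact: ex_diff.
  by move=> v; rewrite diff_val normrM ler_wpM2r.
have da0 v : 'd a p v = 0.
  by apply: diff_at_min => //; rewrite ap0.
have D : is_diff p (fun q => angle (a q)) (fun=> 0).
  apply: littleo_is_diff => e e0.
  have e16 : 0 < e / 16 by rewrite divr_gt0.
  have [_ /eqaddoP/(_ _ e16)] := (diff_locallyP _ _).1 da.
  apply: filterS => h /=; rewrite !fctE /= da0 addr0 ap0 subr0 => h1.
  have -> : angle 0 = 0 :> R.
    apply/eqP; rewrite eq_le; have [/andP[-> _] _] := @angleP R 0.
    by have := @angle_le R 0; rewrite normr0 mulr0 => ->.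
  rewrite subr0 ger0_norm; last by have [/andP[]] := angleP (a (h + p)).
  by apply: le_trans (angle_le _) _; lra.
split; first exact: ex_diff.
by move=> v; rewrite diff_val normr0 mulr_ge0.
Qed.

End AngleDifferential.

(** * Functions with a bounded differential on the cube *)

Section CompactCube.
Context {R : realType} {n : nat}.
Local Notation chart := 'rV[R]_n.+1.
Implicit Types (a : chart -> R) (p : chart).

Lemma compact_cube : compact (@cube R n.+1).
Proof.
have := @rV_compact R n.+1 (fun=> `[0, 1]%classic) (fun=> @segment_compact R 0 1).
congr compact; apply/seteqP; split=> p /= H i; have := H i; by rewrite /= in_itv/=.
Qed.

Lemma cube0 : @cube R n.+1 0.
Proof. by move=> i; rewrite mxE lexx ler01. Qed.

Lemma cube_bounded a : (forall p, cube p -> {for p, continuous a}) ->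
  exists C, forall p, cube p -> `|a p| <= C.
Proof.
move=> ca.
have cna : {within cube, continuous (fun p => `|a p|)}.
  apply: continuous_in_subspaceT => p; rewrite inE => cp.
  by apply: (@continuous_comp _ _ _ a (fun x : R => `|x|)); [exact: ca | exact: norm_continuous].
have [c _ H] := EVT_max_rV (ex_intro _ 0 cube0) compact_cube cna.
by exists `|a c| => p cp; apply: H; rewrite inE.
Qed.

Lemma cube_lower_bound a : (forall p, cube p -> {for p, continuous a}) ->
  (forall p, cube p -> 0 < a p) ->
  exists2 c, 0 < c & forall p, cube p -> c <= a p.
Proof.
move=> ca a0.
have cna : {within cube, continuous a}.
  by apply: continuous_in_subspaceT => p; rewrite inE; exact: ca.
have [c cc H] := EVT_min_rV (ex_intro _ 0 cube0) compact_cube cna.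
by exists (a c) => [|p cp]; [apply: a0; rewrite inE in cc | apply: H; rewrite inE].
Qed.

End CompactCube.

Section BoundedDerivative.
Context {R : realType} {n : nat} (O : set 'rV[R]_n.+1).
Hypotheses (O_open : open O) (cube_O : cube `<=` O).
Local Notation chart := 'rV[R]_n.+1.
Implicit Types (a b : chart -> R) (p v : chart).

(** A substitute for C^1 regularity up to the boundary of the cube: the angle alpha
    need not be C^1 where rho vanishes, but its differential is bounded. *)
Definition bounded_diff a :=
  (forall p, O p -> differentiable a p) /\
  (forall v, exists C, forall p, cube p -> `|'d a p v| <= C).

Lemma is_diff_bounded a (da : chart -> chart -> R) :
  (forall p, O p -> is_diff p a (da p)) ->
  (forall v, exists C, forall p, cube p -> `|da p v| <= C) -> bounded_diff a.
Proof.
move=> D B; split=> [p /D[]//|v]; have [C HC] := B v; exists C => p cp.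
by have [_ ->] := D _ (cube_O cp); exact: HC.
Qed.

Lemma bounded_diff_continuous a p : bounded_diff a -> O p -> {for p, continuous a}.
Proof. by move=> [da _] Op; exact/differentiable_continuous/da. Qed.

Lemma bounded_diff_bounded a : bounded_diff a -> exists C, forall p, cube p -> `|a p| <= C.
Proof.
by move=> da; apply: cube_bounded => p /cube_O; exact: bounded_diff_continuous.
Qed.

Lemma bounded_diff_lower_bound a : bounded_diff a -> (forall p, O p -> 0 < a p) ->
  exists2 c, 0 < c & forall p, cube p -> c <= a p.
Proof.
move=> da a0; apply: cube_lower_bound => [p /cube_O|p /cube_O]; last exact: a0.
exact: bounded_diff_continuous.
Qed.

Lemma eq_bounded_diff a b : (forall p, O p -> a p = b p) ->
  bounded_diff a -> bounded_diff b.
Proof.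
move=> ab [da Ba].
apply: is_diff_bounded Ba => p Op.
apply: near_is_diff (differentiableP (da _ Op)).
by apply: filterS ab _; exact: open_nbhs_nbhs.
Qed.

Lemma bounded_diff_cst (k : R) : bounded_diff (fun=> k).
Proof.
split=> [p _|v]; first exact: differentiable_cst.
by exists 0 => p _; rewrite (diff_cst k p) normr0.
Qed.

Lemma bounded_diffD a b : bounded_diff a -> bounded_diff b ->
  bounded_diff (fun p => a p + b p).
Proof.
move=> [da Ba] [db Bb].
apply: (@is_diff_bounded _ (fun p v => 'd a p v + 'd b p v)) => [p Op|v].
  exact: is_diffD (differentiableP (da _ Op)) (differentiableP (db _ Op)).
have [C HC] := Ba v; have [D HD] := Bb v; exists (C + D) => p cp.
by apply: le_trans (ler_normD _ _) (lerD (HC _ cp) (HD _ cp)).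
Qed.

Lemma bounded_diffM a b : bounded_diff a -> bounded_diff b ->
  bounded_diff (fun p => a p * b p).
Proof.
move=> ha hb; have [A HA] := bounded_diff_bounded ha; have [B HB] := bounded_diff_bounded hb.
case: ha hb => [da Ba] [db Bb].
apply: (@is_diff_bounded _ (fun p v => a p * 'd b p v + b p * 'd a p v)) => [p Op|v].
  exact: is_diffM (differentiableP (da _ Op)) (differentiableP (db _ Op)).
have [C HC] := Ba v; have [D HD] := Bb v; exists (A * D + B * C) => p cp.
apply: le_trans (ler_normD _ _) _; rewrite !normrM.
by apply: lerD; apply: ler_pM; rewrite ?normr_ge0//; [exact: HA|exact: HD|exact: HB|exact: HC].
Qed.

Lemma bounded_diff_sum (I : Type) (r : seq I) (P : pred I) (F : I -> chart -> R) :
  (forall i, bounded_diff (F i)) -> bounded_diff (fun p => \sum_(i <- r | P i) F i p).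
Proof.
move=> hF; elim: r => [|i r IH].
  by apply: eq_bounded_diff (bounded_diff_cst 0) => p _; rewrite big_nil.
case Pi: (P i); last by apply: eq_bounded_diff IH => p _; rewrite big_cons Pi.
by apply: eq_bounded_diff (bounded_diffD (hF i) IH) => p _; rewrite big_cons Pi.
Qed.

Lemma bounded_diff_prod (I : Type) (r : seq I) (P : pred I) (F : I -> chart -> R) :
  (forall i, bounded_diff (F i)) -> bounded_diff (fun p => \prod_(i <- r | P i) F i p).
Proof.
move=> hF; elim: r => [|i r IH].
  by apply: eq_bounded_diff (bounded_diff_cst 1) => p _; rewrite big_nil.
case Pi: (P i); last by apply: eq_bounded_diff IH => p _; rewrite big_cons Pi.
by apply: eq_bounded_diff (bounded_diffM (hF i) IH) => p _; rewrite big_cons Pi.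
Qed.

Lemma bounded_diff_det d (M : chart -> 'M[R]_d) :
  (forall i j, bounded_diff (fun p => M p i j)) -> bounded_diff (fun p => \det (M p)).
Proof.
move=> hM; rewrite /determinant; apply: bounded_diff_sum => s.
apply: bounded_diffM; first exact: bounded_diff_cst.
by apply: bounded_diff_prod => i; exact: hM.
Qed.

(** The values of a on the cube stay in a compact subset of the positive half-line,
    where the derivative of f is bounded. *)
Lemma bounded_diff_comp (f df : R -> R) a :
  (forall x : R, 0 < x -> is_derive x 1 f (df x)) ->
  (forall x : R, 0 < x -> {for x, continuous df}) ->
  bounded_diff a -> (forall p, O p -> 0 < a p) -> bounded_diff (fun p => f (a p)).
Proof.
move=> fdf cdf ha a0.
have [B HB] : exists C, forall p, cube p -> `|df (a p)| <= C.
  apply: (cube_bounded (a := fun p => df (a p))) => p /cube_O Op.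
  apply: continuous_comp; first exact: bounded_diff_continuous.
  exact/cdf/a0.
apply: (@is_diff_bounded _ (fun p v => df (a p) * 'd a p v)) => [p Op|v].
  by apply: is_diff_comp1; [exact/fdf/a0 | exact: ha.1].
have [C HC] := ha.2 v; exists (B * C) => p cp; rewrite normrM.
by apply: ler_pM; rewrite ?normr_ge0//; [exact: HB|exact: HC].
Qed.

Lemma bounded_diffV a : bounded_diff a -> (forall p, O p -> 0 < a p) ->
  bounded_diff (fun p => (a p)^-1).
Proof.
apply: (@bounded_diff_comp _ (fun x => - x ^- 2 * 1)) => x x0.
  by apply: (@is_deriveV _ id); rewrite gt_eqF.
apply: continuousM; last exact: cst_continuous.
apply: continuousN; apply: continuousV; first by rewrite expf_neq0// gt_eqF.
exact: exprn_continuous.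
Qed.

Lemma bounded_diff_sqrt a : bounded_diff a -> (forall p, O p -> 0 < a p) ->
  bounded_diff (fun p => Num.sqrt (a p)).
Proof.
apply: (@bounded_diff_comp _ (fun x => (2 * Num.sqrt x)^-1)) => x x0.
apply: continuousV; first by rewrite mulf_neq0// gt_eqF// sqrtr_gt0.
by apply: continuousM; [exact: cst_continuous | exact: sqrt_continuous].
Qed.

Lemma bounded_diff_angle a : bounded_diff a -> (forall p, O p -> 0 <= a p) ->
  bounded_diff (fun p => angle (a p)).
Proof.
move=> ha a0.
have D p : O p -> differentiable (fun q => angle (a q)) p /\
    forall v, `|'d (fun q => angle (a q)) p v| <= 128 * `|'d a p v|.
  move=> Op; apply: differentiable_angle; first exact: ha.1.
  have : \forall q \near p, 0 <= a q by apply: filterS a0 _; exact: open_nbhs_nbhs.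
  by rewrite (near_shift 0 p) /=; apply: filterS => h /=; rewrite subr0.
split=> [p /D[]//|v].
have [C HC] := ha.2 v; exists (128 * C) => p cp.
by apply: le_trans ((D _ (cube_O cp)).2 v) _; rewrite ler_wpM2l// HC.
Qed.

Lemma class_C1_bounded_diff (h : chart -> R^o) : class_C 1 O h -> bounded_diff h.
Proof.
move=> [dh ch]; split=> // v; apply: cube_bounded => p cp; exact/(ch v)/cube_O.
Qed.

Lemma is_diff_coord d (h : chart -> 'rV[R]_d.+1) p i : differentiable h p ->
  is_diff p (fun q => h q 0 i) (fun v => 'd h p v 0 i).
Proof.
move=> dh.
have := is_diff_comp (differentiableP dh)
  (differentiableP (@differentiable_coord R 1 d.+1 (h p) 0 i)).
congr is_diff_def; apply/funext => v /=.
have clin : linear (fun M : 'rV[R]_d.+1 => M 0 i) by move=> k x y; rewrite !mxE.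
pose cM := GRing.isLinear.Build _ _ _ _ _ clin.
pose c : {linear 'rV[R]_d.+1 -> R} := HB.pack (fun M : 'rV[R]_d.+1 => M 0 i) cM.
by have /(_ (h p)) -> := @diff_lin _ _ _ c ^~ (@coord_continuous _ _ _ _ _).
Qed.

Lemma class_C1_bounded_diff_coord d (h : chart -> 'rV[R]_d.+1) i :
  class_C 1 O h -> bounded_diff (fun p => h p 0 i).
Proof.
move=> [dh ch].
apply: (@is_diff_bounded _ (fun p v => 'd h p v 0 i)) => [p /dh|v].
  exact: is_diff_coord.
apply: (cube_bounded (a := fun p => 'd h p v 0 i)) => p cp.
apply: (@continuous_comp _ _ _ (fun p => 'd h p v) (fun M : 'rV[R]_d.+1 => M 0 i)).
  exact/(ch v)/cube_O.
exact: coord_continuous.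
Qed.

End BoundedDerivative.

(** * Dot product and vector product *)

Section DotProduct.
Context {R : realType} {d : nat}.
Implicit Types (x y z : 'rV[R]_d) (k : R).

Lemma dotE x y : dot x y = \sum_i x 0 i * y 0 i.
Proof. by rewrite /dot mxE; apply: eq_bigr => i _; rewrite mxE. Qed.

Lemma dotC x y : dot x y = dot y x.
Proof. by rewrite !dotE; apply: eq_bigr => i _; rewrite mulrC. Qed.

Lemma dotDl x y z : dot (x + y) z = dot x z + dot y z.
Proof. by rewrite /dot mulmxDl mxE. Qed.

Lemma dotZl k x z : dot (k *: x) z = k * dot x z.
Proof. by rewrite /dot -scalemxAl mxE. Qed.

Lemma dotDr x y z : dot z (x + y) = dot z x + dot z y.
Proof. by rewrite dotC dotDl !(dotC z). Qed.

Lemma dotZr k x z : dot z (k *: x) = k * dot z x.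
Proof. by rewrite dotC dotZl (dotC z). Qed.

Lemma dotNl x z : dot (- x) z = - dot x z.
Proof. by rewrite -scaleN1r dotZl mulN1r. Qed.

Lemma dotNr x z : dot z (- x) = - dot z x.
Proof. by rewrite dotC dotNl (dotC z). Qed.

Lemma dotBl x y z : dot (x - y) z = dot x z - dot y z.
Proof. by rewrite dotDl dotNl. Qed.

Lemma dotBr x y z : dot z (x - y) = dot z x - dot z y.
Proof. by rewrite dotDr dotNr. Qed.

Lemma dot0l z : dot 0 z = 0.
Proof. by rewrite -(scale0r 0) dotZl mul0r. Qed.

Lemma dot_suml (I : Type) (r : seq I) (P : pred I) (F : I -> 'rV[R]_d) z :
  dot (\sum_(i <- r | P i) F i) z = \sum_(i <- r | P i) dot (F i) z.
Proof.
by apply: (big_morph (dot ^~ z)) => [x y|]; [exact: dotDl | exact: dot0l].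
Qed.

Lemma dot_ge0 x : 0 <= dot x x.
Proof. by rewrite dotE sumr_ge0// => i _; rewrite -expr2 sqr_ge0. Qed.

Lemma dot_eq0 x : (dot x x == 0) = (x == 0).
Proof.
apply/idP/idP => [|/eqP->]; last by rewrite dot0l.
rewrite dotE psumr_eq0 => [/allP x0|i _]; last by rewrite -expr2 sqr_ge0.
apply/eqP/rowP => i; rewrite mxE; apply/eqP.
by have := x0 i (mem_index_enum _); rewrite mulf_eq0 orbb.
Qed.

Lemma dot_gt0 x : (0 < dot x x) = (x != 0).
Proof. by rewrite lt_neqAle dot_ge0 andbT eq_sym dot_eq0. Qed.

Lemma enorm_sqr x : enorm x ^+ 2 = dot x x.
Proof. by rewrite sqr_sqrtr ?dot_ge0. Qed.

Lemma enorm_gt0 x : (0 < enorm x) = (x != 0).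
Proof. by rewrite sqrtr_gt0 dot_gt0. Qed.

Lemma enorm0 : enorm (0 : 'rV[R]_d) = 0.
Proof. by rewrite /enorm dot0l sqrtr0. Qed.

Lemma normalize0 : normalize (0 : 'rV[R]_d) = 0.
Proof. by rewrite /normalize scaler0. Qed.

Lemma enormZ k x : enorm (k *: x) = `|k| * enorm x.
Proof. by rewrite /enorm dotZl dotZr mulrA -expr2 sqrtrM ?sqr_ge0// sqrtr_sqr. Qed.

Lemma enorm_normalizeK x : enorm x *: normalize x = x.
Proof.
have [->|x0] := eqVneq x 0; first by rewrite normalize0 scaler0.
by rewrite scalerA divff ?scale1r// gt_eqF// enorm_gt0.
Qed.

Lemma dot_normalize x : x != 0 -> dot (normalize x) (normalize x) = 1.
Proof.
move=> x0; rewrite dotZl dotZr -enorm_sqr mulrA -expr2 -exprMn mulVf ?expr1n//.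
by rewrite gt_eqF// enorm_gt0.
Qed.

Lemma normalizeZ k x : 0 < k -> normalize (k *: x) = normalize x.
Proof.
move=> k0; rewrite /normalize enormZ gtr0_norm// scalerA invfM mulrAC.
by rewrite mulVf ?mul1r// gt_eqF.
Qed.

Lemma normalize_unit x : dot x x = 1 -> normalize x = x.
Proof. by move=> x1; rewrite /normalize /enorm x1 sqrtr1 invr1 scale1r. Qed.

End DotProduct.

Section Families.
Context {T : Type} {k : nat}.
Implicit Types (x : T) (a : 'I_k -> T).

Lemma fcons0 x a : fcons x a ord0 = x.
Proof. by rewrite /fcons unlift_none. Qed.

Lemma fconsS x a i : fcons x a (lift ord0 i) = a i.
Proof. by rewrite /fcons liftK. Qed.

Lemma frcons_max a x : frcons a x ord_max = x.
Proof. by rewrite /frcons unlift_none. Qed.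

Lemma frcons_lift a x i : frcons a x (lift ord_max i) = a i.
Proof. by rewrite /frcons liftK. Qed.

End Families.

(** Both sides are the family x, a, y. *)
Lemma fcons_frcons (T : Type) k (x y : T) (a : 'I_k -> T) :
  fcons x (frcons a y) = frcons (fcons x a) y.
Proof.
apply/funext => i.
case: (unliftP ord0 i) => [j ->|->]; last first.
  rewrite fcons0; have -> : ord0 = lift ord_max ord0 :> 'I_k.+2 by apply: ord_inj.
  by rewrite frcons_lift fcons0.
rewrite fconsS; case: (unliftP ord_max j) => [l ->|->].
  have -> : lift ord0 (lift ord_max l) = lift ord_max (lift ord0 l).
    by apply: ord_inj; rewrite lift0 !lift_max lift0.
  by rewrite !frcons_lift fconsS.
have -> : lift ord0 ord_max = ord_max :> 'I_k.+2 by apply: ord_inj; rewrite lift0.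
by rewrite !frcons_max.
Qed.

Lemma sum_ord_max (V : nmodType) k (F : 'I_k.+1 -> V) :
  \sum_i F i = \sum_i F (lift ord_max i) + F ord_max.
Proof.
rewrite big_ord_recr /=; congr (_ + _); apply: eq_bigr => i _; congr F.
by apply: ord_inj; rewrite lift_max.
Qed.

Section Wedge.
Context {R : realType} {d : nat}.
Local Notation vec := 'rV[R]_d.+1.
Implicit Types (a b : 'I_d -> vec) (x y : vec) (k : R).

(** The determinant det (a_1, ..., a_d, x) that defines the vector product. *)
Definition last_det a x := \det (\matrix_i frcons a x i).

Lemma minor_frcons a x j :
  row' ord_max (col' j (\matrix_i frcons a x i)) = col' j (\matrix_i a i).
Proof. by apply/matrixP => i l; rewrite !mxE frcons_lift. Qed.

Lemma minor_fcons a x j :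
  row' ord0 (col' j (\matrix_i fcons x a i)) = col' j (\matrix_i a i).
Proof. by apply/matrixP => i l; rewrite !mxE fconsS. Qed.

(** Expansion along the last row; it shows that the determinant depends on a only
    through the maximal minors. *)
Lemma last_detE a x : last_det a x =
  \sum_j x 0 j * ((-1) ^+ (d + j) * \det (col' j (\matrix_i a i))).
Proof.
rewrite /last_det (expand_det_row _ ord_max); apply: eq_bigr => j _.
by rewrite mxE frcons_max /cofactor minor_frcons.
Qed.

(** Moving the vector x from the last to the first place is a cycle of length d + 1. *)
Lemma det_fcons a x : \det (\matrix_i fcons x a i) = (-1) ^+ d * last_det a x.
Proof.
rewrite last_detE (expand_det_row _ ord0) mulr_sumr; apply: eq_bigr => j _.
rewrite mxE fcons0 /cofactor minor_fcons add0n exprD.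
have s2 : (-1) ^+ d * (-1) ^+ d = 1 :> R by rewrite -expr2 sqrr_sign.
by move: s2; set e := _ ^+ d => s2; rewrite -[LHS]mul1r -s2; ring.
Qed.

Lemma dot_wedge a x : dot (wedge a) x = last_det a x.
Proof.
rewrite dotE last_detE; apply: eq_bigr => j _; rewrite mxE -/(last_det _ _) last_detE.
rewrite (bigD1 j)//= big1 ?addr0; last first.
  by move=> i ij; rewrite mxE eqxx (negbTE ij) mul0r.
by rewrite mxE !eqxx mul1r mulrC.
Qed.

(** A vector is determined by its dot products. *)
Lemma wedge_eqP a y : (forall x, last_det a x = dot y x) -> wedge a = y.
Proof.
move=> H; apply/eqP; rewrite -subr_eq0 -dot_eq0 dotBl dot_wedge H.
by rewrite subrr.
Qed.

Lemma last_detDr a x y : last_det a (x + y) = last_det a x + last_det a y.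
Proof. by rewrite -!dot_wedge dotDr. Qed.

Lemma last_detZr a k x : last_det a (k *: x) = k * last_det a x.
Proof. by rewrite -!dot_wedge dotZr. Qed.

Lemma dot_wedge_family a i : dot (wedge a) (a i) = 0.
Proof.
rewrite dot_wedge; apply: (@determinant_alternate _ _ _ (lift ord_max i) ord_max).
  by rewrite eq_sym neq_lift.
by move=> j; rewrite !mxE frcons_lift frcons_max.
Qed.

(** Every maximal minor is multiplied by det M. *)
Lemma last_det_mul (M : 'M[R]_d) a b x :
  \matrix_i b i = M *m (\matrix_i a i) -> last_det b x = \det M * last_det a x.
Proof.
move=> bE; rewrite !last_detE mulr_sumr; apply: eq_bigr => j _.
have -> : col' j (\matrix_i b i) = M *m col' j (\matrix_i a i).
  by rewrite bE; apply/matrixP => i l; rewrite !mxE; apply: eq_bigr => m _; rewrite !mxE.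
by rewrite det_mulmx; ring.
Qed.

Lemma wedge_mul (M : 'M[R]_d) a b :
  \matrix_i b i = M *m (\matrix_i a i) -> wedge b = \det M *: wedge a.
Proof.
by move=> bE; apply: wedge_eqP => x; rewrite (last_det_mul x bE) dotZl dot_wedge.
Qed.

Lemma wedge_neq0_row_free a : wedge a != 0 -> row_free (\matrix_i a i).
Proof.
move=> W0; rewrite -kermx_eq0; apply/rowV0P => u /sub_kermxP ua.
apply/eqP/negPn/negP => u0.
have /rV0Pn [i ui] := u0.
suff /eqP : wedge a = 0 by rewrite (negbTE W0).
apply: wedge_eqP => x; rewrite dot0l last_detE big1// => j _.
suff -> : \det (col' j (\matrix_i a i)) = 0 by rewrite !mulr0.
apply/eqP/det0P; exists u => //.
have -> : u *m col' j (\matrix_i a i) = col' j (u *m \matrix_i a i).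
  by apply/matrixP => m l; rewrite !mxE; apply: eq_bigr => q _; rewrite mxE.
by rewrite ua; apply/rowP => l; rewrite !mxE.
Qed.

(** A vector outside of the span of a completes it to a basis, whose determinant
    is not 0. *)
Lemma row_free_wedge_neq0 a : row_free (\matrix_i a i) -> wedge a != 0.
Proof.
move=> fa; have /row_freeP[B aB] := fa.
have nfull : ~~ row_full (\matrix_i a i).
  by rewrite /row_full (eqP fa) neq_ltn ltnSn.
(* d vectors do not span a space of dimension d + 1. *)
have [x xa] : exists x : 'rV[R]_d.+1, ~~ (x <= \matrix_i a i)%MS.
  apply/not_existsP => H; move/negP: nfull; apply; rewrite -sub1mx.
  by apply/row_subP => i; apply/negPn/negP/H.
apply/negP => /eqP W0.
have := dot_wedge a x; rewrite W0 dot0l => /esym/eqP/det0P[u u0 ux].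
have uE : u *m (\matrix_i frcons a x i) =
    (\row_i u 0 (lift ord_max i)) *m (\matrix_i a i) + u 0 ord_max *: x.
  apply/rowP => j; rewrite !mxE sum_ord_max; congr (_ + _).
    by apply: eq_bigr => l _; rewrite !mxE frcons_lift.
  by rewrite mxE frcons_max.
have := ux; rewrite uE => /eqP; rewrite addr_eq0 => /eqP u'a.
have umax : u 0 ord_max = 0.
  apply/eqP/negPn/negP => um; move/negP: xa; apply.
  have -> : x = - (u 0 ord_max)^-1 *: ((\row_i u 0 (lift ord_max i)) *m (\matrix_i a i)).
    by rewrite u'a scaleNr scalerN opprK scalerA mulVf// scale1r.
  exact: scalemx_sub (submxMl _ _).
have u'0 : \row_i u 0 (lift ord_max i) = 0.
  by rewrite -[LHS]mulmx1 -aB mulmxA u'a umax scale0r oppr0 mul0mx.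
move/eqP: u0; apply; apply/rowP => i; rewrite mxE.
case: (unliftP ord_max i) => [l ->|-> //].
by move/rowP: u'0 => /(_ l); rewrite !mxE.
Qed.

End Wedge.

(** * Gram-Schmidt orthonormalization *)

Section GramSchmidt.
Context {R : realType} {k d : nat}.
Local Notation vec := 'rV[R]_d.
Implicit Types (s : seq vec) (a : 'I_k -> vec).

Lemma gram_schmidt_seq_rcons s (x : vec) : gram_schmidt_seq (rcons s x) =
  rcons (gram_schmidt_seq s)
        (normalize (x - \sum_(w <- gram_schmidt_seq s) dot x w *: w)).
Proof. by rewrite /gram_schmidt_seq -cats1 foldl_cat. Qed.

Lemma size_gram_schmidt_seq s : size (gram_schmidt_seq s) = size s.
Proof.
by elim/last_ind: s => [//|s x IH]; rewrite gram_schmidt_seq_rcons !size_rcons IH.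
Qed.

Lemma nth_gram_schmidt_seq_cat s1 s2 i : (i < size s1)%N ->
  nth 0 (gram_schmidt_seq (s1 ++ s2)) i = nth 0 (gram_schmidt_seq s1) i.
Proof.
move=> i1; elim/last_ind: s2 => [|s2 x IH]; first by rewrite cats0.
rewrite -rcons_cat gram_schmidt_seq_rcons nth_rcons size_gram_schmidt_seq size_cat.
by rewrite (leq_trans i1 (leq_addr _ _)) IH.
Qed.

(** The vector that Gram-Schmidt normalizes at the index i. *)
Definition residual a i :=
  a i - \sum_(j < k | (j < i)%N) dot (a i) (gram_schmidt a j) *: gram_schmidt a j.

(** The list-based definition, unfolded into a recursion on indices. *)
Lemma gram_schmidtE a i : gram_schmidt a i = normalize (residual a i).
Proof.
rewrite {1}/gram_schmidt; set s := [seq a j | j <- enum 'I_k].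
have sz : size s = k by rewrite size_map size_enum_ord.
have ik : (i < size s)%N by rewrite sz.
have nth_s : nth 0 s i = a i by rewrite (nth_map i) ?size_enum_ord// nth_ord_enum.
rewrite -[s](cat_take_drop i.+1) nth_gram_schmidt_seq_cat ?size_takel//.
rewrite (take_nth 0 ik) gram_schmidt_seq_rcons nth_rcons size_gram_schmidt_seq.
rewrite size_takel ?(ltnW ik)// ltnn eqxx nth_s /residual; congr (normalize (_ - _)).
rewrite (big_nth 0) size_gram_schmidt_seq size_takel ?(ltnW ik)// big_mkord.
rewrite (big_ord_widen k (fun j => dot (a i) (nth 0 (gram_schmidt_seq (take i s)) j) *:
   nth 0 (gram_schmidt_seq (take i s)) j)) ?(ltnW (ltn_ord i))//.
apply: eq_bigr => j ji; rewrite /gram_schmidt -/s -[in RHS](cat_take_drop i s).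
by rewrite nth_gram_schmidt_seq_cat// size_takel// ltnW.
Qed.

(** The triangular factor of the QR factorization. *)
Definition gram_schmidt_mx a : 'M[R]_k := \matrix_(i, j)
  if (j < i)%N then dot (a i) (gram_schmidt a j)
  else if i == j then enorm (residual a i) else 0.

(** This holds for any family, free or not: it is the QR factorization. *)
Lemma gram_schmidt_mxE a :
  \matrix_i a i = gram_schmidt_mx a *m \matrix_i gram_schmidt a i.
Proof.
apply/row_matrixP => i; rewrite row_mul rowK mulmx_sum_row.
rewrite (bigID (fun j : 'I_k => (j < i)%N))/=.
rewrite [X in _ + X](bigD1 i) ?ltnn//= [X in _ + (_ + X)]big1 ?addr0; last first.
  move=> j /andP[ij ji]; rewrite !mxE (negbTE ij) eq_sym (negbTE ji).
  by rewrite scale0r.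
rewrite !mxE ltnn eqxx rowK gram_schmidtE enorm_normalizeK.
rewrite /residual addrC; set S := \sum_(_ < _ | _) _; set S' := \sum_(_ < _ | _) _.
have -> : S' = S by apply: eq_bigr => j ji; rewrite !mxE ji rowK.
by rewrite subrK.
Qed.

Lemma det_gram_schmidt_mx a : \det (gram_schmidt_mx a) = \prod_i enorm (residual a i).
Proof.
rewrite det_trig; first by apply: eq_bigr => i _; rewrite mxE ltnn eqxx.
apply/is_trig_mxP => i j ij; rewrite mxE ltnNge (ltnW ij)/=.
by rewrite -val_eqE ltn_eqF.
Qed.

(** By the QR factorization, a free family forces the triangular factor to be
    invertible, so that no diagonal entry vanishes. *)
Lemma residual_neq0 a i : row_free (\matrix_i a i) -> residual a i != 0.
Proof.
move=> fa; have Tu : gram_schmidt_mx a \in unitmx.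
  rewrite -row_free_unit /row_free eqn_leq rank_leq_row/=.
  by rewrite -{1}(eqP fa) gram_schmidt_mxE mxrankM_maxl.
have := Tu; rewrite unitmxE unitfE det_gram_schmidt_mx => /prodf_neq0/(_ i isT).
by apply: contraNneq => ->; rewrite enorm0.
Qed.

Lemma det_gram_schmidt_mx_gt0 a : row_free (\matrix_i a i) ->
  0 < \det (gram_schmidt_mx a).
Proof.
move=> fa; rewrite det_gram_schmidt_mx prodr_gt0// => i _.
by rewrite enorm_gt0 residual_neq0.
Qed.

Lemma gram_schmidt_orthonormal a : row_free (\matrix_i a i) ->
  forall i j, dot (gram_schmidt a i) (gram_schmidt a j) = (i == j)%:R.
Proof.
move=> fa; set v := gram_schmidt a.
have v1 i : dot (v i) (v i) = 1.
  by rewrite /v gram_schmidtE dot_normalize// residual_neq0.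
have ortho m : forall i j : 'I_k, (i < m)%N -> (j < i)%N -> dot (v i) (v j) = 0.
  elim: m => [//|m IH] i j; rewrite ltnS => im ji.
  rewrite /v gram_schmidtE dotZl; apply/eqP; rewrite mulf_eq0; apply/orP; right.
  rewrite /residual dotBl dot_suml (bigD1 j)//= dotZl v1 mulr1 big1 ?addr0 ?subrr//.
  move=> l /andP[li lj]; rewrite dotZl -/v.
  case: (ltngtP l j) => [ltlj|ltjl|/ord_inj e]; last by rewrite e eqxx in lj.
    by rewrite [dot (v l) _]dotC (IH j l) ?mulr0// (leq_trans ji).
  by rewrite (IH l j) ?mulr0// (leq_trans li).
move=> i j; case: (ltngtP i j) => [ij|ji|/ord_inj->]; last by rewrite v1 eqxx.
  by rewrite dotC (ortho j.+1 j i)// -val_eqE/= ltn_eqF.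
by rewrite (ortho i.+1 i j)// -val_eqE/= gtn_eqF.
Qed.

End GramSchmidt.

(** * Geometry of a framed hyperplane *)

Section HyperplaneGeometry.
Context {R : realType} {n : nat}.
Local Notation vec := 'rV[R]_n.+2.
Variables (X : 'I_n -> vec) (Y : vec).
Implicit Types (x y z : vec) (k : R).

(** det (x, X_1, ..., X_n, y), an alternating bilinear form in (x, y). *)
Definition det_around x y := last_det (fcons x X) y.

Lemma det_aroundE x y : det_around x y = (-1) ^+ n.+1 * last_det (frcons X y) x.
Proof. by rewrite /det_around -det_fcons fcons_frcons. Qed.

Lemma det_aroundDl x y z : det_around (x + y) z = det_around x z + det_around y z.
Proof. by rewrite !det_aroundE last_detDr mulrDr. Qed.

Lemma det_aroundZl k x z : det_around (k *: x) z = k * det_around x z.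
Proof. by rewrite !det_aroundE last_detZr mulrCA. Qed.

Lemma det_aroundDr x y z : det_around z (x + y) = det_around z x + det_around z y.
Proof. exact: last_detDr. Qed.

Lemma det_aroundZr k x z : det_around z (k *: x) = k * det_around z x.
Proof. exact: last_detZr. Qed.

Lemma det_around_alt x : det_around x x = 0.
Proof.
have := dot_wedge_family (fcons x X) ord0.
by rewrite dot_wedge fcons0.
Qed.

Lemma det_around_anti x y : det_around y x = - det_around x y.
Proof.
have := det_around_alt (x + y).
rewrite det_aroundDl !det_aroundDr !det_around_alt add0r addr0 addrC => /eqP.
by rewrite addr_eq0 => /eqP.
Qed.

Lemma det_around_family x i : det_around x (X i) = 0.
Proof.
have := dot_wedge_family (fcons x X) (lift ord0 i).
by rewrite dot_wedge fconsS.
Qed.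

Definition hyper_normal := normalize (wedge (fcons Y X)).
Local Notation nu := hyper_normal.

(** A vector of the direction of t.  The sign makes its product with Y positive. *)
Definition conormal := (-1) ^+ n.+1 *: wedge (frcons X nu).

Definition unit_conormal := normalize conormal.
Local Notation t := unit_conormal.

Lemma dot_hyper_normal x : dot nu x = (enorm (wedge (fcons Y X)))^-1 * det_around Y x.
Proof. by rewrite dotZl dot_wedge. Qed.

Lemma dot_conormal x : dot conormal x = det_around x nu.
Proof. by rewrite dotZl dot_wedge det_aroundE. Qed.

Lemma hyper_normal_family i : dot nu (X i) = 0.
Proof. by rewrite dot_hyper_normal det_around_family mulr0. Qed.

Lemma hyper_normalY : dot nu Y = 0.
Proof. by rewrite dot_hyper_normal det_around_alt mulr0. Qed.

Lemma conormal_family i : dot conormal (X i) = 0.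
Proof. by rewrite dot_conormal det_around_anti det_around_family oppr0. Qed.

Lemma conormal_normal : dot conormal nu = 0.
Proof. by rewrite dot_conormal det_around_alt. Qed.

Hypothesis W0 : wedge (fcons Y X) != 0.

Lemma hyper_normal_unit : dot nu nu = 1.
Proof. exact: dot_normalize. Qed.

(** <t', Y> = det (Y, X, n) = <Y /\ X, n>, the norm of Y /\ X. *)
Lemma conormalY : dot conormal Y = enorm (wedge (fcons Y X)).
Proof.
rewrite dot_conormal /det_around -dot_wedge -[X in dot X _]enorm_normalizeK dotZl.
by rewrite hyper_normal_unit mulr1.
Qed.

Lemma conormalY_gt0 : 0 < dot conormal Y.
Proof. by rewrite conormalY enorm_gt0. Qed.

Lemma conormal_neq0 : conormal != 0.
Proof. by apply: contraTneq conormalY_gt0 => ->; rewrite dot0l ltxx. Qed.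

Lemma unit_conormal_unit : dot t t = 1.
Proof. exact/dot_normalize/conormal_neq0. Qed.

Lemma unit_conormal_family i : dot t (X i) = 0.
Proof. by rewrite dotZl conormal_family mulr0. Qed.

Lemma unit_conormal_normal : dot t nu = 0.
Proof. by rewrite dotZl conormal_normal mulr0. Qed.

(** The norm of the component of Y orthogonal to the span of X. *)
Definition height := dot t Y.

Lemma heightE : height = enorm (wedge (fcons Y X)) / enorm conormal.
Proof. by rewrite /height dotZl conormalY mulrC. Qed.

Lemma height_gt0 : 0 < height.
Proof. by rewrite heightE divr_gt0 ?enorm_gt0// conormal_neq0. Qed.

(** X, n and the conormal form a basis; n and t are orthogonal to each other and
    to X, so their coefficients are dot products. *)
Lemma orthogonal_decomposition x : exists b : 'I_n -> R,
  x = \sum_i b i *: X i + dot x nu *: nu + dot x t *: t.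
Proof.
(* its determinant is, up to sign, the square norm of the conormal *)
pose M := \matrix_i frcons (frcons X nu) conormal i.
have Mu : M \in unitmx.
  rewrite unitmxE unitfE -/(last_det _ _) -dot_wedge.
  apply: contra_neq conormal_neq0 => e; apply/eqP; rewrite -dot_eq0.
  by rewrite {1}/conormal dotZl e mulr0.
pose y := x *m invmx M.
have xE : x = \sum_i y 0 (lift ord_max (lift ord_max i)) *: X i
    + y 0 (lift ord_max ord_max) *: nu + y 0 ord_max *: conormal.
  rewrite -[LHS](mulmxKV Mu) -/y mulmx_sum_row !sum_ord_max !rowK.
  rewrite !(frcons_lift, frcons_max); congr (_ + _ + _); apply: eq_bigr => i _.
  by rewrite rowK !frcons_lift.
set b := fun i => y 0 (lift ord_max (lift ord_max i)).
set beta := y 0 (lift ord_max ord_max) in xE.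
set gamma := y 0 ord_max in xE.
have S0 z : (forall i, dot z (X i) = 0) -> dot (\sum_i b i *: X i) z = 0.
  by move=> zX; rewrite dot_suml big1// => i _; rewrite dotZl dotC zX mulr0.
exists b; have nuE : dot x nu = beta.
  rewrite xE !dotDl S0 ?(dotZl beta) ?(dotZl gamma); last exact: hyper_normal_family.
  by rewrite hyper_normal_unit conormal_normal mulr0 mulr1 add0r addr0.
have tE : dot x t = gamma * enorm conormal.
  rewrite xE !dotDl S0 ?(dotZl beta) ?(dotZl gamma); last exact: unit_conormal_family.
  rewrite [dot nu t]dotC unit_conormal_normal mulr0 !add0r.
  by rewrite -{1}[conormal]enorm_normalizeK dotZl unit_conormal_unit mulr1.
by rewrite {1}xE nuE tE -scalerA enorm_normalizeK.
Qed.

Lemma tangent_decomposition : exists b : 'I_n -> R,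
  Y = \sum_i b i *: X i + height *: t.
Proof.
have [b e] := orthogonal_decomposition Y; exists b.
by rewrite {1}e dotC hyper_normalY scale0r addr0 dotC.
Qed.

Lemma det_around_sum b y : det_around (\sum_(i < n) b i *: X i) y = 0.
Proof.
rewrite det_around_anti; apply/eqP; rewrite oppr_eq0 /det_around -dot_wedge dotC.
rewrite dot_suml big1// => i _; rewrite dotZl dotC dot_wedge.
by rewrite -/(det_around _ _) det_around_family mulr0.
Qed.

(** The factor by which x -> det (t, X, x) differs from the product with the normal. *)
Definition turn := enorm (wedge (fcons Y X)) / height.

Lemma turn_gt0 : 0 < turn.
Proof. by rewrite divr_gt0 ?enorm_gt0// height_gt0. Qed.

(** In x -> det (t, X, x) the vector t may be replaced by Y / height, which differs
    from it by a combination of X. *)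
Lemma det_around_normal x : det_around t x = turn * dot nu x.
Proof.
have [b e] := tangent_decomposition.
rewrite dot_hyper_normal e det_aroundDl det_around_sum add0r det_aroundZl -e.
rewrite /turn; field.
by rewrite !gt_eqF ?height_gt0 ?enorm_gt0.
Qed.

Lemma det_around_conormal x : det_around nu x = - turn * dot t x.
Proof.
have [b e] := orthogonal_decomposition x.
rewrite {1}e !det_aroundDr det_around_anti det_around_sum oppr0 add0r.
rewrite (det_aroundZr (dot x nu)) (det_aroundZr (dot x t)).
rewrite (det_around_alt nu) mulr0 add0r det_around_anti det_around_normal.
by rewrite hyper_normal_unit dotC; ring.
Qed.

(** The hyperplane spanned by X and a vector of height r at the angle th in the
    plane (t, n) has its normal turned by the same angle.  Only the direction of the
    normal matters, the factor being positive. *)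
Lemma turned_normal (b : 'I_n -> R) r th : 0 < r ->
  wedge (fcons (\sum_i b i *: X i + r *: (cos th *: t + sin th *: nu)) X) =
  (r * turn) *: (cos th *: nu - sin th *: t).
Proof.
move=> r0; apply: wedge_eqP => x; rewrite -/(det_around _ _).
rewrite det_aroundDl det_around_sum add0r (det_aroundZl r) det_aroundDl.
rewrite (det_aroundZl (cos th)) (det_aroundZl (sin th)).
rewrite det_around_normal det_around_conormal (dotZl (r * turn)) dotBl (dotZl (cos th)) (dotZl (sin th)).
ring.
Qed.

End HyperplaneGeometry.

(** * Approximation up to O(1/N) *)

Section Asymptotics.
Context {R : realType} {n : nat}.
Local Notation chart := 'rV[R]_n.+1.
Implicit Types (F G : nat -> chart -> R) (N : nat) (p : chart).

(** F = G + O(1/N), uniformly on the cube. *)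
Definition approx F G := exists C N0, forall N p, (0 < N)%N -> (N0 <= N)%N ->
  cube p -> `|F N p - G N p| <= C / N%:R.

Definition bounded_on_cube G := exists C, forall N p, (0 < N)%N -> cube p -> `|G N p| <= C.

Definition far_from0 G := exists2 c, 0 < c &
  forall N p, (0 < N)%N -> cube p -> c <= G N p.

Lemma approx_ge0 F G : approx F G -> exists C N0, 0 <= C /\
  forall N p, (0 < N)%N -> (N0 <= N)%N -> cube p -> `|F N p - G N p| <= C / N%:R.
Proof.
move=> [C [N0 H]]; exists C, N0; split => //.
have := H N0.+1 0 (ltn0Sn _) (leqnSn _) cube0.
by move=> /(le_trans (normr_ge0 _)); rewrite pmulr_lge0// invr_gt0.
Qed.

Lemma bounded_ge0 G : bounded_on_cube G -> exists2 C, 0 <= C &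
  forall N p, (0 < N)%N -> cube p -> `|G N p| <= C.
Proof.
by move=> [C H]; exists C => //; exact: le_trans (normr_ge0 _) (H 1%N 0 _ cube0).
Qed.

Lemma approx_refl F : approx F F.
Proof. by exists 0, 0%N => N p _ _ _; rewrite subrr normr0 mul0r. Qed.

Lemma eq_approx F G F1 G1 : approx F G ->
  (forall N p, (0 < N)%N -> cube p -> F N p = F1 N p) ->
  (forall N p, (0 < N)%N -> cube p -> G N p = G1 N p) -> approx F1 G1.
Proof.
by move=> [C [N0 H]] FE GE; exists C, N0 => N p N1 NN cp; rewrite -FE// -GE// H.
Qed.

Lemma approxD F G F' G' : approx F G -> approx F' G' ->
  approx (fun N p => F N p + F' N p) (fun N p => G N p + G' N p).
Proof.
move=> [C [N0 H]] [C' [N0' H']]; exists (C + C'), (maxn N0 N0') => N p N1.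
rewrite geq_max => /andP[NN NN'] cp.
have -> : F N p + F' N p - (G N p + G' N p) = (F N p - G N p) + (F' N p - G' N p) by ring.
apply: le_trans (ler_normD _ _) _; rewrite mulrDl; exact: lerD (H _ _ _ _ _) (H' _ _ _ _ _).
Qed.

Lemma bounded_cst (c : R) : bounded_on_cube (fun _ _ => c).
Proof. by exists `|c|. Qed.

Lemma boundedD G G' : bounded_on_cube G -> bounded_on_cube G' ->
  bounded_on_cube (fun N p => G N p + G' N p).
Proof.
move=> [C H] [C' H']; exists (C + C') => N p N0 cp.
exact: le_trans (ler_normD _ _) (lerD (H _ _ N0 cp) (H' _ _ N0 cp)).
Qed.

Lemma boundedM G G' : bounded_on_cube G -> bounded_on_cube G' ->
  bounded_on_cube (fun N p => G N p * G' N p).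
Proof.
move=> [C H] [C' H']; exists (C * C') => N p N0 cp.
by rewrite normrM; exact: ler_pM (normr_ge0 _) (normr_ge0 _) (H _ _ N0 cp) (H' _ _ N0 cp).
Qed.

Lemma approxM F G F' G' : bounded_on_cube G -> bounded_on_cube G' ->
  approx F G -> approx F' G' ->
  approx (fun N p => F N p * F' N p) (fun N p => G N p * G' N p).
Proof.
move=> /bounded_ge0[B B0 HB] /bounded_ge0[B' B'0 HB'].
move=> /approx_ge0[C [N0 [C0 H]]] /approx_ge0[C' [N0' [C'0 H']]].
(* F F' - G G' = (F - G) (G' + (F' - G')) + G (F' - G'), and C' / N <= C' *)
exists (C * (B' + C') + B * C'), (maxn N0 N0') => N p N1.
rewrite geq_max => /andP[NN NN'] cp.
have N_gt0 : 0 < N%:R :> R by rewrite ltr0n.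
have N_ge1 : 1 <= N%:R :> R by rewrite ler1n.
have -> : F N p * F' N p - G N p * G' N p =
  (F N p - G N p) * (G' N p + (F' N p - G' N p)) + G N p * (F' N p - G' N p) by ring.
apply: le_trans (ler_normD _ _) _; rewrite !normrM mulrDl.
have h' := H' _ _ N1 NN' cp.
have c' : C' / N%:R <= C' by rewrite ler_pdivrMr// ler_peMr.
apply: lerD.
  rewrite mulrAC; apply: ler_pM => //; first exact: H.
  apply: le_trans (ler_normD _ _) _; apply: lerD; first exact: HB'.
  exact: le_trans h' c'.
by rewrite -mulrA; apply: ler_pM => //; exact: HB.
Qed.

Lemma approx_scale (c : R) F G : approx F G ->
  approx (fun N p => c * F N p) (fun N p => c * G N p).
Proof.
move=> [C [N0 H]]; exists (`|c| * C), N0 => N p N1 NN cp.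
by rewrite -mulrBr normrM -mulrA ler_wpM2l// H.
Qed.

Lemma approxB F G F' G' : approx F G -> approx F' G' ->
  approx (fun N p => F N p - F' N p) (fun N p => G N p - G' N p).
Proof.
move=> h /(approx_scale (-1)) h'; apply: eq_approx (approxD h h') _ _ => N p _ _;
by rewrite mulN1r.
Qed.

Lemma boundedB G G' : bounded_on_cube G -> bounded_on_cube G' ->
  bounded_on_cube (fun N p => G N p - G' N p).
Proof.
move=> h [C H]; apply: boundedD => //.
by exists C => N p N0 cp; rewrite normrN H.
Qed.

Lemma bounded_sum (I : Type) (r : seq I) (P : pred I) (G : I -> nat -> chart -> R) :
  (forall i, P i -> bounded_on_cube (G i)) ->
  bounded_on_cube (fun N p => \sum_(i <- r | P i) G i N p).
Proof.
move=> H; elim: r => [|i r [C IH]]; first by exists 0 => N p _ _; rewrite big_nil normr0.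
case Pi: (P i); last by exists C => N p N0 cp; rewrite big_cons Pi IH.
have [D HD] := H i Pi; exists (D + C) => N p N0 cp; rewrite big_cons Pi.
exact: le_trans (ler_normD _ _) (lerD (HD _ _ N0 cp) (IH _ _ N0 cp)).
Qed.

Lemma bounded_prod (I : Type) (r : seq I) (P : pred I) (G : I -> nat -> chart -> R) :
  (forall i, P i -> bounded_on_cube (G i)) ->
  bounded_on_cube (fun N p => \prod_(i <- r | P i) G i N p).
Proof.
move=> H; elim: r => [|i r [C IH]]; first by exists 1 => N p _ _; rewrite big_nil normr1.
case Pi: (P i); last by exists C => N p N0 cp; rewrite big_cons Pi IH.
have [D HD] := H i Pi; exists (D * C) => N p N0 cp; rewrite big_cons Pi normrM.
exact: ler_pM (normr_ge0 _) (normr_ge0 _) (HD _ _ N0 cp) (IH _ _ N0 cp).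
Qed.

Lemma approx_sum (I : Type) (r : seq I) (P : pred I) (F G : I -> nat -> chart -> R) :
  (forall i, P i -> approx (F i) (G i)) ->
  approx (fun N p => \sum_(i <- r | P i) F i N p)
         (fun N p => \sum_(i <- r | P i) G i N p).
Proof.
move=> H; elim: r => [|i r IH].
  by apply: eq_approx (approx_refl (fun _ _ => 0)) _ _ => N p _ _; rewrite big_nil.
case Pi: (P i); last by apply: eq_approx IH _ _ => N p _ _; rewrite big_cons Pi.
by apply: eq_approx (approxD (H i Pi) IH) _ _ => N p _ _; rewrite big_cons Pi.
Qed.

Lemma approx_prod (I : Type) (r : seq I) (P : pred I) (F G : I -> nat -> chart -> R) :
  (forall i, P i -> bounded_on_cube (G i)) ->
  (forall i, P i -> approx (F i) (G i)) ->
  approx (fun N p => \prod_(i <- r | P i) F i N p)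
         (fun N p => \prod_(i <- r | P i) G i N p).
Proof.
move=> B H; elim: r => [|i r IH].
  by apply: eq_approx (approx_refl (fun _ _ => 1)) _ _ => N p _ _; rewrite big_nil.
case Pi: (P i); last by apply: eq_approx IH _ _ => N p _ _; rewrite big_cons Pi.
have BM := bounded_prod r B.
by apply: eq_approx (approxM (B i Pi) BM (H i Pi) IH) _ _ => N p _ _; rewrite big_cons Pi.
Qed.

Lemma bounded_det d (M : nat -> chart -> 'M[R]_d) :
  (forall i j, bounded_on_cube (fun N p => M N p i j)) ->
  bounded_on_cube (fun N p => \det (M N p)).
Proof.
move=> H; rewrite /determinant; apply: bounded_sum => s _.
apply: boundedM; first exact: bounded_cst.
by apply: bounded_prod => i _; exact: H.
Qed.

Lemma approx_det d (M M' : nat -> chart -> 'M[R]_d) :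
  (forall i j, bounded_on_cube (fun N p => M' N p i j)) ->
  (forall i j, approx (fun N p => M N p i j) (fun N p => M' N p i j)) ->
  approx (fun N p => \det (M N p)) (fun N p => \det (M' N p)).
Proof.
move=> B H; rewrite /determinant; apply: approx_sum => s _.
by apply: approx_scale; apply: approx_prod => i _; [exact: B | exact: H].
Qed.

Lemma approx_eventually_ge F G c : approx F G -> 0 < c ->
  (forall N p, (0 < N)%N -> cube p -> c <= G N p) ->
  exists N0, forall N p, (0 < N)%N -> (N0 <= N)%N -> cube p -> c / 2 <= F N p.
Proof.
move=> /approx_ge0[C [N0 [C0 H]]] c0 Gc.
(* beyond this rank C / N <= c / 2 *)
exists (maxn N0 (Num.bound (2 * C / c))) => N p N1; rewrite geq_max => /andP[NN Nb] cp.
have N_gt0 : 0 < N%:R :> R by rewrite ltr0n.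
have : `|F N p - G N p| <= c / 2.
  apply: le_trans (H _ _ N1 NN cp) _.
  have b : 2 * C / c < N%:R.
    apply: lt_le_trans (archi_boundP _) _; last by rewrite ler_nat.
    by apply: divr_ge0; [exact: mulr_ge0 | exact: ltW].
  rewrite ler_pdivrMr//; move: b; rewrite ltr_pdivrMr// => b; lra.
by have := Gc _ _ N1 cp; rewrite ler_norml => h /andP[]; lra.
Qed.

(** Once C / N <= c / 2, the approximating function is itself at least c / 2. *)
Lemma approxV F G : far_from0 G -> approx F G ->
  approx (fun N p => (F N p)^-1) (fun N p => (G N p)^-1).
Proof.
move=> [c c0 Gc] FG; have [N1 H1] := approx_eventually_ge FG c0 Gc.
move: FG => /approx_ge0[C [N0 [C0 H]]].
exists (C * (2 / c ^+ 2)), (maxn N0 N1) => N p N_gt0; rewrite geq_max => /andP[NN NN1] cp.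
have Fc := H1 _ _ N_gt0 NN1 cp; have {}Gc := Gc _ _ N_gt0 cp.
have c2 : 0 < c / 2 by rewrite divr_gt0.
have F0 : 0 < F N p by exact: lt_le_trans Fc.
have G0 : 0 < G N p by exact: lt_le_trans Gc.
have -> : (F N p)^-1 - (G N p)^-1 = - ((F N p - G N p) * (F N p * G N p)^-1).
  by field; rewrite !gt_eqF.
rewrite normrN normrM mulrAC; apply: ler_pM => //; first exact: H.
have FG0 : 0 < F N p * G N p by exact: mulr_gt0.
rewrite gtr0_norm ?invr_gt0//.
have -> : 2 / c ^+ 2 = (c / 2 * c)^-1 by field; rewrite gt_eqF.
rewrite lef_pV2 ?posrE// ?mulr_gt0//.
by apply: ler_pM => //; exact: ltW.
Qed.

Lemma approx_sqrt F G : far_from0 G -> approx F G ->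
  approx (fun N p => Num.sqrt (F N p)) (fun N p => Num.sqrt (G N p)).
Proof.
move=> [c c0 Gc] FG; have [N1 H1] := approx_eventually_ge FG c0 Gc.
move: FG => /approx_ge0[C [N0 [C0 H]]].
have sc0 : 0 < Num.sqrt c by rewrite sqrtr_gt0.
exists (C * (Num.sqrt c)^-1), (maxn N0 N1) => N p N_gt0.
rewrite geq_max => /andP[NN NN1] cp.
have Fc := H1 _ _ N_gt0 NN1 cp; have {}Gc := Gc _ _ N_gt0 cp.
have F0 : 0 < F N p by apply: lt_le_trans Fc; rewrite divr_gt0.
have G0 : 0 < G N p by exact: lt_le_trans Gc.
rewrite mulrAC ler_pdivlMr//; apply: le_trans (H _ _ N_gt0 NN cp).
have -> : F N p - G N p = (Num.sqrt (F N p) - Num.sqrt (G N p)) *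
    (Num.sqrt (F N p) + Num.sqrt (G N p)).
  by rewrite -subr_sqr !sqr_sqrtr// ltW.
rewrite normrM ler_wpM2l// ger0_norm ?addr_ge0 ?sqrtr_ge0//.
by apply: ler_wpDl; rewrite ?sqrtr_ge0// ler_wsqrtr.
Qed.

Lemma bounded_inv G : far_from0 G -> bounded_on_cube (fun N p => (G N p)^-1).
Proof.
move=> [c c0 H]; exists c^-1 => N p N0 cp; have Gc := H _ _ N0 cp.
have G0 : 0 < G N p by exact: lt_le_trans Gc.
by rewrite normfV gtr0_norm// lef_pV2.
Qed.

Lemma far_from0_sqrt G : far_from0 G -> far_from0 (fun N p => Num.sqrt (G N p)).
Proof.
move=> [c c0 H]; exists (Num.sqrt c) => [|N p N0 cp]; first by rewrite sqrtr_gt0.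
by rewrite ler_wsqrtr// H.
Qed.

Definition vapprox {d} (F G : nat -> chart -> 'rV[R]_d) :=
  forall j, approx (fun N p => F N p 0 j) (fun N p => G N p 0 j).

Definition vbounded {d} (G : nat -> chart -> 'rV[R]_d) :=
  forall j, bounded_on_cube (fun N p => G N p 0 j).


Lemma approx_dot d (F G F' G' : nat -> chart -> 'rV[R]_d) :
  vbounded G -> vbounded G' -> vapprox F G -> vapprox F' G' ->
  approx (fun N p => dot (F N p) (F' N p)) (fun N p => dot (G N p) (G' N p)).
Proof.
move=> B B' H H'.
have := @approx_sum _ (index_enum _) xpredT _ _
  (fun j _ => approxM (B j) (B' j) (H j) (H' j)).
by move/eq_approx; apply=> N p _ _; rewrite dotE.
Qed.

Lemma bounded_dot d (G G' : nat -> chart -> 'rV[R]_d) :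
  vbounded G -> vbounded G' -> bounded_on_cube (fun N p => dot (G N p) (G' N p)).
Proof.
move=> B B'.
have [C H] := @bounded_sum _ (index_enum _) xpredT _ (fun j _ => boundedM (B j) (B' j)).
by exists C => N p N0 cp; rewrite dotE H.
Qed.

Lemma vapprox_normalize d (F G : nat -> chart -> 'rV[R]_d) :
  vbounded G -> far_from0 (fun N p => dot (G N p) (G N p)) -> vapprox F G ->
  vapprox (fun N p => normalize (F N p)) (fun N p => normalize (G N p)).
Proof.
move=> B far H j.
have A : approx (fun N p => (enorm (F N p))^-1) (fun N p => (enorm (G N p))^-1).
  apply: approxV; first exact: far_from0_sqrt far.
  by apply: approx_sqrt => //; exact: approx_dot.
have Bi := bounded_inv (far_from0_sqrt far).
by apply: eq_approx (approxM Bi (B j) A (H j)) _ _ => N p _ _; rewrite mxE.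
Qed.

Lemma vbounded_normalize d (G : nat -> chart -> 'rV[R]_d) :
  vbounded G -> far_from0 (fun N p => dot (G N p) (G N p)) ->
  vbounded (fun N p => normalize (G N p)).
Proof.
move=> B far j; have [C H] := boundedM (bounded_inv (far_from0_sqrt far)) (B j).
by exists C => N p N0 cp; rewrite mxE H.
Qed.

Lemma vboundedD d (G G' : nat -> chart -> 'rV[R]_d) : vbounded G -> vbounded G' ->
  vbounded (fun N p => G N p + G' N p).
Proof.
by move=> H H' j; have [C HC] := boundedD (H j) (H' j); exists C => N p N0 cp; rewrite mxE HC.
Qed.

Lemma vapproxZ d F G (F' G' : nat -> chart -> 'rV[R]_d) :
  bounded_on_cube G -> vbounded G' -> approx F G -> vapprox F' G' ->
  vapprox (fun N p => F N p *: F' N p) (fun N p => G N p *: G' N p).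
Proof.
move=> B B' H H' j.
by apply: eq_approx (approxM B (B' j) H (H' j)) _ _ => N p _ _; rewrite mxE.
Qed.

Lemma vboundedZ d G (G' : nat -> chart -> 'rV[R]_d) : bounded_on_cube G -> vbounded G' ->
  vbounded (fun N p => G N p *: G' N p).
Proof.
by move=> H H' j; have [C HC] := boundedM H (H' j); exists C => N p N0 cp; rewrite mxE HC.
Qed.

Lemma vapprox_sum d (I : Type) (r : seq I) (P : pred I)
    (F G : I -> nat -> chart -> 'rV[R]_d) :
  (forall i, P i -> vapprox (F i) (G i)) ->
  vapprox (fun N p => \sum_(i <- r | P i) F i N p)
          (fun N p => \sum_(i <- r | P i) G i N p).
Proof.
move=> H j; have := approx_sum r (fun i Pi => H i Pi j).
by move/eq_approx; apply=> N p _ _; rewrite summxE.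
Qed.

Lemma vbounded_sum d (I : Type) (r : seq I) (P : pred I) (G : I -> nat -> chart -> 'rV[R]_d) :
  (forall i, P i -> vbounded (G i)) ->
  vbounded (fun N p => \sum_(i <- r | P i) G i N p).
Proof.
move=> H j; have [C HC] := bounded_sum r (fun i Pi => H i Pi j).
by exists C => N p N0 cp; rewrite summxE HC.
Qed.

Lemma vapproxB d (F G F' G' : nat -> chart -> 'rV[R]_d) : vapprox F G -> vapprox F' G' ->
  vapprox (fun N p => F N p - F' N p) (fun N p => G N p - G' N p).
Proof.
by move=> H H' j; apply: eq_approx (approxB (H j) (H' j)) _ _ => N p _ _; rewrite !mxE.
Qed.

Lemma vboundedB d (G G' : nat -> chart -> 'rV[R]_d) : vbounded G -> vbounded G' ->
  vbounded (fun N p => G N p - G' N p).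
Proof.
by move=> H H' j; have [C HC] := boundedB (H j) (H' j); exists C => N p N0 cp; rewrite !mxE HC.
Qed.

Lemma approx_last_det d (F G : 'I_d -> nat -> chart -> 'rV[R]_d.+1)
    (F' G' : nat -> chart -> 'rV[R]_d.+1) :
  (forall i, vbounded (G i)) -> vbounded G' ->
  (forall i, vapprox (F i) (G i)) -> vapprox F' G' ->
  approx (fun N p => last_det (fun i => F i N p) (F' N p))
         (fun N p => last_det (fun i => G i N p) (G' N p)).
Proof.
move=> B B' H H'; apply: approx_det => i j; case: (unliftP ord_max i) => [l ->|->].
- have [C HC] := B l j; exists C => N p N0 cp; rewrite mxE frcons_lift; exact: HC.
- have [C HC] := B' j; exists C => N p N0 cp; rewrite mxE frcons_max; exact: HC.
- by apply: eq_approx (H l j) _ _ => N p _ _; rewrite mxE frcons_lift.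
- by apply: eq_approx (H' j) _ _ => N p _ _; rewrite mxE frcons_max.
Qed.

Lemma bounded_last_det d (G : 'I_d -> nat -> chart -> 'rV[R]_d.+1)
    (G' : nat -> chart -> 'rV[R]_d.+1) :
  (forall i, vbounded (G i)) -> vbounded G' ->
  bounded_on_cube (fun N p => last_det (fun i => G i N p) (G' N p)).
Proof.
move=> B B'; apply: bounded_det => i j; case: (unliftP ord_max i) => [l ->|->].
- have [C HC] := B l j; exists C => N p N0 cp; rewrite mxE frcons_lift; exact: HC.
- have [C HC] := B' j; exists C => N p N0 cp; rewrite mxE frcons_max; exact: HC.
Qed.

Lemma vbounded_cst d (x : 'rV[R]_d) : vbounded (fun _ _ => x).
Proof. by move=> j; exact: bounded_cst. Qed.

Lemma vapprox_refl d (F : nat -> chart -> 'rV[R]_d) : vapprox F F.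
Proof. by move=> j; exact: approx_refl. Qed.

Lemma vapprox_wedge d (F G : 'I_d -> nat -> chart -> 'rV[R]_d.+1) :
  (forall i, vbounded (G i)) -> (forall i, vapprox (F i) (G i)) ->
  vapprox (fun N p => wedge (fun i => F i N p)) (fun N p => wedge (fun i => G i N p)).
Proof.
move=> B H j.
have := approx_last_det B (vbounded_cst (delta_mx 0 j)) H (vapprox_refl _).
by move/eq_approx; apply=> N p _ _; rewrite mxE.
Qed.

Lemma vbounded_wedge d (G : 'I_d -> nat -> chart -> 'rV[R]_d.+1) :
  (forall i, vbounded (G i)) -> vbounded (fun N p => wedge (fun i => G i N p)).
Proof.
move=> B j; have [C HC] := bounded_last_det B (vbounded_cst (delta_mx 0 j)).
by exists C => N p N0 cp; rewrite mxE; exact: HC.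
Qed.

Lemma vapprox_fcons k d (F G : nat -> chart -> 'rV[R]_d)
    (F' G' : 'I_k -> nat -> chart -> 'rV[R]_d) i :
  vapprox F G -> (forall i, vapprox (F' i) (G' i)) ->
  vapprox (fun N p => fcons (F N p) (fun i => F' i N p) i)
          (fun N p => fcons (G N p) (fun i => G' i N p) i).
Proof.
move=> H H' j; case: (unliftP ord0 i) => [l ->|->].
  by apply: eq_approx (H' l j) _ _ => N p _ _; rewrite fconsS.
by apply: eq_approx (H j) _ _ => N p _ _; rewrite fcons0.
Qed.

Lemma vbounded_fcons k d (G : nat -> chart -> 'rV[R]_d)
    (G' : 'I_k -> nat -> chart -> 'rV[R]_d) i :
  vbounded G -> (forall i, vbounded (G' i)) ->
  vbounded (fun N p => fcons (G N p) (fun i => G' i N p) i).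
Proof.
move=> H H' j; case: (unliftP ord0 i) => [l ->|->].
  by have [C HC] := H' l j; exists C => N p N0 cp; rewrite fconsS HC.
by have [C HC] := H j; exists C => N p N0 cp; rewrite fcons0 HC.
Qed.

Lemma vapprox_frcons k d (F G : nat -> chart -> 'rV[R]_d)
    (F' G' : 'I_k -> nat -> chart -> 'rV[R]_d) i :
  vapprox F G -> (forall i, vapprox (F' i) (G' i)) ->
  vapprox (fun N p => frcons (fun i => F' i N p) (F N p) i)
          (fun N p => frcons (fun i => G' i N p) (G N p) i).
Proof.
move=> H H' j; case: (unliftP ord_max i) => [l ->|->].
  by apply: eq_approx (H' l j) _ _ => N p _ _; rewrite frcons_lift.
by apply: eq_approx (H j) _ _ => N p _ _; rewrite frcons_max.
Qed.

Lemma vbounded_frcons k d (G : nat -> chart -> 'rV[R]_d)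
    (G' : 'I_k -> nat -> chart -> 'rV[R]_d) i :
  vbounded G -> (forall i, vbounded (G' i)) ->
  vbounded (fun N p => frcons (fun i => G' i N p) (G N p) i).
Proof.
move=> H H' j; case: (unliftP ord_max i) => [l ->|->].
  by have [C HC] := H' l j; exists C => N p N0 cp; rewrite frcons_lift HC.
by have [C HC] := H j; exists C => N p N0 cp; rewrite frcons_max HC.
Qed.

(** Strong induction on the index: the i-th residual is polynomial in the earlier
    vectors, and it is normalized by a norm that is bounded below. *)
Lemma vapprox_gram_schmidt k d (F G : 'I_k -> nat -> chart -> 'rV[R]_d) :
  (forall i, vbounded (G i)) -> (forall i, vapprox (F i) (G i)) ->
  (forall i, far_from0 (fun N p => dot (residual (fun i => G i N p) i)
                                       (residual (fun i => G i N p) i))) ->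
  forall i, vapprox (fun N p => gram_schmidt (fun i => F i N p) i)
                    (fun N p => gram_schmidt (fun i => G i N p) i) /\
            vbounded (fun N p => gram_schmidt (fun i => G i N p) i).
Proof.
move=> B H far i; move: {2}i.+1 (ltnSn i) => m; elim: m i => [//|m IH] i im.
have IHj (j : 'I_k) : (j < i)%N -> _ := fun ji => IH j (leq_trans ji im).
have Bres : vbounded (fun N p => residual (fun i => G i N p) i).
  apply: vboundedB (B i) _; apply: vbounded_sum => j /IHj[_ Bj].
  by apply: vboundedZ => //; exact: bounded_dot.
have Ares : vapprox (fun N p => residual (fun i => F i N p) i)
                    (fun N p => residual (fun i => G i N p) i).
  apply: vapproxB (H i) _; apply: vapprox_sum => j /IHj[Aj Bj].
  apply: vapproxZ => //; first exact: bounded_dot.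
  exact: approx_dot.
split=> j.
  apply: eq_approx (vapprox_normalize Bres (far i) Ares j) _ _ => N p _ _;
  by rewrite gram_schmidtE.
have [C HC] := vbounded_normalize Bres (far i) j; exists C => N p N0 cp.
by rewrite gram_schmidtE HC.
Qed.

(** Finitely many estimates share their constants. *)
Lemma approx_uniform (I : finType) (F G : I -> nat -> chart -> R) :
  (forall i, approx (F i) (G i)) ->
  exists C N0, forall N, (0 < N)%N -> (N0 <= N)%N -> forall p i, cube p ->
    `|F i N p - G i N p| <= C / N%:R.
Proof.
move=> H.
have [C HC] := choice (fun i => approx_ge0 (H i)).
have [M HM] := choice HC.
exists (\sum_i C i), (\max_i M i)%N => N N0 NM p i cp.
have [C0 Hi] := HM i.
apply: le_trans (Hi _ _ N0 _ cp) _.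
  by apply: leq_trans NM; exact: leq_bigmax.
rewrite ler_wpM2r ?invr_ge0 ?ler0n// (bigD1 i)//= lerDl sumr_ge0// => j _.
by have [] := HM j.
Qed.

End Asymptotics.

(** * Orthonormal bases and rotations *)

Section OrthonormalFrames.
Context {R : realType}.

Definition orthonormal d k (b : 'I_k -> 'rV[R]_d) :=
  forall i j, dot (b i) (b j) = (i == j)%:R.

Lemma orthonormalP d k (b : 'I_k -> 'rV[R]_d) :
  orthonormal b <-> (\matrix_i b i) *m (\matrix_i b i)^T = 1%:M.
Proof.
have E i j : ((\matrix_i b i) *m (\matrix_i b i)^T) i j = dot (b i) (b j).
  by rewrite mxE dotE; apply: eq_bigr => l _; rewrite !mxE.
split=> [H|H i j]; first by apply/matrixP => i j; rewrite E H mxE.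
by rewrite -E H mxE.
Qed.

Lemma orthonormal_row_free d k (b : 'I_k -> 'rV[R]_d) :
  orthonormal b -> row_free (\matrix_i b i).
Proof. by move=> /orthonormalP H; apply/row_freeP; eexists; exact: H. Qed.

Lemma orthonormal_frcons d k (b : 'I_k -> 'rV[R]_d) x : orthonormal b ->
  dot x x = 1 -> (forall i, dot x (b i) = 0) -> orthonormal (frcons b x).
Proof.
move=> ob x1 xb i j; case: (unliftP ord_max i) => [k' ->|->];
  case: (unliftP ord_max j) => [l ->|->]; rewrite ?frcons_lift ?frcons_max.
- by rewrite ob (inj_eq lift_inj).
- by rewrite dotC xb eq_sym (negbTE (neq_lift _ _)).
- by rewrite xb (negbTE (neq_lift _ _)).
- by rewrite x1 eqxx.
Qed.

Lemma orthonormal_fcons d k (b : 'I_k -> 'rV[R]_d) x : orthonormal b ->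
  dot x x = 1 -> (forall i, dot x (b i) = 0) -> orthonormal (fcons x b).
Proof.
move=> ob x1 xb i j; case: (unliftP ord0 i) => [k' ->|->];
  case: (unliftP ord0 j) => [l ->|->]; rewrite ?fconsS ?fcons0.
- by rewrite ob (inj_eq lift_inj).
- by rewrite dotC xb eq_sym (negbTE (neq_lift _ _)).
- by rewrite xb (negbTE (neq_lift _ _)).
- by rewrite x1 eqxx.
Qed.

(** With w the normalized vector product, det (b, w) = |wedge b|; this determinant
    is 1 up to sign because the matrix is orthogonal. *)
Lemma dot_wedge_orthonormal d (b : 'I_d -> 'rV[R]_d.+1) : orthonormal b ->
  dot (wedge b) (wedge b) = 1.
Proof.
move=> ob; have W0 := row_free_wedge_neq0 (orthonormal_row_free ob).
set W := wedge b in W0 *; set M := \matrix_i frcons b W i.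
have dM : \det M = dot W W by rewrite dot_wedge.
pose B := \matrix_i frcons b (normalize W) i.
have : B *m B^T = 1%:M.
  apply/orthonormalP/orthonormal_frcons => //; first exact: dot_normalize.
  by move=> i; rewrite dotZl dot_wedge_family mulr0.
move=> /(congr1 determinant); rewrite det_mulmx det_tr det1 -/(last_det _ _).
rewrite -dot_wedge -/W dotZr -expr2 exprMn exprVn enorm_sqr expr2 mulrA mulVf.
  by rewrite mul1r.
by rewrite gt_eqF// dot_gt0.
Qed.

Lemma orthonormal_wedge d (b : 'I_d -> 'rV[R]_d.+1) : orthonormal b ->
  orthonormal (fcons (wedge b) b) /\
  \det (\matrix_i fcons (wedge b) b i) = (-1) ^+ d.
Proof.
move=> ob; split.
  by apply: orthonormal_fcons => //; [exact: dot_wedge_orthonormal|exact: dot_wedge_family].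
by rewrite det_fcons -dot_wedge dot_wedge_orthonormal// mulr1.
Qed.

End OrthonormalFrames.

Section FrameRotation.
Context {R : realType} {n : nat}.
Local Notation vec := 'rV[R]_n.+2.
Implicit Types (v : 'I_n -> vec) (nu : vec).

Definition frame_mx v nu : 'M[R]_n.+2 :=
  \matrix_i fcons (wedge (frcons v nu)) (frcons v nu) i.

Definition middle (k : 'I_n) : 'I_n.+2 := lift ord0 (lift ord_max k).

Lemma lift0_max : lift ord0 ord_max = ord_max :> 'I_n.+2.
Proof. by apply: ord_inj; rewrite lift0. Qed.

Variant index_spec : 'I_n.+2 -> Type :=
| First_index : index_spec ord0
| Middle_index k : index_spec (middle k)
| Last_index : index_spec ord_max.

Lemma indexP i : index_spec i.
Proof.
case: (unliftP ord0 i) => [j ->|->]; last exact: First_index.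
case: (unliftP ord_max j) => [k ->|->]; first exact: Middle_index.
by rewrite lift0_max; exact: Last_index.
Qed.

Lemma row_frame0 v nu : row ord0 (frame_mx v nu) = wedge (frcons v nu).
Proof. by rewrite rowK fcons0. Qed.

Lemma row_frame_mid v nu k : row (middle k) (frame_mx v nu) = v k.
Proof. by rewrite rowK fconsS frcons_lift. Qed.

Lemma row_frame_max v nu : row ord_max (frame_mx v nu) = nu.
Proof. by rewrite rowK -lift0_max fconsS frcons_max. Qed.

Lemma mul_tr_frame v nu v' nu' i j : (frame_mx v' nu' *m (frame_mx v nu)^T) i j =
  dot (row i (frame_mx v' nu')) (row j (frame_mx v nu)).
Proof. by rewrite mxE dotE; apply: eq_bigr => l _; rewrite !mxE. Qed.

(** The matrix from an orthonormal basis to another is unique and orthogonal; its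
    determinant is 1 since both bases have the determinant (-1)^(n+1). *)
Lemma frame_rotation v nu v' nu' :
  orthonormal (frcons v nu) -> orthonormal (frcons v' nu') ->
  let L := frame_mx v' nu' *m (frame_mx v nu)^T in
  [/\ is_rotation L, frame_mx v' nu' = L *m frame_mx v nu &
      forall L', frame_mx v' nu' = L' *m frame_mx v nu -> L' = L].
Proof.
move=> /orthonormal_wedge[/orthonormalP ob db] /orthonormal_wedge[/orthonormalP ob' db'] L.
rewrite -/(frame_mx _ _) in ob db; rewrite -/(frame_mx _ _) in ob' db'.
have tb := mulmx1C ob; split.
- split; last by rewrite det_mulmx det_tr db db' -expr2 sqrr_sign.
  by rewrite trmx_mul trmxK mulmxA -(mulmxA _ (frame_mx v nu)^T) tb mulmx1.
- by rewrite -mulmxA tb mulmx1.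
- by move=> L' e; rewrite /L e -mulmxA ob mulmx1.
Qed.

(** The entries are dot products of orthonormal vectors, except in the first row,
    made of the determinants det (v, cos th n - sin th t', b) for b in the basis:
    they reduce to det (v, n, t') = 1 by bilinearity and antisymmetry. *)
Lemma corner_rotationE v nu th : orthonormal (frcons v nu) ->
  frame_mx v (cos th *: nu - sin th *: wedge (frcons v nu)) *m (frame_mx v nu)^T =
  corner_rotation th.
Proof.
move=> ob; set tp := wedge (frcons v nu); set N := _ - _.
have ntp : dot nu tp = 0.
  by rewrite dotC; have := dot_wedge_family (frcons v nu) ord_max; rewrite frcons_max.
have vtp k : dot (v k) tp = 0.
  by rewrite dotC; have := dot_wedge_family (frcons v nu) (lift ord_max k); rewrite frcons_lift.
have tp1 : dot tp tp = 1 by exact: dot_wedge_orthonormal.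
have n1 : dot nu nu = 1 by have := ob ord_max ord_max; rewrite frcons_max eqxx.
have vn k : dot (v k) nu = 0.
  have := ob (lift ord_max k) ord_max; rewrite frcons_lift frcons_max => ->.
  by rewrite eq_sym (negbTE (neq_lift _ _)).
have vv k l : dot (v k) (v l) = (k == l)%:R.
  by have := ob (lift ord_max k) (lift ord_max l); rewrite !frcons_lift (inj_eq lift_inj).
have dN x : dot N x = cos th * dot nu x - sin th * dot tp x.
  by rewrite dotBl (dotZl (cos th)) (dotZl (sin th)).
pose e : R := (-1) ^+ n.+1.
have ee : e * e = 1 by rewrite -expr2 sqrr_sign.
have lastE a b : last_det (frcons v a) b = e * det_around v b a.
  by rewrite det_aroundE -/e mulrA ee mul1r.
have dt y : det_around v y nu = e * dot tp y.
  by rewrite dot_wedge lastE mulrA ee mul1r.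
have dW y : dot (wedge (frcons v N)) y =
    cos th * dot tp y - e * sin th * det_around v y tp.
  rewrite dot_wedge lastE /N det_aroundDr -(scaleNr (sin th)).
  rewrite (det_aroundZr v (cos th)) (det_aroundZr v (- sin th)) dt.
  by rewrite -[cos th * dot tp y in RHS]mul1r -ee; ring.
have mid_ne0 k : (middle k == ord0) = false by [].
have mid_nemax k : (middle k == ord_max) = false.
  by rewrite -lift0_max (inj_eq lift_inj) eq_sym (negbTE (neq_lift _ _)).
have max_ne0 : (ord_max == ord0 :> 'I_n.+2) = false by [].
apply/matrixP => i j; rewrite mul_tr_frame mxE.
case: (indexP i) => [|k|]; case: (indexP j) => [|l|];
  rewrite ?eqxx ?mid_ne0 ?mid_nemax ?max_ne0 ?row_frame0 ?row_frame_mid ?row_frame_max.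
- by rewrite -/tp dW det_around_alt tp1; ring.
- rewrite dW det_around_anti det_around_family [dot tp _]dotC vtp; ring.
- by rewrite dW det_around_anti dt [dot tp nu]dotC ntp tp1 mulr1 mulr0 sub0r mulrN opprK mulrAC ee mul1r.
- by rewrite -/tp vtp.
- by rewrite vv /middle !(inj_eq lift_inj).
- by rewrite vn.
- by rewrite -/tp dN ntp tp1; ring.
- by rewrite dN [dot nu _]dotC vn [dot tp _]dotC vtp; ring.
- by rewrite dN n1 [dot tp nu]dotC ntp; ring.
Qed.

End FrameRotation.

(** * Frames adapted to a linear form *)

Section AdaptedFrames.
Context {R : realType} {n : nat}.
Local Notation chart := 'rV[R]_n.+1.
Local Notation space := 'rV[R]_n.+2.
Implicit Types (c : 'cV[R]_n.+1) (u x : chart) (V : 'I_n -> chart).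

Definition adapted_at c u V := [/\ pairing c u = 1, row_free (\matrix_i V i),
  (\matrix_i V i == kermx c)%MS & 0 < \det (\matrix_i fcons u V i)].

Lemma pairing_eq0 c x : (x <= kermx c)%MS <-> pairing c x = 0.
Proof.
split=> [/sub_kermxP e|e]; first by rewrite /pairing e mxE.
by apply/sub_kermxP/matrixP => i j; rewrite !ord1 [RHS]mxE.
Qed.

Lemma pairingB c x y : pairing c (x - y) = pairing c x - pairing c y.
Proof. by rewrite /pairing mulmxBl !mxE. Qed.

Lemma adapted_pairing c u V i : adapted_at c u V -> pairing c (V i) = 0.
Proof.
case=> _ _ /eqmxP VE _; apply/pairing_eq0; rewrite -VE.
by rewrite -[V i](rowK V) row_sub.
Qed.

Lemma adapted_span c u V x : adapted_at c u V -> pairing c x = 0 ->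
  exists b : 'I_n -> R, x = \sum_i b i *: V i.
Proof.
case=> _ _ /eqmxP VE _ /pairing_eq0; rewrite -VE => /submxP[b xb].
exists (b 0); rewrite xb mulmx_sum_row; apply: eq_bigr => i _; by rewrite rowK.
Qed.

Lemma linear_matrix (D : {linear chart -> space}) k (a : 'I_k -> chart) :
  \matrix_i D (a i) = (\matrix_i a i) *m lin1_mx D.
Proof.
by apply/row_matrixP => i; rewrite row_mul !rowK mul_rV_lin1.
Qed.

Lemma linear_fcons (D : {linear chart -> space}) u V :
  fcons (D u) (D \o V) = D \o fcons u V.
Proof.
by apply/funext => i; case: (unliftP ord0 i) => [j ->|->]; rewrite /= ?fconsS ?fcons0.
Qed.

(** Two positively oriented frames differ by a matrix of positive determinant,
    which multiplies the vector product of their images. *)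
Lemma wedge_frame (D : {linear chart -> space}) u V u' V' :
  0 < \det (\matrix_i fcons u V i) -> 0 < \det (\matrix_i fcons u' V' i) ->
  exists2 k, 0 < k &
    wedge (fcons (D u') (D \o V')) = k *: wedge (fcons (D u) (D \o V)).
Proof.
move=> d0 d0'; rewrite !linear_fcons.
set U := \matrix_i fcons u V i in d0; set U' := \matrix_i fcons u' V' i in d0'.
have Uu : U \in unitmx by rewrite unitmxE unitfE gt_eqF.
exists (\det (U' *m invmx U)).
  by rewrite det_mulmx det_inv mulr_gt0// invr_gt0.
apply: wedge_mul; rewrite -[in RHS]/(\matrix_i D (fcons u V i)) linear_matrix.
by rewrite (linear_matrix D (fcons u' V')) -/U' -/U mulmxA mulmxKV.
Qed.

Lemma wedge_fconsZ (X : 'I_n -> space) (k : R) (y : space) :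
  wedge (fcons (k *: y) X) = k *: wedge (fcons y X).
Proof.
apply: wedge_eqP => x; rewrite -/(det_around _ _ _) det_aroundZl dotZl.
by rewrite dot_wedge.
Qed.

(** The two vector products are positive multiples of each other; if D u' = 0, both
    of them, hence both sides, are 0. *)
Lemma unit_normal_frame (D : {linear chart -> space}) u V u' V' :
  0 < \det (\matrix_i fcons u V i) -> 0 < \det (\matrix_i fcons u' V' i) ->
  normalize (wedge (fcons (normalize (D u')) (fun i => D (V' i)))) =
  hyper_normal (D \o V) (D u).
Proof.
move=> d0 d0'; rewrite /normalize wedge_fconsZ -/(normalize _).
have [k k0 e] := wedge_frame D d0 d0'.
have -> : hyper_normal (D \o V) (D u) = normalize (wedge (fcons (D u') (D \o V'))).
  by rewrite e normalizeZ.
have [Du0|Du0] := eqVneq (D u') 0.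
  have -> : wedge (fcons (D u') (D \o V')) = 0.
    by rewrite Du0 -[X in fcons X _](scale0r 0) wedge_fconsZ scale0r.
  by rewrite scaler0.
by rewrite -[RHS](@normalizeZ _ _ (enorm (D u'))^-1)// invr_gt0 enorm_gt0.
Qed.

Lemma frame_row_free (D : {linear chart -> space}) u V (V' : 'I_n -> chart) :
  wedge (fcons (D u) (D \o V)) != 0 -> 0 < \det (\matrix_i fcons u V i) ->
  row_free (\matrix_i V' i) -> row_free (\matrix_i D (V' i)).
Proof.
move=> /wedge_neq0_row_free; rewrite linear_fcons (linear_matrix D (fcons u V)) => fU dU fV'.
have Uu : \matrix_i fcons u V i \in unitmx by rewrite unitmxE unitfE gt_eqF.
have fD : row_free (lin1_mx D).
  by move: fU; rewrite /row_free (eqmxMfull _ (_ : row_full _)) // row_full_unit.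
by rewrite linear_matrix /row_free mxrankMfree.
Qed.

Lemma injective_wedge_neq0 (D : {linear chart -> space}) u V :
  injective D -> 0 < \det (\matrix_i fcons u V i) -> wedge (fcons (D u) (D \o V)) != 0.
Proof.
move=> iD dU; rewrite linear_fcons; apply: row_free_wedge_neq0.
rewrite (linear_matrix D (fcons u V)) /row_free.
have fD : row_free (lin1_mx D).
  rewrite -kermx_eq0; apply/rowV0P => x /sub_kermxP.
  by rewrite mul_rV_lin1 => Dx; apply: iD; rewrite Dx linear0.
rewrite mxrankMfree//; apply/eqP; rewrite mxrank_unit// unitmxE unitfE gt_eqF//.
Qed.

End AdaptedFrames.

Section Projections.
Context {R : realType}.

(** The defining property of the orthogonal projection has at most one solution. *)
Lemma proj_unique d (P : set 'rV[R]_d) (v w : 'rV[R]_d) :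
  (forall y z, P y -> P z -> P (y - z)) -> P w ->
  (forall z, P z -> dot (v - w) z = 0) -> Defs.proj P v = w.
Proof.
move=> PB Pw vw; apply: xget_unique => // y [Py vy].
apply/eqP; rewrite -subr_eq0 -dot_eq0.
have e : y - w = (v - w) - (v - y) by apply/rowP => j; rewrite !mxE; ring.
by rewrite {1}e dotBl vw ?vy ?subrr//; exact: PB.
Qed.

End Projections.

Section AdaptedGramSchmidt.
Context {R : realType} {n : nat}.
Local Notation chart := 'rV[R]_n.+1.
Local Notation space := 'rV[R]_n.+2.
Variables (c : 'cV[R]_n.+1) (u0 : chart) (V0 : 'I_n -> chart) (D : {linear chart -> space}).
Hypothesis adapted0 : adapted_at c u0 V0.
Local Notation X := (D \o V0).
Local Notation Y := (D u0).
Hypothesis W0 : wedge (fcons Y X) != 0.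
Local Notation nu := (hyper_normal X Y).
Local Notation t := (unit_conormal X Y).

Lemma linear_span (V : 'I_n -> chart) (y : space) x : (forall i, dot y (D (V i)) = 0) ->
  (exists b : 'I_n -> R, x = \sum_i b i *: V i) -> dot y (D x) = 0.
Proof.
move=> H [b ->]; rewrite linear_sum dotC dot_suml big1// => i _.
by rewrite linearZ dotZl dotC H mulr0.
Qed.

Lemma normal_ker x : pairing c x = 0 -> dot nu (D x) = 0.
Proof.
move=> /(adapted_span adapted0); apply: linear_span => i.
exact: (hyper_normal_family X).
Qed.

Lemma conormal_ker x : pairing c x = 0 -> dot t (D x) = 0.
Proof.
move=> /(adapted_span adapted0); apply: linear_span => i.
exact: (unit_conormal_family X).
Qed.

(** [D u]^P + s t, for any u with l(u) = 1: such u differ by elements of ker l. *)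
Lemma height_decomposition u : pairing c u = 1 ->
  exists2 x, pairing c x = 0 & D u = D x + height X Y *: t.
Proof.
move=> cu; have [b e] := tangent_decomposition W0.
have [cu0 _ _ _] := adapted0.
exists (u - u0 + \sum_i b i *: V0 i).
  rewrite /pairing mulmxDl mxE -/(pairing _ _) pairingB cu cu0 subrr add0r.
  rewrite mulmx_suml summxE big1// => i _; rewrite -scalemxAl mxE -/(pairing _ _).
  by rewrite (adapted_pairing _ adapted0) mulr0.
rewrite linearD linearB -addrA.
suff -> : D (\sum_i b i *: V0 i) + height X Y *: t = Y by rewrite subrK.
rewrite [RHS]e; congr (_ + _); rewrite linear_sum; apply: eq_bigr => i _.
by rewrite linearZ.
Qed.

(** The Gram-Schmidt vectors are combinations of the family, the triangular factor
    being invertible. *)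
Lemma orthogonal_gram_schmidt (a : 'I_n -> space) (y : space) :
  row_free (\matrix_i a i) -> (forall i, dot y (a i) = 0) ->
  forall i, dot y (gram_schmidt a i) = 0.
Proof.
move=> fa ya i; have dT := det_gram_schmidt_mx_gt0 fa.
have Tu : gram_schmidt_mx a \in unitmx by rewrite unitmxE unitfE gt_eqF.
have vE : \matrix_i gram_schmidt a i = invmx (gram_schmidt_mx a) *m \matrix_i a i.
  by rewrite [X in _ *m X]gram_schmidt_mxE mulKmx.
have ay : (\matrix_i a i) *m y^T = 0.
  apply/matrixP => k l; rewrite !ord1 [RHS]mxE -(ya k) dotC /dot.
  by rewrite !mxE; apply: eq_bigr => j _; rewrite !mxE.
have : (\matrix_i gram_schmidt a i) *m y^T = 0 by rewrite vE -mulmxA ay mulmx0.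
move=> /matrixP/(_ i 0); rewrite [RHS]mxE => <-.
by rewrite dotC /dot !mxE; apply: eq_bigr => j _; rewrite !mxE.
Qed.

Variables (u : chart) (V : 'I_n -> chart).
Hypothesis adapted : adapted_at c u V.
Local Notation v := (gram_schmidt (fun i => D (V i))).

Lemma adapted_free : row_free (\matrix_i D (V i)).
Proof.
have [_ _ _ d0] := adapted0; have [_ fV _ _] := adapted.
exact: frame_row_free W0 d0 fV.
Qed.

Lemma adapted_orthonormal : orthonormal (frcons v nu).
Proof.
apply: orthonormal_frcons; first exact: gram_schmidt_orthonormal adapted_free.
  exact: hyper_normal_unit.
apply: orthogonal_gram_schmidt adapted_free _ => i.
by apply: normal_ker; exact: adapted_pairing adapted.
Qed.

Lemma fcons_col_mx d k (x : 'rV[R]_d) (a : 'I_k -> 'rV[R]_d) :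
  \matrix_i fcons x a i = col_mx x (\matrix_i a i) :> 'M[R]_(1 + k, d).
Proof.
apply/row_matrixP => i; rewrite rowK; case: (unliftP ord0 i) => [j ->|->].
  have -> : lift ord0 j = rshift 1 j by apply: ord_inj; rewrite lift0.
  rewrite rowKd rowK -(fconsS x a j); congr (fcons _ _ _).
  by apply: ord_inj; rewrite lift0.
have -> : ord0 = lshift k (0 : 'I_1) by apply: ord_inj.
by rewrite rowKu row_id -[RHS](fcons0 x a); congr (fcons _ _ _); exact: ord_inj.
Qed.

(** The triangular factor has a positive determinant, so orthonormalizing keeps the
    direction of the vector product. *)
Lemma wedge_gram_schmidt (x : space) :
  exists2 k, 0 < k & wedge (fcons x v) = k *: wedge (fcons x (fun i => D (V i))).
Proof.
set a := fun i => D (V i).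
have dT : 0 < \det (gram_schmidt_mx a) := det_gram_schmidt_mx_gt0 adapted_free.
exists (\det (gram_schmidt_mx a))^-1; first by rewrite invr_gt0.
have -> : wedge (fcons x a) = \det (gram_schmidt_mx a) *: wedge (fcons x v).
  have <- : \det (block_mx (1%:M : 'M[R]_1) 0 0 (gram_schmidt_mx a)) =
            \det (gram_schmidt_mx a) by rewrite det_ublock det1 mul1r.
  set B := block_mx _ _ _ _.
  suff e : \matrix_i fcons x a i = (B : 'M[R]_(1 + n)) *m (\matrix_i fcons x v i : 'M[R]_(1 + n, n.+2)).
    exact: wedge_mul e.
  rewrite (fcons_col_mx x a) [X in _ *m X](fcons_col_mx x v) /B mul_block_col.
  by rewrite mul1mx !mul0mx addr0 add0r gram_schmidt_mxE.
by rewrite scalerA mulVf ?scale1r// gt_eqF.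
Qed.

(** v /\ n is a unit vector orthogonal to n and to df(ker l), hence t up to sign.
    The sign is that of <v /\ n, df(u)> = (-1)^(n+1) det (df(u), v, n), and n is
    a positive multiple of df(u) /\ v. *)
Lemma adapted_wedge : wedge (frcons v nu) = (-1) ^+ n.+1 *: t.
Proof.
set tp := wedge _; pose e : R := (-1) ^+ n.+1; rewrite -/e.
have ee : e * e = 1 by rewrite -expr2 sqrr_sign.
have ov := adapted_orthonormal.
have tpv i : dot tp (v i) = 0.
  by have := dot_wedge_family (frcons v nu) (lift ord_max i); rewrite frcons_lift.
have tpn : dot tp nu = 0.
  by have := dot_wedge_family (frcons v nu) ord_max; rewrite frcons_max.
have tpa i : dot tp (D (V i)) = 0.
  have := gram_schmidt_mxE (fun i => D (V i)) => /(congr1 (row i)).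
  rewrite rowK row_mul mulmx_sum_row => ->; rewrite dotC dot_suml big1// => j _.
  by rewrite dotZl rowK dotC tpv mulr0.
have tpker x : pairing c x = 0 -> dot tp (D x) = 0.
  by move=> /(adapted_span adapted); exact: linear_span.
pose k := dot tp t.
(* The component of tp along X vanishes, as tp and t are orthogonal to X. *)
have tpE : tp = k *: t.
  have [b dec] := orthogonal_decomposition W0 tp.
  apply/eqP; rewrite -subr_eq0 -dot_eq0.
  have zE : tp - k *: t = \sum_i b i *: X i.
    by rewrite {1}dec tpn scale0r addr0 addrK.
  rewrite {1}zE dot_suml big1// => i _; rewrite dotZl dotC dotBl (dotZl k).
  rewrite (unit_conormal_family X) mulr0 subr0 tpker ?mulr0//.
  exact: adapted_pairing adapted0.
have k2 : k * k = 1.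
  have := dot_wedge_orthonormal ov; rewrite -/tp tpE (dotZl k) (dotZr k).
  by rewrite (unit_conormal_unit W0) mulr1.
(* Both factors of <tp, D u> = s k are compared with the orientation of the frames. *)
have ke : 0 < k * e.
  have [cu _ _ du] := adapted; have [_ _ _ du0] := adapted0.
  have [x cx Du] := height_decomposition cu.
  have h0 := height_gt0 W0.
  have e1 : dot tp (D u) = height X Y * k.
    by rewrite Du dotDr tpker// add0r dotZr.
  have [k1 k10 w1] := wedge_gram_schmidt (D u).
  have [k3 k30 w2] := wedge_frame D du0 du.
  have e2 : e * dot tp (D u) = k1 * (k3 * enorm (wedge (fcons Y X))).
    rewrite dot_wedge -det_aroundE /det_around -dot_wedge w1 -/(D \o V).
    rewrite w2 (dotZl k1) (dotZl k3).
    congr (_ * (_ * _)); rewrite -[X in dot X _]enorm_normalizeK dotZl.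
    by rewrite (hyper_normal_unit W0) mulr1.
  have : 0 < height X Y * (k * e).
    rewrite mulrA mulrC -e1 e2 !mulr_gt0// enorm_gt0//.
  by rewrite pmulr_rgt0.
rewrite tpE; congr (_ *: _).
have : (k * e - 1) * (k * e + 1) = 0.
  have -> : (k * e - 1) * (k * e + 1) = (k * k) * (e * e) - 1 by ring.
  by rewrite k2 ee mulr1 subrr.
move/eqP; rewrite mulf_eq0 => /orP[|/eqP]; last by lra.
by rewrite subr_eq0 => /eqP ke1; rewrite -[LHS]mulr1 -ee mulrA ke1 mul1r.
Qed.

End AdaptedGramSchmidt.

(** * The data of the corrugation process *)

Section CorrugationData.
Context {R : realType} {n : nat}.
Local Notation chart := 'rV[R]_n.+1.
Local Notation space := 'rV[R]_n.+2.
Variables (f : chart -> space) (p : chart) (c : 'cV[R]_n.+1).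
Variables (u0 : chart) (V0 : 'I_n -> chart).
Hypothesis adapted0 : adapted_at c u0 V0.
Local Notation X := ('d f p \o V0).
Local Notation Y := ('d f p u0).
Hypothesis W0 : wedge (fcons Y X) != 0.
Variables (u : chart -> chart) (rho : chart -> R).
Hypothesis cu : pairing c (u p) = 1.
Local Notation h := (height X Y).

Lemma projperpE : projperp (image_ker f c p) ('d f p (u p)) =
    h *: unit_conormal X Y.
Proof.
have [x cx Du] := height_decomposition adapted0 W0 cu.
rewrite /projperp (@proj_unique _ _ _ _ ('d f p x)).
- by rewrite Du addrC addKr.
- move=> _ _ [y cy <-] [z cz <-]; exists (y - z); last by rewrite linearB.
  by rewrite /= pairingB cy cz subrr.
- by exists x.
- move=> _ [y cy <-]; rewrite Du addrC addKr dotZl.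
  by rewrite (conormal_ker ('d f p) adapted0) ?mulr0.
Qed.

Lemma tvecE : tvec f c u p = unit_conormal X Y.
Proof.
rewrite /tvec projperpE normalizeZ ?height_gt0// normalize_unit//.
exact: unit_conormal_unit.
Qed.

Lemma enorm_projperp : enorm (projperp (image_ker f c p) ('d f p (u p))) = h.
Proof.
rewrite projperpE enormZ /enorm (unit_conormal_unit W0) sqrtr1 mulr1.
by rewrite gtr0_norm// height_gt0.
Qed.

Lemma radiusE : Defs.radius f rho c u p = Num.sqrt (h ^+ 2 + rho p).
Proof.
rewrite /Defs.radius /mu /pullback cu !mulr1; congr Num.sqrt; rewrite enorm_sqr.
have -> : Defs.proj (image_ker f c p) ('d f p (u p)) =
          'd f p (u p) - projperp (image_ker f c p) ('d f p (u p)).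
  by rewrite /projperp opprB addrCA subrr addr0.
rewrite projperpE; have [x cx Du] := height_decomposition adapted0 W0 cu.
rewrite Du addrK dotDl !dotDr (dotZl h) (dotZl h) !(dotZr h) [dot ('d f p x) (unit_conormal _ _)]dotC.
rewrite (conormal_ker ('d f p) adapted0)// (unit_conormal_unit W0).
ring.
Qed.

(** s / r = 1 / sqrt (1 + rho / s^2). *)
Lemma alphaE : 0 <= rho p -> alpha f rho c u p = angle (Num.sqrt (rho p) / h).
Proof.
move=> rho0; rewrite /alpha enorm_projperp radiusE /angle /invsqrt1p.
have h0 := height_gt0 W0; congr (J0inv _).
rewrite expr_div_n sqr_sqrtr//.
have -> : h ^+ 2 + rho p = h ^+ 2 * (1 + rho p / h ^+ 2).
  by rewrite mulrDr mulr1 mulrCA mulfV ?mulr1// expf_neq0// gt_eqF.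
rewrite sqrtrM ?sqr_ge0// sqrtr_sqr gtr0_norm// invfM mulrA mulfV ?mul1r//.
by rewrite gt_eqF.
Qed.

(** The choice of alpha makes the mean of r cos (alpha cos (2 pi s)) over a period
    equal to the height of df(u). *)
Lemma radius_J0 : 0 <= rho p ->
  Defs.radius f rho c u p * J0 (alpha f rho c u p) = h.
Proof.
move=> rho0; have h0 := height_gt0 W0.
have r0 : 0 < Defs.radius f rho c u p.
  by rewrite radiusE sqrtr_gt0 ltr_pwDl// exprn_gt0.
rewrite /alpha (J0invP _).2 enorm_projperp; first by rewrite mulrCA mulfV ?mulr1// gt_eqF.
rewrite divr_ge0 ?(ltW h0) ?(ltW r0)// ler_pdivrMr// mul1r radiusE.
by rewrite -[leLHS](gtr0_norm h0) -sqrtr_sqr ler_wsqrtr// lerDl.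
Qed.

End CorrugationData.

(** * Vector-valued functions *)

Section VectorDifferentials.
Context {R : realType} {n : nat}.
Local Notation chart := 'rV[R]_n.+1.
Implicit Types (p v : chart).

Lemma is_diffE (W : normedModType R) (g dg : chart -> W) p v :
  is_diff p g dg -> 'd g p v = dg v.
Proof. by move=> [_ ->]. Qed.

Lemma is_diff_sum (W : normedModType R) (I : Type) (r : seq I) (F dF : I -> chart -> W) p :
  (forall i, is_diff p (F i) (dF i)) ->
  is_diff p (fun q => \sum_(i <- r) F i q) (fun v => \sum_(i <- r) dF i v).
Proof.
move=> H; elim: r => [|i r IH].
  have -> : (fun q => \sum_(i <- [::]) F i q) = cst 0.
    by apply/funext => q; rewrite big_nil.
  have -> : (fun v => \sum_(i <- [::]) dF i v) = (0 : chart -> W).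
    by apply/funext => v; rewrite big_nil.
  exact: is_diff_cst.
have -> : (fun q => \sum_(i <- i :: r) F i q) = F i + (fun q => \sum_(i <- r) F i q).
  by apply/funext => q; rewrite big_cons fctE.
have -> : (fun v => \sum_(i <- i :: r) dF i v) = dF i + (fun v => \sum_(i <- r) dF i v).
  by apply/funext => v; rewrite big_cons fctE.
exact: is_diffD.
Qed.

Lemma is_diff_row d (g : chart -> 'rV[R]_d.+1) (dg : 'I_d.+1 -> chart -> R) p :
  (forall i, is_diff p (fun q => g q 0 i) (dg i)) ->
  is_diff p g (fun v => \row_i dg i v).
Proof.
move=> H.
have -> : g = (fun q => \sum_i g q 0 i *: delta_mx 0 i).
  by apply/funext => q; exact: row_sum_delta.
have -> : (fun v => \row_i dg i v) = (fun v => \sum_i dg i v *: (delta_mx 0 i : 'rV[R]_d.+1)).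
  apply/funext => v; rewrite [LHS]row_sum_delta; apply: eq_bigr => i _.
  by rewrite mxE.
apply: is_diff_sum => i; have [di Di] := H i.
apply: DiffDef; first exact: differentiableZl.
by rewrite diffZl// Di.
Qed.

Variable O : set chart.
Hypotheses (O_open : open O) (cube_O : cube `<=` O).

Definition vbounded_diff {d} (g : chart -> 'rV[R]_d) :=
  forall i, bounded_diff O (fun p => g p 0 i).

Lemma vbounded_diff_dot d (g h : chart -> 'rV[R]_d) :
  vbounded_diff g -> vbounded_diff h -> bounded_diff O (fun p => dot (g p) (h p)).
Proof.
move=> Hg Hh.
have := bounded_diff_sum O_open cube_O (index_enum _) xpredT
  (fun i => bounded_diffM cube_O (Hg i) (Hh i)).
by apply: (eq_bounded_diff O_open cube_O) => p _; rewrite dotE.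
Qed.

Lemma vbounded_diffZ d (a : chart -> R) (g : chart -> 'rV[R]_d) :
  bounded_diff O a -> vbounded_diff g -> vbounded_diff (fun p => a p *: g p).
Proof.
move=> Ha Hg i; have := bounded_diffM cube_O Ha (Hg i).
by apply: (eq_bounded_diff O_open cube_O) => p _; rewrite mxE.
Qed.

Lemma vbounded_diff_enorm d (g : chart -> 'rV[R]_d) : vbounded_diff g ->
  (forall p, O p -> g p != 0) -> bounded_diff O (fun p => enorm (g p)).
Proof.
move=> Hg g0; apply: (bounded_diff_sqrt cube_O); first exact: vbounded_diff_dot.
by move=> p Op; rewrite dot_gt0 g0.
Qed.

Lemma vbounded_diff_normalize d (g : chart -> 'rV[R]_d) : vbounded_diff g ->
  (forall p, O p -> g p != 0) -> vbounded_diff (fun p => normalize (g p)).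
Proof.
move=> Hg g0; apply: vbounded_diffZ => //.
apply: (bounded_diffV cube_O); first exact: vbounded_diff_enorm.
by move=> p Op; rewrite enorm_gt0 g0.
Qed.

Lemma vbounded_diff_wedge d (a : 'I_d -> chart -> 'rV[R]_d.+1) :
  (forall i, vbounded_diff (a i)) -> vbounded_diff (fun p => wedge (fun i => a i p)).
Proof.
move=> Ha j.
have H : bounded_diff O (fun p =>
    \det (\matrix_i frcons (fun i => a i p) (delta_mx 0 j : 'rV[R]_d.+1) i)).
  apply: (bounded_diff_det O_open cube_O) => i l.
  case: (unliftP ord_max i) => [k ->|->].
    by apply: (eq_bounded_diff O_open cube_O) (Ha k l) => p _; rewrite mxE frcons_lift.
  apply: (eq_bounded_diff O_open cube_O)
    (bounded_diff_cst O ((delta_mx 0 j : 'rV[R]_d.+1) 0 l)) => p _.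
  by rewrite [in RHS]mxE frcons_max.
by apply: (eq_bounded_diff O_open cube_O) H => p _; rewrite mxE.
Qed.

Lemma vbounded_diff_fcons k d (x : chart -> 'rV[R]_d) (a : 'I_k -> chart -> 'rV[R]_d) i :
  vbounded_diff x -> (forall i, vbounded_diff (a i)) ->
  vbounded_diff (fun p => fcons (x p) (fun i => a i p) i).
Proof.
move=> Hx Ha j; case: (unliftP ord0 i) => [l ->|->].
  by apply: (eq_bounded_diff O_open cube_O) (Ha l j) => p _; rewrite fconsS.
by apply: (eq_bounded_diff O_open cube_O) (Hx j) => p _; rewrite fcons0.
Qed.

Lemma vbounded_diff_frcons k d (x : chart -> 'rV[R]_d) (a : 'I_k -> chart -> 'rV[R]_d) i :
  vbounded_diff x -> (forall i, vbounded_diff (a i)) ->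
  vbounded_diff (fun p => frcons (fun i => a i p) (x p) i).
Proof.
move=> Hx Ha j; case: (unliftP ord_max i) => [l ->|->].
  by apply: (eq_bounded_diff O_open cube_O) (Ha l j) => p _; rewrite frcons_lift.
by apply: (eq_bounded_diff O_open cube_O) (Hx j) => p _; rewrite frcons_max.
Qed.

End VectorDifferentials.

Section ContinuousGramSchmidt.
Context {R : realType} {n : nat}.
Local Notation chart := 'rV[R]_n.+1.
Implicit Types (p q : chart).

Lemma continuous_at_sum (I : Type) (r : seq I) (P : pred I) (F : I -> chart -> R) p :
  (forall i, P i -> {for p, continuous (F i)}) ->
  {for p, continuous (fun q => \sum_(i <- r | P i) F i q)}.
Proof.
move=> cF; elim: r => [|i r IH].
  have -> : (fun q => \sum_(i <- [::] | P i) F i q) = cst 0.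
    by apply/funext => q; rewrite big_nil.
  exact: cst_continuous.
have -> : (fun q => \sum_(i <- i :: r | P i) F i q) =
    (fun q => if P i then F i q + \sum_(i <- r | P i) F i q else \sum_(i <- r | P i) F i q).
  by apply/funext => q; rewrite big_cons.
by case Pi: (P i) => //; apply: cvgD IH; exact: cF.
Qed.

Definition vcontinuous_at p d (g : chart -> 'rV[R]_d) :=
  forall j, {for p, continuous (fun q => g q 0 j)}.

Lemma continuous_at_dot p d (g h : chart -> 'rV[R]_d) :
  vcontinuous_at p g -> vcontinuous_at p h -> {for p, continuous (fun q => dot (g q) (h q))}.
Proof.
move=> cg ch; have -> : (fun q => dot (g q) (h q)) = (fun q => \sum_i g q 0 i * h q 0 i).
  by apply/funext => q; rewrite dotE.
by apply: continuous_at_sum => i _; exact: continuousM (cg i) (ch i).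
Qed.

Lemma vcontinuous_atZ p d (a : chart -> R) (g : chart -> 'rV[R]_d) :
  {for p, continuous a} -> vcontinuous_at p g -> vcontinuous_at p (fun q => a q *: g q).
Proof.
move=> ca cg j; have -> : (fun q => (a q *: g q) 0 j) = (fun q => a q * g q 0 j).
  by apply/funext => q; rewrite mxE.
exact: continuousM ca (cg j).
Qed.

Lemma vcontinuous_at_normalize p d (g : chart -> 'rV[R]_d) :
  g p != 0 -> vcontinuous_at p g -> vcontinuous_at p (fun q => normalize (g q)).
Proof.
move=> g0 cg; apply: vcontinuous_atZ => //; apply: continuousV; first by rewrite gt_eqF// enorm_gt0.
apply: (@continuous_comp _ _ _ (fun q => dot (g q) (g q)) Num.sqrt).
  exact: continuous_at_dot.
exact: sqrt_continuous.
Qed.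

(** Strong induction on the index, as the earlier vectors are normalized residuals. *)
Lemma vcontinuous_at_residual p k d (a : 'I_k -> chart -> 'rV[R]_d) :
  row_free (\matrix_i a i p) -> (forall i, vcontinuous_at p (a i)) ->
  forall i, vcontinuous_at p (fun q => residual (fun i => a i q) i).
Proof.
move=> fa ca i; move: {2}i.+1 (ltnSn i) => m; elim: m i => [//|m IH] i im j.
have -> : (fun q => residual (fun i => a i q) i 0 j) =
  (fun q => a i q 0 j - \sum_(l < k | (l < i)%N)
     (dot (a i q) (normalize (residual (fun i => a i q) l)) *:
        normalize (residual (fun i => a i q) l)) 0 j).
  apply/funext => q; rewrite /residual [LHS]mxE [X in _ + X]mxE summxE.
  by congr (_ - _); apply: eq_bigr => l li; rewrite gram_schmidtE.
apply: (continuousB (ca i j)); apply: continuous_at_sum => l li.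
have cl : vcontinuous_at p (fun q => normalize (residual (fun i => a i q) l)).
  apply: vcontinuous_at_normalize; first exact: residual_neq0.
  exact/IH/(leq_trans li).
by apply: (vcontinuous_atZ _ cl); exact: continuous_at_dot (ca i) cl.
Qed.

End ContinuousGramSchmidt.

(** * One step of corrugation *)

Section CorrugationStep.
Context {R : realType} {n : nat} (O : set 'rV[R]_n.+1).
Hypotheses (O_open : open O) (cube_O : cube `<=` O).
Local Notation chart := 'rV[R]_n.+1.
Local Notation space := 'rV[R]_n.+2.
Variables (f : chart -> space) (c : 'cV[R]_n.+1) (rho : chart -> R).
Variables (u : chart -> chart) (V : 'I_n -> chart -> chart).
Hypotheses (f_C2 : class_C 2 O f) (f_imm : immersion_on O f).
Hypothesis uV_adapted : adapted_frame O (fun=> c) u V.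
Hypothesis rho_ge0 : forall p, O p -> 0 <= rho p.
Hypothesis sqrt_rho_C1 : class_C 1 O (fun p => Num.sqrt (rho p) : R^o).
Implicit Types (p q x : chart) (N : nat).

Let u0 : chart := u 0.
Let V0 : 'I_n -> chart := fun i => V i 0.

Let X p : 'I_n -> space := 'd f p \o V0.
Let Y p : space := 'd f p u0.
Let nu p := hyper_normal (X p) (Y p).
Let t p := unit_conormal (X p) (Y p).
Let h p := height (X p) (Y p).
Let r p := Num.sqrt (h p ^+ 2 + rho p).
Let al p := angle (Num.sqrt (rho p) / h p).

Lemma adapted_frame_at p : O p -> adapted_at c (u p) (fun i => V i p).
Proof. by case: uV_adapted => _ _ H /H[]. Qed.

Lemma base_adapted : adapted_at c u0 V0.
Proof. exact/adapted_frame_at/cube_O/cube0. Qed.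

Lemma frame_wedge_neq0 p : O p -> wedge (fcons (Y p) (X p)) != 0.
Proof.
by move=> Op; have [_ _ _ d0] := base_adapted; apply: injective_wedge_neq0 => //; exact: f_imm.
Qed.

Lemma unit_normal_nu p : O p -> unit_normal f u V p = nu p.
Proof.
move=> /adapted_frame_at[_ _ _ d]; have [_ _ _ d0] := base_adapted.
exact: (unit_normal_frame ('d f p) d0 d).
Qed.

Lemma base_height_gt0 p : O p -> 0 < h p.
Proof. by move=> Op; exact: height_gt0 (frame_wedge_neq0 Op). Qed.

Lemma pairing_u p : O p -> pairing c (u p) = 1.
Proof. by move=> /adapted_frame_at[]. Qed.

(** Here the data of the process, defined from u and V, are replaced by their
    expressions in the constant frame, which are differentiable. *)
Lemma corrugation_eq N p : O p ->
  corrugation f rho c u (unit_normal f u V) N p =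
  f p + (r p / N%:R * Kc (al p) (N%:R * pairing c p)) *: t p
      + (r p / N%:R * Ks (al p) (N%:R * pairing c p)) *: nu p.
Proof.
move=> Op; have W0 := frame_wedge_neq0 Op; have cu := pairing_u Op.
rewrite /corrugation (tvecE base_adapted W0 cu) (radiusE base_adapted W0 _ cu).
by rewrite (alphaE base_adapted W0 cu (rho_ge0 Op)) unit_normal_nu.
Qed.

Lemma theta_eq N p : O p ->
  theta f rho c u N p = al p * cos (2 * pi * (N%:R * pairing c p)).
Proof.
move=> Op; have W0 := frame_wedge_neq0 Op.
by rewrite /theta (alphaE base_adapted W0 (pairing_u Op) (rho_ge0 Op)).
Qed.

Lemma radius_mul_J0 p : O p -> r p * J0 (al p) = h p.
Proof.
move=> Op; have W0 := frame_wedge_neq0 Op; have cu := pairing_u Op.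
have := radius_J0 base_adapted W0 cu (rho_ge0 Op).
by rewrite (radiusE base_adapted W0 _ cu) (alphaE base_adapted W0 cu (rho_ge0 Op)).
Qed.

Lemma height_le_radius p : O p -> h p <= r p.
Proof.
move=> Op; rewrite -[leLHS](gtr0_norm (base_height_gt0 Op)) -sqrtr_sqr ler_wsqrtr//.
by rewrite lerDl rho_ge0.
Qed.

Lemma differential_bounded_diff x : vbounded_diff O (fun p => 'd f p x).
Proof.
case: f_C2 => _ df i; apply: (class_C1_bounded_diff_coord cube_O i); exact: df.
Qed.

Lemma kernel_image_bounded_diff i : vbounded_diff O (fun p => X p i).
Proof. exact: differential_bounded_diff. Qed.

Lemma transverse_bounded_diff : vbounded_diff O Y.
Proof. exact: differential_bounded_diff. Qed.

Lemma base_wedge_bounded_diff : vbounded_diff O (fun p => wedge (fcons (Y p) (X p))).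
Proof.
apply: (vbounded_diff_wedge O_open cube_O (a := fun i p => fcons (Y p) (X p) i)) => i.
exact: (vbounded_diff_fcons O_open cube_O _ transverse_bounded_diff kernel_image_bounded_diff).
Qed.

Lemma normal_bounded_diff : vbounded_diff O nu.
Proof.
exact: (vbounded_diff_normalize O_open cube_O base_wedge_bounded_diff frame_wedge_neq0).
Qed.

Lemma conormal_bounded_diff : vbounded_diff O t.
Proof.
apply: (vbounded_diff_normalize O_open cube_O).
  apply: (vbounded_diffZ O_open cube_O); first exact: bounded_diff_cst.
  apply: (vbounded_diff_wedge O_open cube_O (a := fun i p => frcons (X p) (nu p) i)) => i.
  exact: (vbounded_diff_frcons O_open cube_O _ normal_bounded_diff kernel_image_bounded_diff).
by move=> p Op; exact: conormal_neq0 (frame_wedge_neq0 Op).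
Qed.

Lemma height_bounded_diff : bounded_diff O h.
Proof. exact: (vbounded_diff_dot O_open cube_O conormal_bounded_diff transverse_bounded_diff). Qed.

Lemma sqrt_rho_bounded_diff : bounded_diff O (fun p => Num.sqrt (rho p)).
Proof. exact: class_C1_bounded_diff. Qed.

Lemma radius_bounded_diff : bounded_diff O r.
Proof.
apply: (bounded_diff_sqrt cube_O).
  have H := bounded_diffD cube_O (bounded_diffM cube_O height_bounded_diff height_bounded_diff)
    (bounded_diffM cube_O sqrt_rho_bounded_diff sqrt_rho_bounded_diff).
  apply: (eq_bounded_diff O_open cube_O) H => p Op.
  by rewrite -!expr2 sqr_sqrtr// rho_ge0.
by move=> p Op; rewrite ltr_pwDl ?rho_ge0// exprn_gt0// base_height_gt0.
Qed.

Lemma alpha_bounded_diff : bounded_diff O al.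
Proof.
apply: (bounded_diff_angle O_open cube_O).
  apply: (bounded_diffM cube_O sqrt_rho_bounded_diff).
  exact: (bounded_diffV cube_O height_bounded_diff base_height_gt0).
by move=> p Op; rewrite divr_ge0 ?sqrtr_ge0// ltW// base_height_gt0.
Qed.

Lemma is_diff_pairing (k : R) p : is_diff p (fun q => k * pairing c q) (fun v => k * pairing c v).
Proof.
have D i : is_diff p (fun q : chart => (k * c i 0) * q 0 i) (fun v : chart => (k * c i 0) * v 0 i).
  have Di : is_diff p (fun q : chart => q 0 i) (fun v : chart => v 0 i).
    have [di Di] := is_diff_id p.
    by have := is_diff_coord i di; rewrite Di.
  exact: (is_diffZ (k * c i 0) Di).
have E (q : chart) : k * pairing c q = \sum_i (k * c i 0) * q 0 i.
  by rewrite /pairing mxE mulr_sumr; apply: eq_bigr => i _; ring.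
have -> : (fun q : chart => k * pairing c q) = (fun q => \sum_i (k * c i 0) * q 0 i).
  by apply/funext => q; exact: E.
exact: is_diff_sum.
Qed.

(** The coefficient of l(x) in the differential of the corrugated map. *)
Definition push N p : space :=
  (r p * (cos (al p * cos (2 * pi * (N%:R * pairing c p))) - J0 (al p))) *: t p +
  (r p * sin (al p * cos (2 * pi * (N%:R * pairing c p)))) *: nu p.

Local Notation f' := (corrugation f rho c u (unit_normal f u V)).

Lemma row_combination3 d (a x y : 'rV[R]_d) (k l : R) i :
  (a + k *: x + l *: y) 0 i = a 0 i + k * x 0 i + l * y 0 i.
Proof. by rewrite !mxE. Qed.

Lemma remainder_bound (a k d l e B A C : R) : `|a| <= B -> `|k| <= 2 ->
  `|d| <= A -> `|l| <= 2 -> `|e| <= C -> `|a * k * d + l * e| <= B * 2 * A + 2 * C.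
Proof.
move=> aB k2 dA l2 eC; apply: le_trans (ler_normD _ _) _; rewrite !normrM.
by apply: lerD; do ?[apply: ler_pM => //]; rewrite mulr_ge0.
Qed.

Lemma row_combination2 d (a x : 'rV[R]_d) (k : R) i :
  (a + k *: x) 0 i = a 0 i + k * x 0 i.
Proof. by rewrite !mxE. Qed.

Lemma push_coord N p i : push N p 0 i =
  r p * (cos (al p * cos (2 * pi * (N%:R * pairing c p))) - J0 (al p)) * t p 0 i +
  r p * sin (al p * cos (2 * pi * (N%:R * pairing c p))) * nu p 0 i.
Proof. by rewrite -[push N p]add0r /push addrA row_combination3 mxE add0r. Qed.

(** One coordinate of the perturbation.  The derivative of the phase N pi cancels
    the factor 1 / N; all other terms keep it. *)
Lemma is_diff_corrugation_term (K Ka Kt : R -> R -> R) (b : chart -> R) N p :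
  (forall x s : R, is_derive x 1 (K ^~ s) (Ka x s)) ->
  (forall x s : R, is_derive s 1 (K x) (Kt x s)) ->
  continuous (fun z : R * R => Kt z.1 z.2) ->
  bounded_diff O b -> O p -> (0 < N)%N ->
  is_diff p (fun q => b q / N%:R * K (al q) (N%:R * pairing c q))
    (fun v => b p * Kt (al p) (N%:R * pairing c p) * pairing c v +
       (b p * Ka (al p) (N%:R * pairing c p) * 'd al p v +
        K (al p) (N%:R * pairing c p) * 'd b p v) / N%:R).
Proof.
move=> dKa dKt cKt hb Op N0.
have [dpi Dpi] := is_diff_pairing N%:R p.
have dal := alpha_bounded_diff.1 p Op.
have D := differentiable_two_variables dKa dKt cKt dal dpi.
have db := differentiableP (hb.1 p Op).
rewrite Dpi in D; have D2 := is_diffM (is_diffZ N%:R^-1 db) D.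
have Nn0 : N%:R != 0 :> R by rewrite pnatr_eq0 -lt0n.
have -> : (fun q => b q / N%:R * K (al q) (N%:R * pairing c q)) =
    (N%:R^-1 *: b) * (fun q => K (al q) (N%:R * pairing c q)).
  by apply/funext => q; rewrite /GRing.scale/= [b q / _]mulrC.
apply: is_diff_eq D2 _; apply/funext => v.
have E (k a1 a2 x y z w : R) : (N%:R^-1 * z) * (a1 * x + a2 * (N%:R * y)) + k * (N%:R^-1 * w) =
    z * a2 * y + (z * a1 * x + k * w) / N%:R by field.
exact: E.
Qed.

(** The remainder is E / N, where E collects the derivatives of the slowly varying
    factors r t, r n and alpha; the kernels being bounded uniformly in the phase,
    E is bounded uniformly in N. *)
Lemma differential_corrugation x :
  (forall N p, (0 < N)%N -> O p -> differentiable (f' N) p) /\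
  vapprox (fun N p => 'd (f' N) p x)
          (fun N p => 'd f p x + pairing c x *: push N p).
Proof.
pose bt i q := r q * t q 0 i; pose bn i q := r q * nu q 0 i.
have hbt i : bounded_diff O (bt i) := bounded_diffM cube_O radius_bounded_diff (conormal_bounded_diff i).
have hbn i : bounded_diff O (bn i) := bounded_diffM cube_O radius_bounded_diff (normal_bounded_diff i).
pose s N p : R := N%:R * pairing c p.
pose E i N p v := bt i p * dKc (al p) (s N p) * 'd al p v + Kc (al p) (s N p) * 'd (bt i) p v
  + (bn i p * dKs (al p) (s N p) * 'd al p v + Ks (al p) (s N p) * 'd (bn i) p v).
have D N p : (0 < N)%N -> O p -> is_diff p (f' N)
    (fun v => \row_i ('d f p v 0 i + pairing c v * push N p 0 i + E i N p v / N%:R)).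
  move=> N0 Op.
  pose g q := \row_i (f q 0 i + bt i q / N%:R * Kc (al q) (s N q)
                              + bn i q / N%:R * Ks (al q) (s N q)).
  have fg : \forall q \near p, g q = f' N q.
    have : \forall q \near p, O q by exact: open_nbhs_nbhs.
    apply: filterS => q Oq; rewrite corrugation_eq//; apply/rowP => i.
    rewrite [LHS]mxE row_combination3 /bt /bn /s.
    by move: (f q 0 i) (t q 0 i) (nu q 0 i) => a b d; ring.
  apply: (near_is_diff fg); apply: is_diff_row => i.
  have -> : (fun q => g q 0 i) = (fun q => f q 0 i)
      + (fun q => bt i q / N%:R * Kc (al q) (s N q))
      + (fun q => bn i q / N%:R * Ks (al q) (s N q)).
    by apply/funext => q; rewrite mxE !fctE.
  have D1 : is_diff p (fun q => f q 0 i) (fun v => 'd f p v 0 i).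
    by apply: is_diff_coord; case: f_C2 => df _; exact: df.
  have D2 := is_diff_corrugation_term is_derive_Kc_param is_derive_Kc
    continuous_dt_Kc (hbt i) Op N0.
  have D3 := is_diff_corrugation_term is_derive_Ks_param is_derive_Ks
    continuous_dt_Ks (hbn i) Op N0.
  apply: is_diff_eq (is_diffD (is_diffD D1 D2) D3) _.
  apply/funext => v; rewrite push_coord.
  have Er (d r0 t0 n0 c1 j0 s1 y e1 e2 m : R) :
      d + (r0 * t0 * (c1 - j0) * y + e1 / m) + (r0 * n0 * s1 * y + e2 / m) =
      d + y * (r0 * (c1 - j0) * t0 + r0 * s1 * n0) + (e1 + e2) / m by ring.
  exact: Er.
split=> [N p N0 Op|i]; first by have [] := D N p N0 Op.
have [A HA] := alpha_bounded_diff.2 x.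
have [B HB] := bounded_diff_bounded cube_O (hbt i).
have [B' HB'] := bounded_diff_bounded cube_O (hbn i).
have [C HC] := (hbt i).2 x; have [C' HC'] := (hbn i).2 x.
exists (B * 2 * A + 2 * C + (B' * 2 * A + 2 * C')), 0%N => N p N0 _ cp.
have Dv : 'd (f' N) p x 0 i = 'd f p x 0 i + pairing c x * push N p 0 i + E i N p x / N%:R.
  apply: etrans (congr1 (fun g : space => g 0 i) (is_diffE x (D N p N0 (cube_O cp)))) _.
  by rewrite mxE.
have -> : 'd (f' N) p x 0 i - ('d f p x + pairing c x *: push N p) 0 i = E i N p x / N%:R.
  by apply/eqP; rewrite subr_eq Dv (row_combination2 ('d f p x)) addrC.
rewrite normrM [`|N%:R^-1|]ger0_norm ?invr_ge0 ?ler0n// ler_wpM2r ?invr_ge0 ?ler0n//.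
apply: le_trans (ler_normD _ _) _; apply: lerD; apply: remainder_bound.
- exact: HB.
- exact: dKc_bounded.
- exact: HA.
- exact: Kc_bounded.
- exact: HC.
- exact: HB'.
- exact: dKs_bounded.
- exact: HA.
- exact: Ks_bounded.
- exact: HC'.
Qed.

Lemma vbounded_of_diff d (g : chart -> 'rV[R]_d) : vbounded_diff O g ->
  vbounded (fun (_ : nat) p => g p).
Proof.
move=> hg j; have [C HC] := bounded_diff_bounded cube_O (hg j).
by exists C => N p _ cp; exact: HC.
Qed.

Lemma bounded_of_diff (a : chart -> R) : bounded_diff O a ->
  bounded_on_cube (fun (_ : nat) p => a p).
Proof.
by move=> ha; have [C HC] := bounded_diff_bounded cube_O ha; exists C => N p _ cp; exact: HC.
Qed.

Let th N p : R := al p * cos (2 * pi * (N%:R * pairing c p)).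

Lemma push_eq N p : O p -> push N p = (r p * cos (th N p) - h p) *: t p +
  (r p * sin (th N p)) *: nu p.
Proof. by move=> Op; rewrite /push mulrBr radius_mul_J0. Qed.

Lemma bounded_cos_theta : bounded_on_cube (fun N p => cos (th N p)).
Proof. by exists 1 => N p _ _; exact: cos_max. Qed.

Lemma bounded_sin_theta : bounded_on_cube (fun N p => sin (th N p)).
Proof. by exists 1 => N p _ _; exact: sin_max. Qed.

Lemma vbounded_push : vbounded push.
Proof.
have B : vbounded (fun N p => (r p * cos (th N p) - h p) *: t p +
    (r p * sin (th N p)) *: nu p).
  apply: vboundedD; apply: vboundedZ.
  - apply: boundedB; last exact: bounded_of_diff height_bounded_diff.
    exact: boundedM (bounded_of_diff radius_bounded_diff) bounded_cos_theta.
  - exact: vbounded_of_diff conormal_bounded_diff.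
  - exact: boundedM (bounded_of_diff radius_bounded_diff) bounded_sin_theta.
  - exact: vbounded_of_diff normal_bounded_diff.
by move=> j; have [C HC] := B j; exists C => N p N0 cp; rewrite (push_eq _ (cube_O cp)) HC.
Qed.

Lemma approx_differential_ker x : pairing c x = 0 ->
  vapprox (fun N p => 'd (f' N) p x) (fun _ p => 'd f p x).
Proof.
move=> cx j; have [_ H] := differential_corrugation x.
by apply: eq_approx (H j) _ _ => // N p _ _; rewrite cx scale0r addr0.
Qed.

Lemma approx_differential_u :
  vapprox (fun N p => 'd (f' N) p u0) (fun N p => Y p + push N p).
Proof.
move=> j; have [_ H] := differential_corrugation u0.
have [cu0 _ _ _] := base_adapted.
by apply: eq_approx (H j) _ _ => // N p _ _; rewrite cu0 scale1r.
Qed.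

Let turned N p := wedge (fcons (Y p + push N p) (X p)).

Lemma turnedE N p : O p ->
  turned N p = (r p * turn (X p) (Y p)) *: (cos (th N p) *: nu p - sin (th N p) *: t p).
Proof.
move=> Op; have W0 := frame_wedge_neq0 Op.
have [b e] := tangent_decomposition W0.
rewrite -(turned_normal W0 b); last exact: lt_le_trans (base_height_gt0 Op) (height_le_radius Op).
rewrite /turned push_eq//; congr (wedge (fcons _ _)).
rewrite [X in X + _]e -/(h p) -/(t p) -/(nu p).
move: (\sum_i _) (t p) (nu p) => S tp np; apply/rowP => i; rewrite !mxE; ring.
Qed.

Lemma turned_unit N p : O p -> dot (cos (th N p) *: nu p - sin (th N p) *: t p)
  (cos (th N p) *: nu p - sin (th N p) *: t p) = 1.
Proof.
move=> Op; have W0 := frame_wedge_neq0 Op.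
have tt := unit_conormal_unit W0; have nn := hyper_normal_unit W0.
have tn := unit_conormal_normal (X p) (Y p); rewrite -/(t p) -/(nu p) in tt nn tn.
rewrite dotBl !dotBr !(dotZl (cos _)) !(dotZl (sin _)) !(dotZr (cos _)) !(dotZr (sin _)).
rewrite tt nn tn [dot (nu p) _]dotC tn -[RHS](cos2Dsin2 (th N p)); ring.
Qed.

(** The vector product has the norm r |Y /\ X| / s >= |Y /\ X|. *)
Lemma turned_far_from0 : far_from0 (fun N p => dot (turned N p) (turned N p)).
Proof.
have [e e0 He] := bounded_diff_lower_bound cube_O
  (vbounded_diff_dot O_open cube_O base_wedge_bounded_diff base_wedge_bounded_diff)
  (fun p Op => etrans (dot_gt0 _) (frame_wedge_neq0 Op)).
exists e => // N p N0 cp; have Op := cube_O cp.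
apply: le_trans (He _ cp) _; rewrite turnedE// dotZl dotZr turned_unit// mulr1.
rewrite -enorm_sqr expr2; set w := enorm _.
have h0 := base_height_gt0 Op.
have w_le : w <= r p * turn (X p) (Y p).
  rewrite /turn -/w -/(h p) mulrCA ler_peMr ?sqrtr_ge0//.
  by rewrite ler_pdivlMr// mul1r height_le_radius.
by apply: ler_pM; rewrite ?sqrtr_ge0.
Qed.

Lemma approx_turned :
  vapprox (fun N p => wedge (fcons ('d (f' N) p u0) ('d (f' N) p \o V0))) turned /\
  vbounded turned.
Proof.
have B i : vbounded (fun N p => fcons (Y p + push N p) (fun i => X p i) i).
  apply: vbounded_fcons => [|l]; last exact: vbounded_of_diff (kernel_image_bounded_diff l).
  exact: vboundedD (vbounded_of_diff transverse_bounded_diff) vbounded_push.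
split; last exact: vbounded_wedge B.
apply: (vapprox_wedge (F := fun i N p => fcons ('d (f' N) p u0) ('d (f' N) p \o V0) i) B) => i.
apply: (vapprox_fcons (F' := fun i N p => 'd (f' N) p (V0 i))).
  exact: approx_differential_u.
move=> l; apply: approx_differential_ker; exact: adapted_pairing base_adapted.
Qed.

Lemma approx_normal :
  vapprox (fun N p => hyper_normal ('d (f' N) p \o V0) ('d (f' N) p u0))
          (fun N p => cos (th N p) *: nu p - sin (th N p) *: t p).
Proof.
have [A B] := approx_turned.
move=> j; apply: eq_approx (vapprox_normalize B turned_far_from0 A j) _ _ => // N p _ cp.
have Op := cube_O cp; rewrite turnedE// normalizeZ ?normalize_unit ?turned_unit//.
apply: mulr_gt0; first exact: lt_le_trans (base_height_gt0 Op) (height_le_radius Op).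
exact: turn_gt0 (frame_wedge_neq0 Op).
Qed.

Lemma frame_vcontinuous i p : O p -> vcontinuous_at p (V i).
Proof.
move=> Op j; have [_ cV _] := uV_adapted.
apply: (@continuous_comp _ _ _ (V i) (fun M : chart => M 0 j)); first exact: cV.
exact: coord_continuous.
Qed.

Lemma linear_coord (W : lmodType R) (D : {linear chart -> W}) y :
  D y = \sum_k y 0 k *: D (delta_mx 0 k).
Proof. by rewrite {1}[y]row_sum_delta linear_sum; apply: eq_bigr => k _; rewrite linearZ. Qed.

(** V depends on p, but only through its bounded coordinates; l(V) = 0 removes the
    leading term. *)
Lemma approx_differential_frame i :
  vapprox (fun N p => 'd (f' N) p (V i p)) (fun _ p => 'd f p (V i p)) /\
  vbounded (fun (_ : nat) p => 'd f p (V i p)).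
Proof.
have BV k : bounded_on_cube (fun _ p => V i p 0 k).
  have [C HC] : exists C, forall p, cube p -> `|V i p 0 k| <= C.
    by apply: (cube_bounded (a := fun p => V i p 0 k)) => p /cube_O Op; exact: frame_vcontinuous.
  by exists C => N p _ cp; exact: HC.
have BE k : vbounded (fun N p => 'd f p (delta_mx 0 k) + pairing c (delta_mx 0 k) *: push N p).
  apply: vboundedD; first exact: vbounded_of_diff (differential_bounded_diff _).
  by apply: vboundedZ; [exact: bounded_cst | exact: vbounded_push].
have E N p : cube p -> \sum_k V i p 0 k *:
    ('d f p (delta_mx 0 k) + pairing c (delta_mx 0 k) *: push N p) = 'd f p (V i p).
  move=> cp; under eq_bigr do rewrite scalerDr scalerA.
  rewrite big_split/= -linear_coord -scaler_suml.
  have -> : \sum_k V i p 0 k * pairing c (delta_mx 0 k) = pairing c (V i p).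
    rewrite [in RHS]/pairing [in RHS](row_sum_delta (V i p)) mulmx_suml summxE.
    by apply: eq_bigr => k _; rewrite -scalemxAl mxE.
  rewrite (adapted_pairing i (adapted_frame_at (cube_O cp))) scale0r addr0//.
split=> j.
  have H := vapprox_sum (index_enum _) (P := xpredT) (fun k _ => vapproxZ (BV k) (BE k)
    (approx_refl _) (differential_corrugation (delta_mx 0 k)).2).
  apply: eq_approx (H j) _ _ => N p N0 cp; last by rewrite E.
  by rewrite [in RHS]linear_coord.
have [C HC] := vbounded_sum (index_enum _) (P := xpredT) (fun k _ => vboundedZ (BV k) (BE k)) j.
by exists C => N p N0 cp; have := HC N p N0 cp; rewrite E.
Qed.

Lemma residual_far i : far_from0 (fun (_ : nat) p =>
  dot (residual (fun i => 'd f p (V i p)) i) (residual (fun i => 'd f p (V i p)) i)).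
Proof.
have free p : O p -> row_free (\matrix_i 'd f p (V i p)).
  move=> Op; exact: (adapted_free base_adapted (frame_wedge_neq0 Op) (adapted_frame_at Op)).
have cdV l p : O p -> vcontinuous_at p (fun q => 'd f q (V l q)).
  move=> Op j.
  have -> : (fun q => 'd f q (V l q) 0 j) =
      (fun q => \sum_k V l q 0 k * 'd f q (delta_mx 0 k) 0 j).
    by apply/funext => q; rewrite linear_coord summxE; apply: eq_bigr => k _; rewrite mxE.
  apply: continuous_at_sum => k _; apply: continuousM; first exact: frame_vcontinuous.
  exact: bounded_diff_continuous (differential_bounded_diff _ _) Op.
have [e e0 He] : exists2 e, 0 < e & forall p, cube p -> e <=
    dot (residual (fun i => 'd f p (V i p)) i) (residual (fun i => 'd f p (V i p)) i).
  apply: cube_lower_bound => p /cube_O Op; last by rewrite dot_gt0 residual_neq0 ?free.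
  have H : vcontinuous_at p (fun q => residual (fun i => 'd f q (V i q)) i).
    apply: (vcontinuous_at_residual (a := fun i q => 'd f q (V i q))) => [|l].
      exact: free.
    exact: cdV.
  exact: (continuous_at_dot H H).
by exists e => // N p _ cp; exact: He.
Qed.

Lemma approx_gram_schmidt_frame i :
  vapprox (fun N p => gram_schmidt (fun i => 'd (f' N) p (V i p)) i)
          (fun _ p => gram_schmidt (fun i => 'd f p (V i p)) i) /\
  vbounded (fun (_ : nat) p => gram_schmidt (fun i => 'd f p (V i p)) i).
Proof.
apply: (vapprox_gram_schmidt (F := fun i N p => 'd (f' N) p (V i p))
  (G := fun i (_ : nat) p => 'd f p (V i p))) => l.
- by have [] := approx_differential_frame l.
- by have [] := approx_differential_frame l.
- exact: residual_far.
Qed.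

(** So f' is an immersion along the cube: its vector product is close to that of the
    turned hyperplane, whose norm is bounded below. *)
Lemma corrugation_wedge_neq0 : exists N0, forall N p, (0 < N)%N -> (N0 <= N)%N -> cube p ->
  wedge (fcons ('d (f' N) p u0) ('d (f' N) p \o V0)) != 0.
Proof.
have [A B] := approx_turned; have [e e0 He] := turned_far_from0.
have [N0 H] := approx_eventually_ge (approx_dot B B A A) e0 He.
exists N0 => N p N1 NN cp; rewrite -dot_gt0.
by apply: lt_le_trans (H _ _ N1 NN cp); rewrite divr_gt0.
Qed.

Let v p i := gram_schmidt (fun i => 'd f p (V i p)) i.
Let v' N p i := gram_schmidt (fun i => 'd (f' N) p (V i p)) i.
Let nu' N p := hyper_normal ('d (f' N) p \o V0) ('d (f' N) p u0).

(** [corner_rotationE] for the angle (-1)^(n+1) theta, as v /\ n = (-1)^(n+1) t. *)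
Lemma frame_model N p : O p ->
  frame_mx (v p) (cos (th N p) *: nu p - sin (th N p) *: t p) *m (frame_mx (v p) (nu p))^T =
  corner_rotation ((-1) ^+ n.+1 * th N p).
Proof.
move=> Op; have W0 := frame_wedge_neq0 Op; have av := adapted_frame_at Op.
rewrite -(@corner_rotationE _ _ (v p) (nu p)); last exact: (adapted_orthonormal base_adapted W0 av).
congr (frame_mx _ _ *m _).
have -> : wedge (frcons (v p) (nu p)) = (-1) ^+ n.+1 *: t p.
  exact: (adapted_wedge base_adapted W0 av).
suff E (x y : space) : cos (th N p) *: x - sin (th N p) *: y =
    cos ((-1) ^+ n.+1 * th N p) *: x - sin ((-1) ^+ n.+1 * th N p) *: ((-1) ^+ n.+1 *: y).
  exact: E.
rewrite scalerA -signr_odd; case: (odd n.+1).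
  by rewrite expr1 !mulN1r cosN sinN mulrN1 opprK.
by rewrite expr0 !mul1r mulr1.
Qed.

Lemma vapprox_row_frame (F G : nat -> chart -> space)
    (a a' : 'I_n -> nat -> chart -> space) :
  vbounded G -> (forall k, vbounded (a' k)) -> vapprox F G -> (forall k, vapprox (a k) (a' k)) ->
  forall i, vapprox (fun N p => row i (frame_mx (a ^~ N ^~ p) (F N p)))
          (fun N p => row i (frame_mx (a' ^~ N ^~ p) (G N p))) /\
  vbounded (fun N p => row i (frame_mx (a' ^~ N ^~ p) (G N p))).
Proof.
move=> BG Ba AF Aa i.
have B k : vbounded (fun N p => frcons (fun i => a' i N p) (G N p) k).
  exact: vbounded_frcons.
have A k : vapprox (fun N p => frcons (fun i => a i N p) (F N p) k)
                   (fun N p => frcons (fun i => a' i N p) (G N p) k).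
  exact: vapprox_frcons.
have W1 := vapprox_wedge B A; have W2 := vbounded_wedge B.
split=> j.
  apply: eq_approx (vapprox_fcons i W1 A j) _ _ => N p _ _; by rewrite !mxE.
have [C HC] := vbounded_fcons i W2 B j; exists C => N p N0 cp.
by have := HC N p N0 cp; rewrite !mxE.
Qed.

Lemma approx_rotation (a b : 'I_n.+2) :
  approx (fun N p => (frame_mx (v' N p) (nu' N p) *m (frame_mx (v p) (nu p))^T) a b)
         (fun N p => corner_rotation ((-1) ^+ n.+1 * th N p) a b).
Proof.
have Bn := vbounded_of_diff normal_bounded_diff; have Bt := vbounded_of_diff conormal_bounded_diff.
have BN : vbounded (fun N p => cos (th N p) *: nu p - sin (th N p) *: t p).
  exact: vboundedB (vboundedZ bounded_cos_theta Bn) (vboundedZ bounded_sin_theta Bt).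
have Bv k := (approx_gram_schmidt_frame k).2; have Av k := (approx_gram_schmidt_frame k).1.
have [A B] := vapprox_row_frame (a := fun i N p => v' N p i) (a' := fun i _ p => v p i)
  BN Bv approx_normal Av a.
have [_ B'] := vapprox_row_frame (a := fun i _ p => v p i) (a' := fun i _ p => v p i)
  Bn Bv (vapprox_refl _) (fun k => vapprox_refl _) b.
apply: eq_approx (approx_dot B B' A (vapprox_refl _)) _ _ => N p _ cp.
  by rewrite mul_tr_frame.
by rewrite -mul_tr_frame frame_model//; exact: cube_O.
Qed.

Lemma corrugation_rotation :
  exists (C : R) (N0 : nat), forall N : nat, (0 < N)%N -> (N0 <= N)%N ->
  forall (O' : set chart) (l' : chart -> 'cV[R]_n.+1) (u' : chart -> chart)
    (V' : 'I_n -> chart -> chart),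
  adapted_frame O' l' u' V' ->
  forall p, cube p -> O' p ->
  let Bplus := adapted_basis f V (unit_normal f u V) p in
  let B' := adapted_basis (f' N) V (unit_normal (f' N) u' V') p in
  exists L : 'M[R]_n.+2,
    [/\ is_rotation L,
        B' = L *m Bplus,
        forall L' : 'M[R]_n.+2, B' = L' *m Bplus -> L' = L &
        forall a b, `|L a b - corner_rotation ((-1) ^+ n.+1 * theta f rho c u N p) a b|
                    <= C / N%:R].
Proof.
have [N1 HN1] := corrugation_wedge_neq0.
have [C [N2 HN2]] := approx_uniform (fun ab : 'I_n.+2 * 'I_n.+2 => approx_rotation ab.1 ab.2).
exists C, (maxn N1 N2) => N N0; rewrite geq_max => /andP[NN1 NN2] O' l' u' V' Ha p cp O'p.
have Op := cube_O cp; have [_ _ /(_ _ O'p)[_ _ _ d']] := Ha.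
have [_ _ _ d0] := base_adapted; have av := adapted_frame_at Op.
have nuE : unit_normal (f' N) u' V' p = nu' N p.
  exact: (unit_normal_frame ('d (f' N) p) d0 d').
have ob := adapted_orthonormal base_adapted (frame_wedge_neq0 Op) av.
have ob' := adapted_orthonormal base_adapted (HN1 _ _ N0 NN1 cp) av.
have [rot mapL uniq] := frame_rotation ob ob'.
rewrite /adapted_basis nuE unit_normal_nu//; eexists; split; [exact: rot|exact: mapL|exact: uniq|].
by move=> a b; rewrite theta_eq//; exact: (HN2 _ N0 NN2 p (a, b) cp).
Qed.

End CorrugationStep.

Theorem proposition23 (R : realType) (n : nat) (O : set 'rV[R]_n.+1)
    (O_open : open O) (cube_O : cube `<=` O) (S : nash_process O)
    (k j : nat) (j_lt : (j < nsteps S k)%N) (step_here : here S k j.+1) :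
  exists (C : R) (N0 : nat), forall N : nat, (0 < N)%N -> (N0 <= N)%N ->
  let n_ := unit_normal (f_ S k j) (u_ S k j.+1) (V_ S k j.+1) in
  let f' := corrugation (f_ S k j) (rho_ S k j.+1) (ell_ S k j.+1) (u_ S k j.+1)
              n_ N in
  forall (O' : set 'rV[R]_n.+1) (l' : 'rV[R]_n.+1 -> 'cV[R]_n.+1)
    (u' : 'rV[R]_n.+1 -> 'rV[R]_n.+1)
    (V' : 'I_n -> 'rV[R]_n.+1 -> 'rV[R]_n.+1),
  open O' -> adapted_frame O' l' u' V' ->
  forall p, cube p -> O' p ->
  let Bplus := adapted_basis (f_ S k j) (V_ S k j.+1) n_ p in
  let B' := adapted_basis f' (V_ S k j.+1) (unit_normal f' u' V') p in
  let th := theta (f_ S k j) (rho_ S k j.+1) (ell_ S k j.+1) (u_ S k j.+1) N p in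
  exists L : 'M[R]_n.+2,
    [/\ is_rotation L,
        B' = L *m Bplus,
        forall L' : 'M[R]_n.+2, B' = L' *m Bplus -> L' = L &
        forall a b, `|L a b - corner_rotation ((-1) ^+ n.+1 * th) a b|
                    <= C / N%:R].
Proof.
have jS := ltnW j_lt.
have [C [N0 H]] := corrugation_rotation O_open cube_O (f_C2 jS) (f_immersion jS)
  (frame_adapted step_here) (fun p => rho_ge0 (p := p) step_here) (sqrt_rho_C1 step_here).
exists C, N0 => N N_gt0 N0N n_ f' O' l' u' V' _ Ha p cp O'p.
exact: (H N N_gt0 N0N O' l' u' V' Ha p cp O'p).
Qed.
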